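(* Let $g\equiv0$. Assume conditions (A1-1), (A1-2), (A1-4), (A2-1), (A2-3'), (A3-2') and (A4) listed in the context, and let $w$ be the solution of the system (S) with the Robin/Neumann boundary operator; let $\phi,\Phi,\delta_0,\delta_1$ be as in the context. For $\varepsilon>0$ small enough put $$\lambda:=\underline{c}(1+\delta_0)-\varepsilon>0,\qquad C(\varepsilon):=\frac{\delta_1(1+\delta_0)}{\delta_0(1+\delta_1)}\Big(\frac{1+\delta_0}{1+\delta_1}\varepsilon\Big)^{-\frac{1+\delta_0}{\delta_0(1+\delta_1)}}.$$ Then for any $q\in[1,+\infty]$, with $q'=\frac{q}{q-1}$, the system is exponential $L^q$-ISS in $K_\Phi$-class with respect to boundary and in-domain disturbances $d$ and $f$ from the $L^q_{loc}(\mathbb{R}_+;K_\Phi(\partial\Omega))$- and $L^q_{loc}(\mathbb{R}_+;K_\Phi(\Omega))$-classes respectively, with the following estimate for all $T>0$: $$\int_\Omega\Phi(|w(x,T)|)\,dx\le e^{-\lambda T}\int_\Omega\Phi(|w^0|)\,dx+C(\varepsilon)\Big(\frac1{\lambda q'}\Big)^{\frac1{q'}}\Big(\int_0^T\Big(\int_{\partial\Omega}\Phi(|d|)\,dS\Big)^q dt\Big)^{\frac1q}+C(\varepsilon)\Big(\frac1{\lambda q'}\Big)^{\frac1{q'}}\Big(\int_0^T\Big(\int_{\Omega}\Phi(|f|)\,dx\Big)^q dt\Big)^{\frac1q}.$$ Moreover, the system is exponential $L^q$-ISS in $L^\Phi$-norm with respect to boundary and in-domain disturbances $d$ and $f$ from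 the $L^q_{loc}(\mathbb{R}_+;K_\Phi(\partial\Omega))$- and $L^q_{loc}(\mathbb{R}_+;K_\Phi(\Omega))$-classes respectively.
   Context: Notation. $\mathbb{R}_+=(0,\infty)$, $\mathbb{R}_{\ge0}=[0,\infty)$; $\Omega\subset\mathbb{R}^n$ ($n\ge1$) is a bounded domain with sufficiently smooth boundary $\partial\Omega$, $\boldsymbol{\nu}$ is the outer unit normal on $\partial\Omega$, $Q_T=\Omega\times(0,T)$. For $q=1$, $q'=\infty$ and $(1/(\lambda q'))^{1/q'}$ is read as $1$; for $q=\infty$, $q'=1$ and $(\int_0^T(\cdot)^q dt)^{1/q}$ is the essential supremum over $(0,T)$. $\mathcal{K}$ is the standard class of comparison functions. Data. $a,b_i,c,f,d\in C^2(\overline\Omega\times\mathbb{R}_{\ge0};\mathbb{R})$ ($i=1,\dots,n$), $h\in C^2(\overline\Omega\times\mathbb{R}_{\ge0}\times\mathbb{R}\times\mathbb{R}^n;\mathbb{R})$, $\psi\in C^2(\overline\Omega\times\mathbb{R}_{\ge0}\times\mathbb{R};\mathbb{R})$, $w^0\in C^2(\overline\Omega;\mathbb{R})$; $\mathbf{b}=(b_1,\dots,b_n)$. System (S) (with $g\equiv0$): $w_t-\operatorname{div}(a\nabla w)+\mathbf{b}\cdot\nabla w+cw+h(x,t,w,\nabla w)=f(x,t)$ in $\Omega\times\mathbb{R}_+$; $\mathscr{B}[w](x,t)=d(x,t)$ on $\partial\Omega\times\mathbb{R}_+$; $w(x,0)=w^0(x)$ in $\Omega$. The Robin/Neumann boundary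 operator is $\mathscr{B}[w]=a\frac{\partial w}{\partial\boldsymbol{\nu}}+\psi(x,t,w)$. The solution means the classical solution, $w\in C^{2,1}(Q_T)\cap C(\overline{Q}_T)$ for every $T>0$; classical solutions are considered so that all integrals and derivatives appearing make sense. Orlicz setting. $\phi\in C(\mathbb{R}_{\ge0};\mathbb{R}_{\ge0})\cap C^1(\mathbb{R}_+;\mathbb{R}_+)$, $\phi(0)=0$, satisfies $\delta_0\le\frac{s\phi'(s)}{\phi(s)}\le\delta_1$ for all $s>0$, with constants $\delta_0,\delta_1>0$; $\Phi(s)=\int_0^s\phi(\tau)d\tau$ for $s\ge0$. $K_\Phi(\omega)$ is the set of measurable $u$ on $\omega$ with $\int_\omega\Phi(|u|)dy<\infty$; $L^\Phi(\omega)$ is its linear hull with the Luxemburg norm $\|u\|_{L^\Phi(\omega)}=\inf\{k>0:\int_\omega\Phi(|u(y)|/k)dy\le1\}$. Conditions. (A1-1) $\underline{a}\le a(x,t)\le\overline{a}$ on $\overline\Omega\times\mathbb{R}_{\ge0}$, with positive constants $\underline{a},\overline{a}$. (A1-2) $|h|+|h_t|+|h_s|+(1+|\eta|)\sum_{i=1}^n|h_{\eta_i}|\le\mu_1(|s|)(1+|\eta|^2)$ at all $(x,t,s,\eta)\in\overline\Omega\times\mathbb{R}_{\ge0}\times\mathbb{R}\times\mathbb{R}^n$, where $\mu_1\in C(\mathbb{R}_{\ge0};\mathbb{R}_{\ge0})$ is increasing. (A1-4) $-\psi(x,t,s)s\le\mu_3(x,t)(s^2+1)$ on $\partial\Omega\times\mathbb{R}_{\ge0}\times\mathbb{R}$,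 with $\mu_3\in C(\partial\Omega\times\mathbb{R}_{\ge0};\mathbb{R})$. (A2-1) $-h(x,t,s,\eta)s\le\mu(x,t)s^2$ on $\Omega\times\mathbb{R}_+\times\mathbb{R}\times\mathbb{R}^n$, with $\mu\in C(\overline\Omega\times\mathbb{R}_{\ge0};\mathbb{R})$. (A2-3') There is a constant $\underline{c}>0$ with $\underline{c}\le c-\mu-\max\big\{\frac{\operatorname{div}\mathbf{b}}{1+\delta_0},\frac{\operatorname{div}\mathbf{b}}{1+\delta_1}\big\}$ on $\Omega\times\mathbb{R}_+$. (A3-2') $\psi_0(x,t):=\inf_{s\in\mathbb{R}\setminus\{0\}}\frac{\psi(x,t,s)+s\min\{\frac{\mathbf{b}\cdot\boldsymbol{\nu}}{1+\delta_0},\frac{\mathbf{b}\cdot\boldsymbol{\nu}}{1+\delta_1}\}}{s}$ exists and $\psi_0\ge\underline{\psi_0}$ on $\partial\Omega\times\mathbb{R}_+$, where $\underline{\psi_0}>0$ is a constant. (A4) $\mathscr{B}[w^0](x,0)=d(x,0)$ for $x\in\partial\Omega$. Definitions. For a set $\omega$ and measurable $v$ put $\mathcal{I}(v,\omega)=\big(\int_0^T(\int_\omega\Phi(|v|)dx)^q dt\big)^{1/q}$ (with surface measure if $\omega=\partial\Omega$). The system is exponential $L^q$-ISS in $K_\Phi$-class w.r.t. $d,f$ from the stated classes if there are constants $M_0,\lambda_0>0$ and $\gamma_0,\gamma_1\in\mathcal{K}$ (independent of $w^0,d,f$) such that for any $T>0$ the solution satisfies $\int_\Omega\Phi(|w(x,T)|)dx\le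 M_0e^{-\lambda_0T}\int_\Omega\Phi(|w^0|)dx+\gamma_0(\mathcal{I}(d,\partial\Omega))+\gamma_1(\mathcal{I}(f,\Omega))$. It is exponential $L^q$-ISS in $L^\Phi$-norm w.r.t. $d,f$ from the stated classes if there are such $M_0,\lambda_0,\gamma_0,\gamma_1$ with $\|w(\cdot,T)\|_{L^\Phi(\Omega)}\le M_0e^{-\lambda_0T}\|w^0\|_{L^\Phi(\Omega)}+\gamma_0(\mathcal{I}(d,\partial\Omega))+\gamma_1(\mathcal{I}(f,\Omega))$ for any $T>0$. *)

(* Defs.v *)
From HB Require Import structures.
From mathcomp Require Import all_boot all_order all_algebra.
From mathcomp Require Import all_classical all_reals all_analysis.
Import Order.TTheory GRing.Theory Num.Theory.
Import numFieldNormedType.Exports.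
Set Implicit Arguments.
Unset Strict Implicit.
Unset Printing Implicit Defensive.
Local Open Scope classical_set_scope.
Local Open Scope ring_scope.

(* Row vectors carry the sigma-algebra generated by the coordinate maps, as
   tuples do in the library; over the reals it is the Borel sigma-algebra. *)
Definition measure_row_display : measure_display -> measure_display.
Proof. exact. Qed.

Section measurable_row.
Context {d} {T : measurableType d} (n : nat).

Let coors : 'I_n -> 'rV[T]_n -> T := fun i x => x 0 i.

Let row_set0 : g_sigma_preimage coors set0.
Proof. exact: sigma_algebra0. Qed.

Let row_setC A : g_sigma_preimage coors A -> g_sigma_preimage coors (~` A).
Proof. exact: sigma_algebraC. Qed.

Let row_bigcup (F : _^nat) : (forall i, g_sigma_preimage coors (F i)) ->
  g_sigma_preimage coors (\bigcup_i (F i)).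
Proof. exact: sigma_algebra_bigcup. Qed.

HB.instance Definition _ := @isMeasurable.Build (measure_row_display d)
  'rV[T]_n (g_sigma_preimage coors) row_set0 row_setC row_bigcup.

End measurable_row.


Lemma measurable_row_coord d (T : measurableType d) n (i : 'I_n) :
  measurable_fun [set: 'rV[T]_n] (fun x => x 0 i).
Proof.
move=> _ Y mY; rewrite setTI; apply: sub_sigma_algebra => /=.
rewrite -bigcup_seq/=; exists i => /=; first by rewrite mem_index_enum.
by exists Y => //; rewrite setTI.
Qed.

Lemma measurable_fun_rowP d1 d2 (T1 : measurableType d1)
    (T2 : measurableType d2) n (f : T1 -> 'rV[T2]_n) :
  (forall i, measurable_fun [set: T1] (fun x => f x 0 i)) ->
  measurable_fun [set: T1] f.
Proof.
move=> mf.
have sub : g_sigma_preimage (fun i x => f x 0 i) `<=` measurable.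
  apply: smallest_sub; first exact: sigma_algebra_measurable.
  case: n => [|n] in f mf *; first by rewrite big_ord0.
  rewrite -bigcup_mkord_ord; apply: bigcup_sub => i Ii.
  by move=> A [B mB <-]; exact: mf.
move=> _ A mA; apply: sub.
pose coor := fun (i : 'I_n) (x : 'rV[T2]_n) => x 0 i.
by rewrite -[X in X _]/(g_sigma_preimage (fun i => coor i \o f))
  g_sigma_preimage_comp; exists A.
Qed.

Section row_cons.
Context {T : Type} (n : nat).

Definition row_cons (p : T * 'rV[T]_n) : 'rV[T]_n.+1 :=
  \row_i (if unlift ord0 i is Some j then p.2 0 j else p.1).

Definition row_behead (x : 'rV[T]_n.+1) : 'rV[T]_n :=
  \row_j x 0 (lift ord0 j).

Lemma row_consK : cancel row_cons (fun x => (x 0 ord0, row_behead x)).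
Proof.
move=> [t x] /=; rewrite mxE unlift_none; congr pair.
by apply/rowP => j; rewrite !mxE liftK.
Qed.

End row_cons.

Lemma measurable_row_cons d (T : measurableType d) n :
  measurable_fun [set: T * 'rV[T]_n] (@row_cons T n).
Proof.
apply: measurable_fun_rowP => i.
under eq_fun do rewrite mxE.
case: (unlift ord0 i) => [j|] /=; last exact: measurable_fst.
exact: (measurableT_comp (@measurable_row_coord _ T n j)).
Qed.

Lemma measurable_row_uncons d (T : measurableType d) n :
  measurable_fun [set: 'rV[T]_n.+1]
    (fun x : 'rV[T]_n.+1 => (x 0 ord0, row_behead x)).
Proof.
apply: measurable_fun_pair; first exact: measurable_row_coord.
apply: measurable_fun_rowP => i.
under eq_fun do rewrite mxE.
exact: measurable_row_coord.
Qed.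

Section lebesgue_row_step.
Context {R : realType} (n : nat) (mu : {sigma_finite_measure set 'rV[R]_n -> \bar R}).

Definition lebesgue_row_step : set 'rV[R]_n.+1 -> \bar R :=
  pushforward ((@lebesgue_measure R) \x mu)%E (@row_cons R n).

Let step0 : lebesgue_row_step set0 = 0%E.
Proof. by rewrite /lebesgue_row_step /pushforward preimage_set0 measure0. Qed.

Let step_ge0 A : (0 <= lebesgue_row_step A)%E.
Proof. by rewrite /lebesgue_row_step /pushforward; exact: measure_ge0. Qed.

Let step_sigma_additive : semi_sigma_additive lebesgue_row_step.
Proof.
have mcons A : measurable A -> measurable (@row_cons R n @^-1` A).
  by move=> mA; rewrite -[X in measurable X]setTI; exact: measurable_row_cons.
move=> F mF tF mUF; rewrite /lebesgue_row_step /pushforward preimage_bigcup.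
apply: measure_semi_sigma_additive.
- by move=> i; exact: mcons.
- apply/trivIsetP => /= i j _ _ ij; rewrite -preimage_setI.
  by move/trivIsetP : tF => /(_ _ _ _ _ ij) ->//; rewrite preimage_set0.
- by rewrite -preimage_bigcup; exact: mcons.
Qed.

HB.instance Definition _ := isMeasure.Build _ _ _ lebesgue_row_step
  step0 step_ge0 step_sigma_additive.

Let step_sigma_finite : sigma_finite [set: 'rV[R]_n.+1] lebesgue_row_step.
Proof.
have /sigma_finiteP[F [FT ndF Foo]] := sigma_finiteT (@lebesgue_measure R).
have /sigma_finiteP[G [GT ndG Goo]] := sigma_finiteT mu.
exists (fun k => (fun x : 'rV[R]_n.+1 => (x 0 ord0, row_behead x)) @^-1`
                 (F k `*` G k)).
  apply/esym/seteqP; split=> // x _.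
  have [i _ Fi] : (\bigcup_i F i) (x 0 ord0) by rewrite -FT.
  have [j _ Gj] : (\bigcup_i G i) (row_behead x) by rewrite -GT.
  exists (maxn i j) => //; split => /=.
  - by move: Fi; exact/subsetPset/ndF/leq_maxl.
  - by move: Gj; exact/subsetPset/ndG/leq_maxr.
move=> k; have [mF Fk] := Foo k; have [mG Gk] := Goo k; split.
  by rewrite -[X in measurable X]setTI; apply: measurable_row_uncons => //;
    exact: measurableX.
rewrite /lebesgue_row_step /pushforward -comp_preimage.
rewrite (_ : _ \o _ = id); last by apply/funext => p /=; rewrite row_consK.
by rewrite preimage_id product_measure1E// lte_mul_pinfty// ge0_fin_numE.
Qed.

HB.instance Definition _ := Measure_isSigmaFinite.Build _ _ _ lebesgue_row_step
  step_sigma_finite.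

End lebesgue_row_step.

Fixpoint lebesgue_row (R : realType) (n : nat) :
    {sigma_finite_measure set 'rV[R]_n -> \bar R} :=
  if n is n'.+1 then lebesgue_row_step (lebesgue_row R n') else \d_(0 : 'rV[R]_0).

Section euclidean.
Context {R : realType} {n : nat}.

Definition dotp (u v : 'rV[R]_n) : R := \sum_i u 0 i * v 0 i.

(* The library norm on row vectors is the sup norm. *)
Definition enorm (u : 'rV[R]_n) : R := Num.sqrt (dotp u u).

End euclidean.

Section regularity.
Context {R : realType} {V : normedModType R}.
Implicit Types (U : set V) (f g : V -> R).

Definition limit_from U g (p : V) : R := lim (g q @[q --> within U (nbhs p)]).

(* For U open: g is continuous on U (at p in U the limit can only be g p) and
   extends continuously, by limit_from U g, to the points of D. *)
Definition extends_to U (D : set V) g :=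
  forall p, D p -> cvg (g q @[q --> within U (nbhs p)]).

(* f is of class C^2 on the closure of the open set U: the derivatives up to
   order 2 exist in U and extend continuously to the closure. *)
Definition C2_closure U f :=
  [/\ {within closure U, continuous f},
      forall u p, U p -> derivable f p u,
      forall u, extends_to U (closure U) ('D_u f),
      forall u v p, U p -> derivable ('D_u f) p v
    & forall u v, extends_to U (closure U) ('D_v ('D_u f))].

End regularity.

Section domain.
Context {R : realType} {m : nat}.
Local Notation V := ('rV[R]_m.+1).
Implicit Types (Omega W : set V) (O : 'M[R]_m.+1) (gam : 'rV[R]_m -> R).

Definition bdry Omega : set V := closure Omega `\` interior Omega.

(* In the open set W and in the orthonormal coordinates y = x *m O, the set
   Omega is the part y_0 < gam (y_1, ..., y_m) under the graph of gam. *)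
Definition C2_chart Omega W O gam :=
  [/\ open W, O *m O^T = 1%:M, C2_closure setT gam
    & forall x, W x -> Omega x <-> (x *m O) 0 0 < gam (row_behead (x *m O))].

Definition smooth_bounded_domain Omega :=
  [/\ open Omega, connected Omega, Omega !=set0, bounded_set Omega
    & forall x, bdry Omega x -> exists W O gam, C2_chart Omega W O gam /\ W x].

Definition is_outer_normal Omega (x v : V) :=
  [/\ dotp v v = 1,
      forall u, dotp u v < 0 -> \forall s \near 0^'+, Omega (x + s *: u)
    & forall u, 0 < dotp u v -> \forall s \near 0^'+, ~ closure Omega (x + s *: u)].

Definition outer_normal Omega (x : V) : V := get (is_outer_normal Omega x).

Definition graph_point O gam (y : 'rV[R]_m) : V := row_cons (gam y, y) *m O^T.

(* dS = sqrt (1 + |grad gam|^2) dy in every chart, which determines sigma on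
   the boundary of Omega. *)
Definition is_surface_measure Omega (sigma : {measure set V -> \bar R}) :=
  forall W O gam (A : set V), C2_chart Omega W O gam -> measurable A ->
  A `<=` W `&` bdry Omega ->
  sigma A = (\int[lebesgue_row R m]_(y in graph_point O gam @^-1` A)
    (Num.sqrt (1 + \sum_(j < m) ('D_(delta_mx 0 j) gam y) ^+ 2))%:E)%E.

Definition cylinder Omega : set (V * R) := Omega `*` [set t | 0 < t].

Definition closed_cylinder Omega : set (V * R) :=
  closure Omega `*` [set t | 0 <= t].

Definition dx (i : 'I_m.+1) : V * R := (delta_mx 0 i, 0).

Definition dt : V * R := (0, 1).

Definition grad (w : V * R -> R) (p : V * R) : V := \row_i 'D_(dx i) w p.

Definition div (F : V * R -> V) (p : V * R) : R :=
  \sum_i 'D_(dx i) (fun p => F p 0 i) p.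

(* outer normal derivative on the lateral boundary, grad w being extended
   continuously from inside *)
Definition normal_derivative Omega (w : V * R -> R) (p : V * R) : R :=
  \sum_i limit_from (cylinder Omega) ('D_(dx i) w) p * outer_normal Omega p.1 0 i.

End domain.

Record system (R : realType) (m : nat) := System {
  sys_a : 'rV[R]_m.+1 * R -> R ;
  sys_b : 'rV[R]_m.+1 * R -> 'rV[R]_m.+1 ;
  sys_c : 'rV[R]_m.+1 * R -> R ;
  sys_h : 'rV[R]_m.+1 * R * R * 'rV[R]_m.+1 -> R ;
  sys_psi : 'rV[R]_m.+1 * R * R -> R }.

Section equation.
Context {R : realType} {m : nat}.
Local Notation V := ('rV[R]_m.+1).
Implicit Types (Omega : set V) (S : system R m) (d f w : V * R -> R).

Definition h_domain Omega : set (V * R * R * V) :=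
  cylinder Omega `*` setT `*` setT.

Definition system_C2 Omega S :=
  [/\ C2_closure (cylinder Omega) (sys_a S),
      forall i, C2_closure (cylinder Omega) (fun p => sys_b S p 0 i),
      C2_closure (cylinder Omega) (sys_c S),
      C2_closure (h_domain Omega) (sys_h S)
    & C2_closure (cylinder Omega `*` setT) (sys_psi S)].

Definition robin Omega S (w : V * R -> R) (p : V * R) : R :=
  sys_a S p * normal_derivative Omega w p + sys_psi S (p, w p).

(* The initial and disturbance data, with the compatibility condition
   B[w0](x,0) = d(x,0). *)
Definition admissible_data Omega S (w0 : V -> R) d f :=
  [/\ C2_closure Omega w0, C2_closure (cylinder Omega) d,
      C2_closure (cylinder Omega) f
    & forall x, bdry Omega x ->
        robin Omega S (fun p => w0 p.1) (x, 0) = d (x, 0)].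

Definition C21 (U : set (V * R)) w :=
  [/\ forall p, U p -> {for p, continuous w},
      forall p, U p -> derivable w p dt /\ {for p, continuous ('D_dt w)},
      forall i p, U p ->
        derivable w p (dx i) /\ {for p, continuous ('D_(dx i) w)}
    & forall i j p, U p -> derivable ('D_(dx i) w) p (dx j) /\
        {for p, continuous ('D_(dx j) ('D_(dx i) w))}].

(* The boundary condition presupposes that the spatial gradient has a trace on
   the lateral boundary, for positive times. *)
Definition classical_solution Omega S (w0 : V -> R) d f w :=
  [/\ C21 (cylinder Omega) w,
      {within closed_cylinder Omega, continuous w}
    & forall i, extends_to (cylinder Omega) (bdry Omega `*` [set t | 0 < t])
        ('D_(dx i) w)] /\
  [/\ forall p, cylinder Omega p ->
        'D_dt w p - div (fun q => sys_a S q *: grad w q) p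
        + dotp (sys_b S p) (grad w p) + sys_c S p * w p
        + sys_h S (p, w p, grad w p) = f p,
      forall x t, bdry Omega x -> 0 < t -> robin Omega S w (x, t) = d (x, t)
    & forall x, Omega x -> w (x, 0) = w0 x].

End equation.

Section conditions.
Context {R : realType} {m : nat}.
Local Notation V := ('rV[R]_m.+1).
Implicit Types (Omega : set V) (S : system R m).

Definition condA11 Omega S (alo ahi : R) :=
  [/\ 0 < alo, 0 < ahi
    & forall p, closed_cylinder Omega p -> alo <= sys_a S p <= ahi].

Definition h_t : V * R * R * V := (0, 1, 0, 0).
Definition h_s : V * R * R * V := (0, 0, 1, 0).
Definition h_eta (i : 'I_m.+1) : V * R * R * V := (0, 0, 0, delta_mx 0 i).

Definition condA12 Omega S (mu1 : R -> R) :=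
  let dh u := limit_from (h_domain Omega) ('D_u (sys_h S)) in
  [/\ {within [set s | 0 <= s], continuous mu1},
      forall s, 0 <= s -> 0 <= mu1 s,
      {in [pred s | 0 <= s] &, {homo mu1 : s s' / s <= s'}}
    & forall p s eta, closed_cylinder Omega p ->
        let P := (p, s, eta) in
        `|sys_h S P| + `|dh h_t P| + `|dh h_s P|
        + (1 + enorm eta) * (\sum_i `|dh (h_eta i) P|)
        <= mu1 `|s| * (1 + enorm eta ^+ 2)].

Definition condA14 Omega S (mu3 : V * R -> R) :=
  let D := bdry Omega `*` [set t : R | 0 <= t] in
  {within D, continuous mu3} /\
  forall p s, D p -> - sys_psi S (p, s) * s <= mu3 p * (s ^+ 2 + 1).

Definition condA21 Omega S (mu : V * R -> R) :=
  {within closed_cylinder Omega, continuous mu} /\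
  forall p s eta, cylinder Omega p ->
    - sys_h S (p, s, eta) * s <= mu p * s ^+ 2.

Definition condA23 Omega S (mu : V * R -> R) (delta0 delta1 clo : R) :=
  0 < clo /\ forall p, cylinder Omega p ->
    clo <= sys_c S p - mu p - Num.max (div (sys_b S) p / (1 + delta0))
                                      (div (sys_b S) p / (1 + delta1)).

Definition condA32 Omega S (delta0 delta1 psilo : R) :=
  0 < psilo /\ forall x t, bdry Omega x -> 0 < t ->
    let bnu := dotp (sys_b S (x, t)) (outer_normal Omega x) in
    let E := [set (sys_psi S (x, t, s)
                   + s * Num.min (bnu / (1 + delta0)) (bnu / (1 + delta1))) / s
             | s in [set s | s != 0]] in
    has_inf E /\ psilo <= inf E.

End conditions.

Section orlicz.
Context {R : realType}.
Implicit Types (phi Phi : R -> R).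

Definition orlicz_density phi (delta0 delta1 : R) :=
  [/\ {within [set s | 0 <= s], continuous phi}, phi 0 = 0,
      forall s, 0 < s ->
        [/\ 0 < phi s, derivable phi s 1 & {for s, continuous (derive1 phi)}],
      0 < delta0 /\ 0 < delta1
    & forall s, 0 < s -> delta0 <= s * derive1 phi s / phi s <= delta1].

Definition orlicz_primitive phi (s : R) : R :=
  \int[lebesgue_measure]_(t in `[0, s]) phi t.

Context {d : measure_display} {T : measurableType d}.
Variable mu : {measure set T -> \bar R}.

Definition modular Phi (D : set T) (u : T -> R) : \bar R :=
  (\int[mu]_(x in D) (Phi `|u x|)%:E)%E.

Definition luxemburg Phi (D : set T) (u : T -> R) : R :=
  inf [set k | 0 < k /\ (modular Phi D (fun x => u x / k)%R <= 1)%E].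

(* ( int_0^T ( int_D Phi(|v|) )^q dt )^(1/q), an essential supremum if q = +oo *)
Definition Lq_modular Phi (D : set T) (q : \bar R) (v : T * R -> R) (tau : R) :
    \bar R :=
  ('N[lebesgue_measure]_q
    [(fun t => modular Phi D (fun x => v (x, t))) \_ `]0%R, tau[ ])%E.

Definition Lq_loc_class Phi (D : set T) (q : \bar R) (v : T * R -> R) :=
  forall tau, 0 < tau -> (Lq_modular Phi D q v tau < +oo)%E.

Definition class_K (gamma : R -> R) :=
  [/\ {within [set s | 0 <= s], continuous gamma}, gamma 0 = 0
    & {in [pred s | 0 <= s] &, {homo gamma : s s' / s < s'}}].

(* (1/(lam q'))^(1/q') with q' = q/(q-1) *)
Definition conjugate_factor (lam : R) (q : \bar R) : R :=
  match q with
  | q%:E => if q == 1 then 1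
            else let q' := q / (q - 1) in (1 / (lam * q')) `^ (1 / q')
  | +oo%E => 1 / lam
  | -oo%E => 0
  end.

End orlicz.

Section iss.
Context {R : realType} {m : nat}.
Local Notation V := ('rV[R]_m.+1).
Variables (Omega : set V) (sigma : {measure set V -> \bar R}) (S : system R m).
Variables (Phi : R -> R) (q : \bar R).
Local Notation leb := (lebesgue_row R m.+1).

(* w solves the system for data w0, d, f, with d and f in the L^q_loc(K_Phi)
   classes *)
Definition disturbed_solution w0 d f w :=
  [/\ admissible_data Omega S w0 d f, classical_solution Omega S w0 d f w,
      Lq_loc_class sigma Phi (bdry Omega) q d
    & Lq_loc_class leb Phi Omega q f].

Definition ISS_gain (gamma0 gamma1 : R -> R) (d f : V * R -> R) (T : R) : R :=
  gamma0 (fine (Lq_modular sigma Phi (bdry Omega) q d T))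
  + gamma1 (fine (Lq_modular leb Phi Omega q f T)).

Definition exp_ISS_class :=
  exists (M0 lam0 : R) (gamma0 gamma1 : R -> R),
  [/\ 0 < M0, 0 < lam0, class_K gamma0, class_K gamma1
    & forall w0 d f w, disturbed_solution w0 d f w -> forall T, 0 < T ->
      (modular leb Phi Omega (fun x => w (x, T))
       <= (M0 * expR (- lam0 * T))%:E * modular leb Phi Omega w0
          + (ISS_gain gamma0 gamma1 d f T)%:E)%E].

Definition exp_ISS_norm :=
  exists (M0 lam0 : R) (gamma0 gamma1 : R -> R),
  [/\ 0 < M0, 0 < lam0, class_K gamma0, class_K gamma1
    & forall w0 d f w, disturbed_solution w0 d f w -> forall T, 0 < T ->
      luxemburg leb Phi Omega (fun x => w (x, T))
      <= M0 * expR (- lam0 * T) * luxemburg leb Phi Omega w0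
         + ISS_gain gamma0 gamma1 d f T].

End iss.

(* Main.v *)
(* Replace Phi |s| by the smooth P(s) = Phi (sqrt (s^2 + e^2)) and let e -> 0 at the end. Testing the
   equation with P'(w), the index bounds (1 + d0) Phi s <= s phi s <= (1 + d1) Phi s turn (A2-1),
   (A2-3') and (A3-2') into decay of the integral of P(w) at the rate clo (1 + d0),
       but leave nothing
   in the interior with which to absorb the in-domain disturbance by Young's inequality. The missing
   term comes from a Robin-Poincare inequality: add theta x_0 P(w) e_0, theta small, to the energy
   flux. Its divergence contains theta P(w); the cross term is absorbed by the ellipticity term and
   the boundary contribution by psilo > 0. So the rate is exactly clo (1 + d0),
       with some constant C0
   which does not depend on phi beyond d0 and d1. Since C eps -> +oo as eps -> 0,
       the stated estimate
   follows for small eps, by Hoelder's inequality in time.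

   For the Luxemburg norm, the same estimate is applied to the density phi (s / k) / k,
       which has the
   same indices, hence the same C0, and whose primitive is Phi (s / k).

   The divergence theorem is replaced by C^1 cutoffs eta_k -> 1 vanishing near the complement of
   Omega, with the integrals of |grad eta_k| bounded, such that - grad eta_k dx -> nu dS weakly;
       they
   are glued from boundary charts. *)

Require Import Defs.
From mathcomp Require Import all_boot all_order all_algebra.
From mathcomp Require Import all_classical all_reals all_analysis.
From mathcomp Require Import measurable_realfun ess_sup_inf ring lra.
Import Order.TTheory GRing.Theory Num.Theory.
Import numFieldNormedType.Exports.
Set Implicit Arguments.
Unset Strict Implicit.
Unset Printing Implicit Defensive.
Local Open Scope classical_set_scope.
Local Open Scope ring_scope.

(** * Lebesgue measure on row vectors *)

(** The solution is twice differentiable only inside the cylinder: its gradient has a trace on the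
    lateral boundary for positive times, but its second derivatives may be unbounded near the
    boundary, and nothing beyond continuity is known at time 0. This shapes the energy argument. The
    divergence of the flux is never integrated up to the boundary; it is multiplied by a cutoff and
    integrated by parts at once, so that only the flux itself, continuous up to the boundary, meets
    the limit of the cutoffs. The inequality in time is first proved on [[s, T]] with [s > 0], and
    [s] then tends to 0 by continuity of the energy. The parameter [e] is there because [phi] is C^1
    only on the open half line and its derivative may blow up at 0. Each exchange of [w ^+ 2] for
    [w ^+ 2 + e ^+ 2] costs a term [e * K], where [K] may depend on the solution and on [phi], since
    it disappears with [e]. The surface measure is known only through rotated charts, which is why
    the invariance of the Lebesgue measure under orthogonal maps comes before any boundary
    integral. *)

Section row_topology.
Context {R : realType}.

(** The norm is the sup norm. The conjunct [0 < e] matters when [n = 0], where the condition on the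
    coordinates is vacuous. *)
Lemma row_ballP n (x y : 'rV[R]_n) (e : R) :
  ball x e y <-> 0 < e /\ forall i, `|x 0 i - y 0 i| < e.
Proof.
rewrite mx_norm_ball /ball_ /=; split => [h|[e0 h]].
  split; first exact: le_lt_trans (normr_ge0 _) h.
  move=> i; apply: le_lt_trans h.
  have -> : x 0 i - y 0 i = (x - y) 0 i by rewrite !mxE.
  rewrite [in leRHS]/Num.norm /= mx_normrE.
  by rewrite (le_trans _ (@le_bigmax _ _ _ _ (fun p => `|(x - y) p.1 p.2|) (0, i)))//=.
rewrite {1}/Num.norm /= mx_normrE; apply/bigmax_ltP; split => // -[i j] _ /=.
by rewrite ord1 !mxE.
Qed.

(** Measurability of rows is generated by the coordinate maps, so it has to be shown that Borel sets
    are measurable: an open set is the union of the countably many boxes with rational centre and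
    radius [1 / (k + 1)] that it contains. *)
Lemma open_measurable_row n (U : set 'rV[R]_n) : open U -> measurable U.
Proof.
move=> oU.
pose box (p : 'rV[rat]_n * nat) :=
  [set x : 'rV[R]_n | forall i, x 0 i \in `]ratr (p.1 0 i) - p.2.+1%:R^-1,
      ratr (p.1 0 i) + p.2.+1%:R^-1[].
pose P p := `[< box p `<=` U >].
have -> : U = \bigcup_(p in [set p | P p]) box p.
  apply/seteqP; split => [x Ux|x [p /asboolP Pp]]; last exact: Pp.
  have /nbhs_ballP[e /= e0 he] := open_nbhs_nbhs (conj oU Ux).
  (* The rational centre will be within [1 / (k + 1)] of [x]; half of [e] keeps the whole box within
     [e] of [x]. *)
  have [k hk] : exists k, (k.+1%:R^-1 : R) < e / 2.
    have e2 : 0 < (e / 2)^-1 by rewrite invr_gt0 divr_gt0.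
    exists (Num.bound (e / 2)^-1).
    rewrite -[ltRHS]invrK ltf_pV2 ?posrE//.
    by rewrite (lt_le_trans (archi_boundP (ltW e2)))// ler_nat.
  have qP i : exists q : rat, `|x 0 i - ratr q| < k.+1%:R^-1.
    have [||z [h [q _ qz]]] := @dense_rat R (ball (x 0 i) k.+1%:R^-1).
    - by exists (x 0 i); exact: ballxx.
    - exact: ball_open.
    by exists q; rewrite qz.
  pose q := \row_i projT1 (cid (qP i)).
  have hq i : `|x 0 i - ratr (q 0 i)| < k.+1%:R^-1.
    by rewrite /q mxE; case: cid.
  exists (q, k).
    apply/asboolP => y hy; apply: he; apply/row_ballP; split => // i.
    have := hy i; rewrite /= in_itv /= => /andP[h1 h2].
    have := hq i; rewrite !ltr_norml => /andP[h3 h4].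
    move: (k.+1%:R^-1) (ratr _) (x 0 i) (y 0 i) hk h1 h2 h3 h4 => d r u v hk h1 h2 h3 h4.
    by apply/andP; split; lra.
  move=> i; rewrite in_itv /=; have := hq i; rewrite ltr_norml.
  move: (k.+1%:R^-1) (ratr _) (x 0 i) => d r u /andP[h3 h4].
  by apply/andP; split; lra.
rewrite bigcup_mkcond; apply: countable_bigcupT_measurable => [|p]; first exact: countableP.
case: ifPn => _; last exact: measurable0.
have -> : box p = \bigcap_(i in [set: 'I_n]) ((fun x : 'rV[R]_n => x 0 i) @^-1`
   [set` `]ratr (p.1 0 i) - p.2.+1%:R^-1, ratr (p.1 0 i) + p.2.+1%:R^-1[]).
  by apply/seteqP; split => x h i; [move=> _; exact: h|exact: h].
apply: fin_bigcap_measurable; first exact: finite_finset.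
move=> i _; rewrite -[X in measurable X]setTI.
by apply: measurable_row_coord => //; exact: measurableT.
Qed.

Lemma closed_measurable_row n (U : set 'rV[R]_n) : closed U -> measurable U.
Proof.
by move=> cU; rewrite -(setCK U); apply: measurableC; apply: open_measurable_row;
    exact: closed_openC.
Qed.

Lemma within_continuous_measurable_row n (D : set 'rV[R]_n) (f : 'rV[R]_n -> R) :
  measurable D -> {within D, continuous f} -> measurable_fun D f.
Proof.
move=> mD /continuousP cf; apply: (measurability _ (RGenOpens.measurableE R)).
move=> _ [_ [a [b ->] <-]].
have := cf _ (@interval_open _ (BRight a) (BLeft b) isT isT).
move/open_subspaceP => [V oV VE].
rewrite setIC -VE; apply: measurableI => //; exact: open_measurable_row.
Qed.

Lemma continuous_measurable_row n (f : 'rV[R]_n -> R) :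
  continuous f -> measurable_fun setT f.
Proof.
move=> cf; apply: within_continuous_measurable_row => //.
exact: continuous_subspaceT.
Qed.

End row_topology.

Section row_integral.
Context {R : realType}.
Local Notation leb1 := (@lebesgue_measure R).

Lemma measurable_row_consE n (f : 'rV[R]_n.+1 -> \bar R) :
  measurable_fun setT f -> measurable_fun setT (f \o @row_cons R n).
Proof. by move=> mf; apply: (measurableT_comp mf); exact: measurable_row_cons. Qed.

Lemma integral_row_cons n (f : 'rV[R]_n.+1 -> \bar R) :
  measurable_fun setT f -> (forall x, 0 <= f x)%E ->
  (\int[lebesgue_row R n.+1]_x f x =
   \int[leb1]_t \int[lebesgue_row R n]_y f (row_cons (t, y)))%E.
Proof.
move=> mf f0.
rewrite /= /lebesgue_row_step ge0_integral_pushforward//; last exact: measurable_row_cons.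
rewrite preimage_setT (@fubini_tonelli1 _ _ _ _ _ leb1 (lebesgue_row R n) (f \o @row_cons R n))//.
  exact: measurable_row_consE.
by move=> x; exact: f0.
Qed.

Lemma integral_row0 (f : 'rV[R]_0 -> \bar R) :
  measurable_fun setT f -> (\int[lebesgue_row R 0]_x f x = f 0%R)%E.
Proof. by move=> mf; rewrite /= integral_dirac//= diracT mul1e. Qed.

(** The condition [|s| = 1] leaves translations and reflections, all that the Haar argument below
    uses. Preimages of half-open intervals are intervals of the same length, and these values
    determine the measure. *)
Lemma lebesgue_measure_affine (s a : R) (A : set R) : `|s| = 1 -> measurable A ->
  leb1 ((fun x => s * x + a) @^-1` A) = leb1 A.
Proof.
move=> s1 mA.
have mf : measurable_fun setT (fun x : measurableTypeR R => s * x + a : measurableTypeR R).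
  by apply: measurable_funD => //; exact: measurable_funM.
rewrite -[LHS]/(pushforward leb1 (fun x : measurableTypeR R => s * x + a : measurableTypeR R) A).
apply/esym/lebesgue_measure_unique => //= _ [[u v]] _ <-; rewrite /pushforward /=.
have /orP[/eqP sE|/eqP sE] : (s == 1) || (s == -1).
  by move/eqP: s1; rewrite eqr_norml ler01 andbT.
- have -> : (fun x => s * x + a) @^-1` [set` `]u, v]] = `]u - a, v - a]%classic.
    by apply/seteqP; split => x /=; rewrite !in_itv/= sE => /andP[? ?]; apply/andP; split; lra.
  rewrite !lebesgue_measure_itv/= !lte_fin ltrD2r.
  by case: ifP => // _; rewrite -!EFinB; congr EFin; ring.
- have -> : (fun x => s * x + a) @^-1` [set` `]u, v]] = `[a - v, a - u[%classic.
    by apply/seteqP; split => x /=; rewrite !in_itv/= sE => /andP[? ?]; apply/andP; split; lra.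
  rewrite !lebesgue_measure_itv/= !lte_fin ltrD2l ltrN2.
  by case: ifP => // _; rewrite -!EFinB; congr EFin; ring.
Qed.

Lemma integral_lebesgue_affine (s a : R) (f : R -> \bar R) : `|s| = 1 ->
  measurable_fun setT f -> (forall x, 0 <= f x)%E ->
  (\int[leb1]_x f (s * x + a)%R = \int[leb1]_x f x)%E.
Proof.
move=> s1 mf f0.
have mg : measurable_fun setT (fun x : measurableTypeR R => s * x + a : measurableTypeR R).
  by apply: measurable_funD => //; exact: measurable_funM.
transitivity (\int[pushforward leb1 (fun x : measurableTypeR R =>
    (s * x + a)%R : measurableTypeR R)]_y f y)%E.
  by rewrite ge0_integral_pushforward// preimage_setT.
by apply: eq_measure_integral => A mA _; rewrite -[LHS]/(leb1 _) lebesgue_measure_affine.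
Qed.

Lemma measurable_row_affine n (s : R) (a : 'rV[R]_n) :
  measurable_fun setT (fun x : 'rV[R]_n => s *: x + a).
Proof.
apply: measurable_fun_rowP => i; under eq_fun do rewrite !mxE.
apply: measurable_funD => //; apply: measurable_funM => //.
exact: measurable_row_coord.
Qed.

(** By induction on the dimension, under Tonelli: the one-dimensional case treats the first
    coordinate, the induction hypothesis the others. *)
Lemma integral_row_affine n (s : R) (a : 'rV[R]_n) (f : 'rV[R]_n -> \bar R) : `|s| = 1 ->
  measurable_fun setT f -> (forall x, 0 <= f x)%E ->
  (\int[lebesgue_row R n]_x f (s *: x + a)%R = \int[lebesgue_row R n]_x f x)%E.
Proof.
move=> s1; elim: n => [|n IH] in a f *; move=> mf f0.
  have mg : measurable_fun setT (fun x : 'rV[R]_0 => f (s *: x + a)).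
    exact: (measurableT_comp mf (measurable_row_affine s a)).
  by rewrite !integral_row0//; congr f; apply/rowP => -[].
have mg : measurable_fun setT (fun x : 'rV[R]_n.+1 => f (s *: x + a)).
  exact: (measurableT_comp mf (measurable_row_affine s a)).
rewrite (integral_row_cons mg (fun x => f0 _)) (integral_row_cons mf f0).
pose G (t : R) := (\int[lebesgue_row R n]_y f (row_cons (t, y)))%E.
have mfc : measurable_fun setT (f \o @row_cons R n) by exact: measurable_row_consE.
have mG : measurable_fun setT G.
  apply: (@measurable_fun_fubini_tonelli_F _ _ _ _ _ (lebesgue_row R n) (f \o @row_cons R n)) => //.
  by move=> x; exact: f0.
have G0 x : (0 <= G x)%E by apply: integral_ge0.
rewrite -[RHS]/(\int[leb1]_t G t)%E -(@integral_lebesgue_affine s (a 0 ord0) G s1 mG G0).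
apply: eq_integral => t _; rewrite /G.
rewrite -[RHS](IH (row_behead a))//; last exact: (measurableT_comp mfc (pair1_measurable _)).
apply: eq_integral => y _; congr f.
apply/rowP => i; rewrite !mxE; case: unliftP => [j ->|->] /=; rewrite ?mxE//.
Qed.

Lemma integral_row_translate n (a : 'rV[R]_n) (f : 'rV[R]_n -> \bar R) :
  measurable_fun setT f -> (forall x, 0 <= f x)%E ->
  (\int[lebesgue_row R n]_x f (x + a)%R = \int[lebesgue_row R n]_x f x)%E.
Proof.
move=> mf f0; rewrite -[RHS](@integral_row_affine n 1 a) ?normr1//.
by apply: eq_integral => x _; rewrite scale1r.
Qed.

Lemma integral_row_reflect n (a : 'rV[R]_n) (f : 'rV[R]_n -> \bar R) :
  measurable_fun setT f -> (forall x, 0 <= f x)%E ->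
  (\int[lebesgue_row R n]_x f (a - x)%R = \int[lebesgue_row R n]_x f x)%E.
Proof.
move=> mf f0; rewrite -[RHS](@integral_row_affine n (-1) a) ?normrN1//.
by apply: eq_integral => x _; rewrite scaleN1r addrC.
Qed.

Definition row_box n (r : R) : set 'rV[R]_n := [set x | forall i, `|x 0 i| <= r].
Arguments row_box n r : clear implicits.

Lemma measurable_row_box n r : measurable (row_box n r).
Proof.
have -> : row_box n r = \bigcap_(i in [set: 'I_n]) ((fun x : 'rV[R]_n => x 0 i) @^-1`
   [set` `[- r, r]]).
  apply/seteqP; split => x h i; first by move=> _ /=; rewrite in_itv/= -ler_norml; exact: h.
  by have := h i I; rewrite /= in_itv/= -ler_norml.
apply: fin_bigcap_measurable; first exact: finite_finset.
move=> i _; rewrite -[X in measurable X]setTI.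
by apply: measurable_row_coord => //; exact: measurableT.
Qed.

Lemma lebesgue_row_box n (r : R) : 0 <= r -> lebesgue_row R n (row_box n r) = ((2 * r) ^+ n)%:E.
Proof.
move=> r0; elim: n => [|n IH].
  by rewrite /= diracE mem_set// => -[].
rewrite /= /lebesgue_row_step /pushforward.
have -> : @row_cons R n @^-1` row_box n.+1 r = `[- r, r]%classic `*` row_box n r.
  apply/seteqP; split => [[t y] h|[t y] [/= h1 h2]].
    split => /=; first by have := h ord0; rewrite /= mxE unlift_none/= in_itv/= -ler_norml.
    by move=> i; have := h (lift ord0 i); rewrite mxE liftK.
  move=> i; rewrite mxE; case: unliftP => [j _|_] /=; first exact: h2.
  by move: h1; rewrite in_itv/= -ler_norml.
rewrite product_measure1E//; last exact: measurable_row_box.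
rewrite IH [X in (X * _)%E](_ : _ = (2 * r)%:E) -?EFinM ?exprS//.
have := @lebesgue_measure_itv R `[- r, r]; rewrite /= lte_fin => ->.
case: ltP => h; first by rewrite -EFinB; congr EFin; ring.
by congr EFin; clear IH; move: r r0 h => r r0 h; lra.
Qed.

Lemma bounded_subset_box n (A : set 'rV[R]_n) : bounded_set A ->
  exists2 r, 0 < r & A `<=` row_box n r.
Proof.
move=> [M [Mr h]].
have M1 : M < `|M| + 1 by rewrite (le_lt_trans (ler_norm _))// ltrDl.
exists (`|M| + 1); first by rewrite ltr_wpDl.
move=> x Ax i; apply: le_trans (h _ M1 x Ax).
rewrite [in leRHS]/Num.norm /= mx_normrE.
by rewrite (le_trans _ (@le_bigmax _ _ _ _ (fun p => `|x p.1 p.2|) (0, i)))//=.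
Qed.

Lemma box_bounded n r : bounded_set (row_box n r).
Proof.
exists (Num.max 0 r); split; first by rewrite num_real.
move=> M hM x hx; apply: le_trans (ltW hM).
rewrite /Num.norm /= mx_normrE; apply/bigmax_leP; split; first by rewrite le_max lexx.
by move=> -[i j] _ /=; rewrite ord1 le_max hx orbT.
Qed.

Lemma bounded_lebesgue_row n (A : set 'rV[R]_n) : measurable A -> bounded_set A ->
  (lebesgue_row R n A < +oo)%E.
Proof.
move=> mA /bounded_subset_box[r r0 Ar].
apply: (@le_lt_trans _ _ (lebesgue_row R n (row_box n r))).
  by apply: le_measure => //; rewrite inE//; exact: measurable_row_box.
by rewrite lebesgue_row_box ?ltW// ltry.
Qed.


Lemma lebesgue_row_box_gt0 n (r : R) : 0 < r -> (0 < lebesgue_row R n (row_box n r))%E.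
Proof. by move=> r0; rewrite lebesgue_row_box ?ltW// lte_fin exprn_gt0// mulr_gt0. Qed.

Lemma measurable_row_mulmx n (O : 'M[R]_n) : measurable_fun setT (fun x : 'rV[R]_n => x *m O).
Proof.
apply: measurable_fun_rowP => i; under eq_fun do rewrite mxE.
apply: measurable_sum => j; apply: measurable_funM => //.
exact: measurable_row_coord.
Qed.

(** The Euclidean unit ball rather than a box: it serves as the reference set that orthogonal maps
    preserve. *)
Definition row_ball n : set 'rV[R]_n := [set x | dotp x x <= 1].
Arguments row_ball n : clear implicits.

Lemma measurable_row_ball n : measurable (row_ball n).
Proof.
have mf : measurable_fun setT (fun x : 'rV[R]_n => dotp x x).
  by apply: measurable_sum => j; apply: measurable_funM; exact: measurable_row_coord.
have := mf measurableT `]-oo, 1]%classic (measurable_itv _).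
by rewrite setTI; congr measurable; apply/seteqP; split => x /=; rewrite in_itv.
Qed.

Lemma lebesgue_row_ball_gt0 n : (0 < lebesgue_row R n (row_ball n))%E.
Proof.
(* This box fits in the ball: [n] squares of coordinates, each at most [1 / (n + 1)], sum to at most
   1. *)
apply: (@lt_le_trans _ _ (lebesgue_row R n (row_box n (n.+1%:R^-1)))).
  by apply: lebesgue_row_box_gt0; rewrite invr_gt0.
apply: le_measure; rewrite ?inE; [exact: measurable_row_box|exact: measurable_row_ball|].
move=> x hx; rewrite /row_ball /dotp /=.
apply: (@le_trans _ _ (\sum_(i < n) n.+1%:R^-1)).
  apply: ler_sum => i _; rewrite -expr2 -real_normK ?num_real//.
  apply: (@le_trans _ _ (n.+1%:R^-1 ^+ 2)).
    by rewrite lerXn2r ?nnegrE ?invr_ge0//; exact: hx.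
  by rewrite expr2 ger_pMr ?invr_gt0// invf_le1// ler1n.
by rewrite sumr_const card_ord -(mulr_natl _ n) ler_pdivrMr// mul1r ler_nat.
Qed.

Lemma lebesgue_row_ball_lty n : (lebesgue_row R n (row_ball n) < +oo)%E.
Proof.
apply: bounded_lebesgue_row; first exact: measurable_row_ball.
have [M [Mr h]] := box_bounded n 1; exists M; split => // t Mt x hx.
apply: h => // i; rewrite -(@expr_le1 _ 2)// real_normK ?num_real// expr2.
apply: le_trans hx; rewrite /dotp (bigD1 i)//= lerDl.
by apply: sumr_ge0 => j _; rewrite -expr2 sqr_ge0.
Qed.

Lemma dotp_mulmx n (O : 'M[R]_n) x y : O *m O^T = 1%:M -> dotp (x *m O) (y *m O) = dotp x y.
Proof.
move=> OO; have E (u v : 'rV[R]_n) : dotp u v = (u *m v^T) 0 0.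
  by rewrite mxE; apply: eq_bigr => i _; rewrite mxE.
by rewrite !E trmx_mul mulmxA -(mulmxA x) OO mulmx1.
Qed.

(* The uniqueness argument for Haar measure: integrating 1_A (x O) 1_B (y + x O) in both orders shows
   that the image of the measure under O is proportional to the measure, and the unit ball B, which
   O preserves, gives the ratio 1. *)
Lemma lebesgue_row_orthogonal n (O : 'M[R]_n) (A : set 'rV[R]_n) :
  O *m O^T = 1%:M -> measurable A ->
  lebesgue_row R n ((fun x => x *m O) @^-1` A) = lebesgue_row R n A.
Proof.
move=> OO mA; pose B := row_ball n; have mB : measurable B by exact: measurable_row_ball.
pose L (x : 'rV[R]_n) := x *m O; have mL : measurable_fun setT L by exact: measurable_row_mulmx.
have LK y : L (y *m O^T) = y by rewrite /L -mulmxA (mulmx1C OO) mulmx1.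
have mpre C : measurable C -> measurable (L @^-1` C).
  by move=> mC; rewrite -[X in measurable X]setTI; exact: mL.
have E C : measurable C -> lebesgue_row R n C = (\int[lebesgue_row R n]_x (\1_C x)%:E)%E.
  by move=> mC; rewrite integral_indic// setIT.
have m1 C : measurable C -> measurable_fun setT (fun x : 'rV[R]_n => (\1_C x)%:E : \bar R).
  by move=> mC; apply/measurable_EFinP; exact: measurable_indic.
have p1 C x : (0 <= (\1_C x)%:E :> \bar R)%E by rewrite lee_fin.
suff : (lebesgue_row R n (L @^-1` A) * lebesgue_row R n B =
        lebesgue_row R n (L @^-1` B) * lebesgue_row R n A)%E.
  have -> : L @^-1` B = B.
    by apply/seteqP; split => x; rewrite /B /row_ball /preimage /= dotp_mulmx.
  rewrite muleC; move/(congr1 (fun z => ((fine (lebesgue_row R n B))^-1%:E * z)%E)).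
  have Bf : lebesgue_row R n B \is a fin_num.
    by rewrite ge0_fin_numE//; exact: lebesgue_row_ball_lty.
  have B0 : fine (lebesgue_row R n B) != 0.
    by rewrite fine_eq0// gt_eqF//; exact: lebesgue_row_ball_gt0.
  rewrite -(fineK Bf) !muleA -!EFinM /= mulVf// !mul1e//.
have mind C (g : 'rV[R]_n * 'rV[R]_n -> 'rV[R]_n) : measurable C -> measurable_fun setT g ->
    measurable_fun setT (fun z => (\1_C (g z))%:E : \bar R).
  by move=> mC mg; exact: (measurableT_comp (m1 C mC) mg).
have mL1 : measurable_fun setT (fun z : 'rV[R]_n * 'rV[R]_n => L z.1).
  exact: (measurableT_comp mL measurable_fst).
have mL2 : measurable_fun setT (fun z : 'rV[R]_n * 'rV[R]_n => z.2 + L z.1).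
  apply: measurable_fun_rowP => i; under eq_fun do rewrite mxE.
  apply: measurable_funD.
    exact: (measurableT_comp (@measurable_row_coord _ _ _ i) measurable_snd).
  exact: (measurableT_comp (@measurable_row_coord _ _ _ i) mL1).
transitivity (\int[lebesgue_row R n]_x \int[lebesgue_row R n]_y
    ((\1_A (L x))%:E * (\1_B (y + L x)%R)%:E))%E.
  rewrite (E _ (mpre _ mA)) -ge0_integralZr//; first last.
  - exact: m1 _ (mpre _ mA).
  apply: eq_integral => x _; rewrite ge0_integralZl//; first last.
  - apply: (measurableT_comp (m1 _ mB)).
    have := @measurable_row_affine n 1 (L x).
    by under eq_fun do rewrite scale1r.
  congr (_ * _)%E; rewrite (E _ mB) (@integral_row_translate n (L x) (fun y => (\1_B y)%:E))//;
      exact: m1.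
transitivity (\int[lebesgue_row R n]_y \int[lebesgue_row R n]_x
    ((\1_A (L x))%:E * (\1_B (y + L x)%R)%:E))%E.
  apply: (@fubini_tonelli _ _ _ _ _ (lebesgue_row R n) (lebesgue_row R n)
     (fun z => (\1_A (L z.1))%:E * (\1_B (z.2 + L z.1)%R)%:E)%E) => [|z].
    by apply: emeasurable_funM; exact: mind.
  exact: mule_ge0.
transitivity (\int[lebesgue_row R n]_y \int[lebesgue_row R n]_x
    ((\1_A (L x - y)%R)%:E * (\1_B (L x))%:E))%E.
  apply: eq_integral => y _ /=.
  (* Substituting [x - y O^T] for [x] turns [x O] into [x O - y], so [y] moves from the factor with
     [B] to the factor with [A]. *)
  rewrite -[LHS](integral_row_translate (- (y *m O^T)))//; first last.
  - apply: emeasurable_funM; apply: (measurableT_comp (m1 _ _)) => //.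
    have := @measurable_row_affine n 1 y.
    under eq_fun do rewrite scale1r.
    move=> mt; under eq_fun do rewrite addrC.
    exact: (measurableT_comp mt mL).
  apply: eq_integral => x _.
  have -> : L (x - y *m O^T) = L x - y by rewrite {1}/L mulmxBl -/(L _) -/(L (y *m O^T)) LK.
  by rewrite addrCA subrr addr0.
have mL3 : measurable_fun setT (fun z : 'rV[R]_n * 'rV[R]_n => L z.1 - z.2).
  apply: measurable_fun_rowP => i; under eq_fun do rewrite mxE [X in _ + X]mxE.
  apply: measurable_funB.
    exact: (measurableT_comp (@measurable_row_coord _ _ _ i) mL1).
  exact: (measurableT_comp (@measurable_row_coord _ _ _ i) measurable_snd).
transitivity (\int[lebesgue_row R n]_x \int[lebesgue_row R n]_y
    ((\1_A (L x - y)%R)%:E * (\1_B (L x))%:E))%E.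
  apply/esym/(@fubini_tonelli _ _ _ _ _ (lebesgue_row R n) (lebesgue_row R n)
     (fun z => (\1_A (L z.1 - z.2)%R)%:E * (\1_B (L z.1))%:E)%E) => [|z].
    by apply: emeasurable_funM; exact: mind.
  exact: mule_ge0.
rewrite (E _ (mpre _ mB)) -ge0_integralZr//; first last.
- exact: m1 _ (mpre _ mB).
apply: eq_integral => x _ /=; under eq_integral do rewrite muleC.
have mx : measurable_fun setT (fun y : 'rV[R]_n => L x - y).
  have := @measurable_row_affine n (-1) (L x).
  by under eq_fun do rewrite scaleN1r addrC.
rewrite ge0_integralZl//; first last.
- exact: (measurableT_comp (m1 _ mA) mx).
congr (_ * _)%E; rewrite (E _ mA) (@integral_row_reflect n (L x) (fun y => (\1_A y)%:E))//;
    exact: m1.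
Qed.

(** Invariance is applied to the positive and to the negative part, so no integrability enters. *)
Lemma integral_row_orthogonal n (O : 'M[R]_n) (f : 'rV[R]_n -> \bar R) :
  O *m O^T = 1%:M -> measurable_fun setT f ->
  (\int[lebesgue_row R n]_x f (x *m O) = \int[lebesgue_row R n]_x f x)%E.
Proof.
move=> OO mf.
have ge0 (g : 'rV[R]_n -> \bar R) : measurable_fun setT g -> (forall x, 0 <= g x)%E ->
  (\int[lebesgue_row R n]_x g (x *m O) = \int[lebesgue_row R n]_x g x)%E.
  move=> mg g0.
  transitivity (\int[pushforward (lebesgue_row R n) (fun x : 'rV[R]_n => (x *m O)%R)]_y g y)%E.
    by rewrite ge0_integral_pushforward//; exact: measurable_row_mulmx.
  have mL : measurable_fun setT (fun x : 'rV[R]_n => x *m O) by exact: measurable_row_mulmx.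
  apply: eq_measure_integral => A mA _.
  by rewrite -[LHS]/(lebesgue_row R n ((fun x => x *m O) @^-1` A)) lebesgue_row_orthogonal.
rewrite integralE [RHS]integralE.
rewrite (funepos_comp f (fun x => x *m O)) (funeneg_comp f (fun x => x *m O)).
congr (_ - _)%E.
  by apply: (ge0 (funepos f)) => //; exact: measurable_funepos.
by apply: (ge0 (funeneg f)) => //; exact: measurable_funeneg.
Qed.

End row_integral.
Arguments row_box {R} n r.

(** * Continuity on subsets and directional derivatives *)

Section continuity.
Context {R : realType}.

(** Equivalent to [{within A, continuous f}] by [within_continuousP], but phrased with limits, which
    can be added, multiplied and composed without passing to the subspace topology. *)
Definition cont_on {T U : topologicalType} (A : set T) (f : T -> U) :=
  forall x, A x -> f y @[y --> within A (nbhs x)] --> f x.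

Lemma cont_onE {T U : topologicalType} (A : set T) (f : T -> U) :
  cont_on A f <-> forall x, A x -> forall B, nbhs (f x) B -> nbhs x (fun y => A y -> B (f y)).
Proof. by split => h x Ax B /(h x Ax). Qed.

Lemma within_continuousP {T U : topologicalType} (A : set T) (f : T -> U) :
  {within A, continuous f} <-> cont_on A f.
Proof.
rewrite cont_onE; split => h x => [Ax B hB|B hB].
  have : @nbhs_subspace T A x (f @^-1` B) := h x B hB.
  by rewrite -nbhs_subspace_in.
suff H : @nbhs_subspace T A x (f @^-1` B) by exact: H.
have [Ax|Ax] := pselect (A x).
  by rewrite -nbhs_subspace_in//; exact: h Ax B hB.
rewrite -nbhs_subspace_out// => y ->.
exact: nbhs_singleton hB.
Qed.

Lemma cont_onW {T U : topologicalType} (A B : set T) (f : T -> U) :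
  B `<=` A -> cont_on A f -> cont_on B f.
Proof.
move=> BA /cont_onE h; apply/cont_onE => x Bx C /(h x (BA _ Bx)).
by apply: filterS => y Py By; apply: Py; exact: BA.
Qed.

Lemma continuous_cont_on {T U : topologicalType} (A : set T) (f : T -> U) :
  (forall x, A x -> {for x, continuous f}) -> cont_on A f.
Proof. by move=> h; apply/cont_onE => x Ax B /(h x Ax) hB; move: (hB : nbhs x (f @^-1` B));
    apply: filterS => y By _. Qed.

Lemma cont_on_open {T U : topologicalType} (A : set T) (f : T -> U) x :
  open A -> cont_on A f -> A x -> {for x, continuous f}.
Proof.
move=> oA /cont_onE h Ax B /(h x Ax) hB.
have : nbhs x A by exact: open_nbhs_nbhs.
by move: hB; apply: filterS2 => y /[apply].
Qed.

Lemma cont_on_comp {T U W : topologicalType} (A : set T) (B : set U) (f : T -> U) (g : U -> W) :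
  cont_on B g -> cont_on A f -> (forall x, A x -> B (f x)) -> cont_on A (g \o f).
Proof.
move=> /cont_onE hg /cont_onE hf AB; apply/cont_onE => x Ax P /(hg _ (AB x Ax)) /(hf x Ax).
by apply: filterS => y hy Ay; apply: hy => //; exact: AB.
Qed.

Lemma cont_on_bounded {T : topologicalType} (K : set T) (f : T -> R) :
  compact K -> cont_on K f -> exists2 M, 0 < M & forall x, K x -> `|f x| <= M.
Proof.
move=> cK /within_continuousP cf.
have /compact_bounded[M [Mr h]] := continuous_compact cf cK.
exists (`|M| + 1); first by rewrite ltr_wpDl.
move=> x Kx; apply: (h (`|M| + 1)); last by exists x.
by rewrite (le_lt_trans (ler_norm _))// ltrDl.
Qed.

Lemma limit_from_in {V : normedModType R} (U : set V) (g : V -> R) p :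
  open U -> U p -> {for p, continuous g} -> limit_from U g p = g p.
Proof.
move=> oU Up cg; have pr : ProperFilter (within U (nbhs p)).
  by apply: within_nbhs_proper; exact: subset_closure.
by apply: cvg_lim => //; exact: cvg_within_filter.
Qed.

(** A neighbourhood of [p] on which [g] stays within [e] of its limit at [p] may be taken open; it
    is then a neighbourhood of each of its points [p'], and the closed inequality passes to the
    limit at [p']. *)
Lemma limit_from_continuous {V : normedModType R} (U D : set V) (g : V -> R) :
  open U -> D `<=` closure U -> (forall p, U p -> {for p, continuous g}) ->
  extends_to U D g -> cont_on (U `|` D) (limit_from U g).
Proof.
move=> oU Dcl cg ext.
have cvgP p : (U `|` D) p -> g q @[q --> within U (nbhs p)] --> limit_from U g p.
  move=> [Up|Dp]; last by rewrite /limit_from; exact: ext.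
  by rewrite limit_from_in//; [exact: cvg_within_filter (cg _ Up)|exact: cg].
have prop p : (U `|` D) p -> ProperFilter (within U (nbhs p)).
  move=> UDp; apply: within_nbhs_proper.
  by case: UDp => [Up|/Dcl//]; exact: subset_closure.
move=> p UDp; apply/cvgrPdist_le => e e0.
have /cvgrPdist_le/(_ e e0) := cvgP p UDp.
rewrite near_withinE => /nbhs_interior hN.
rewrite near_withinE; apply: filterS hN => p' hN UDp'.
have pr := prop _ UDp'.
have h := cvgP _ UDp'.
have : `|limit_from U g p - g q| @[q --> within U (nbhs p')] --> `|limit_from U g p - limit_from
    U g p'|.
  by apply: cvg_norm; apply: cvgB => //; exact: cvg_cst.
apply: (@closed_cvg _ _ _ pr _ (fun y => y <= e)); first exact: closed_le.
by rewrite near_withinE.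
Qed.

End continuity.

Section directional.
Context {R : realType} {V : normedModType R}.
Implicit Types (f : V -> R) (p u v : V).

(** Directional derivatives are ordinary derivatives along a line. The chain rule and the mean value
    theorem below are carried over from the real line this way, without Frechet
    differentiability. *)
Lemma is_derive_line f p v (df : R) :
  is_derive p v f df <-> is_derive (0 : R) 1 (fun h : R => f (h *: v + p)) df.
Proof.
have E : (fun h : R => h^-1 *: (((fun h : R => f (h *: v + p)) \o shift 0) (h *: 1) - f ((0:R) *:
    v + p)))
   = (fun h : R => h^-1 *: ((f \o shift p) (h *: v) - f p)).
  by apply/funext => h /=; rewrite scaler1 addr0 scale0r add0r.
by split => -[h1 h2]; split; rewrite /derivable /derive ?E// -?E//.
Qed.

End directional.

Section directional2.
Context {R : realType} {V : normedModType R}.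
Implicit Types (f : V -> R) (p u v : V).

Lemma is_derive_line_at f p v (s : R) (df : R) :
  is_derive (s *: v + p) v f df -> is_derive s 1 (fun h : R => f (h *: v + p)) df.
Proof.
move=> h; apply/(@is_derive_line R R^o).
apply: (@is_derive_eq _ _ _ _ _ _ _ df) => //.
have -> : (fun t : R => f ((t *: (1:R^o) + s) *: v + p)) = (fun t : R => f (t *: v + (s *: v + p))).
  by apply/funext => t; rewrite addrA -scalerDl scaler1.
by case: (is_derive_line f (s *: v + p) v df) => H _; exact: H.
Qed.

Lemma is_derive_comp f (g : R -> R) p v (df dg : R) :
  is_derive p v f df -> is_derive (f p) 1 g dg -> is_derive p v (g \o f) (dg * df).
Proof.
move=> /is_derive_line hf hg; apply/is_derive_line.
apply: (@is_derive1_comp _ g (fun h => f (h *: v + p))) => //.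
by rewrite scale0r add0r.
Qed.

Lemma line_MVT f p v (h : R) :
  (forall s : R, `|s| <= `|h| -> derivable f (s *: v + p) v) ->
  exists2 c : R, `|c| <= `|h| & f (h *: v + p) - f p = h * 'D_v f (c *: v + p).
Proof.
move=> hd; pose phi (s : R) := f (s *: v + p).
have dphi (s : R) : `|s| <= `|h| -> is_derive s 1 phi ('D_v f (s *: v + p)).
  by move=> sh; apply: is_derive_line_at; apply: DeriveDef => //; exact: hd.
have phi0 : phi 0 = f p by rewrite /phi scale0r add0r.
have [h0|h0] := leP 0 h.
  have [c||c /[!in_itv]/= /andP[c0 ch] E] := @MVT_segment _ phi (fun s =>
      'D_v f (s *: v + p)) 0 h h0.
  - by rewrite in_itv/= => /andP[c0 ch]; apply: dphi; rewrite !ger0_norm// ltW.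
  - apply: derivable_within_continuous => c; rewrite in_itv/= => /andP[c0 ch].
    by have [] := dphi c; rewrite // !ger0_norm.
  - by exists c; [rewrite !ger0_norm|rewrite -phi0 E subr0 mulrC].
have [c||c /[!in_itv]/= /andP[c0 ch] E] := @MVT_segment _ phi (fun s =>
    'D_v f (s *: v + p)) h 0 (ltW h0).
- by rewrite in_itv/= => /andP[c0 ch]; apply: dphi; rewrite !ler0_norm ?lerN2// ltW.
- apply: derivable_within_continuous => c; rewrite in_itv/= => /andP[c0 ch].
  have ch' : `|c| <= `|h| by rewrite (ler0_norm ch) (ltr0_norm h0) lerN2.
  by have [] := dphi c ch'.
- exists c; first by rewrite (ler0_norm ch) (ltr0_norm h0) lerN2.
  by rewrite -phi0 -[LHS]opprB E sub0r mulrN opprK mulrC.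
Qed.

(** Directional derivatives need not be additive in the direction; continuity of one of them repairs
    this. The increment is split into a step along [u] from [p] and a step along [v] from [p + h u];
    the mean value theorem evaluates the latter at a point tending to [p]. *)
Lemma is_derive_addv f p u v (a : R) :
  (\forall x \near p, derivable f x v) -> {for p, continuous ('D_v f)} ->
  is_derive p u f a -> is_derive p (u + v) f (a + 'D_v f p).
Proof.
move=> hd hc [du <-].
have /cvg_ex[/= l hl] := du.
have lE : 'D_u f p = l by apply: cvg_lim.
suff H : h^-1 *: ((f \o shift p) (h *: (u + v)) - f p) @[h --> 0^'] --> l + 'D_v f p.
  by split; [apply/cvg_ex; exists (l + 'D_v f p)|rewrite lE; apply: cvg_lim].
have -> : (fun h : R => h^-1 *: ((f \o shift p) (h *: (u + v)) - f p)) =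
   (fun h : R => h^-1 *: ((f \o shift p) (h *: u) - f p)) \+
   (fun h : R => h^-1 *: (f (h *: v + (h *: u + p)) - f (h *: u + p))).
  by apply/funext => h /=; rewrite -scalerDr; congr (_ *: _);
    rewrite scalerDr (addrC (h *: u)) -addrA [RHS]addrC subrKA.
apply: cvgD; first exact: hl.
apply/cvgrPdist_le => e e0.
have /cvgrPdist_le/(_ e e0) := hc.
move=> /(filterI hd) /nbhs_ballP[d /= d0 hb].
near=> h.
have hsmall (s : R) : `|s| <= `|h| -> ball p d (s *: v + (h *: u + p)).
  move=> sh; rewrite -ball_normE /ball_ /=.
  have -> : p - (s *: v + (h *: u + p)) = - (s *: v + h *: u).
    by rewrite addrA opprD addrCA subrr addr0.
  rewrite normrN; apply: (@le_lt_trans _ _ (`|h| * (`|u| + `|v|))).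
    rewrite (le_trans (ler_normD _ _))// !normrZ mulrDr addrC lerD2l.
    by rewrite ler_wpM2r.
  (* The extra 1 keeps the divisor positive when [u] and [v] both vanish. *)
  have uv : 0 < `|u| + `|v| + 1 by rewrite ltr_wpDl.
  apply: (@le_lt_trans _ _ (`|h| * (`|u| + `|v| + 1))).
    by rewrite ler_wpM2l// lerDl.
  rewrite -ltr_pdivlMr//; near: h.
  by apply: dnbhs0_lt; rewrite divr_gt0.
have [c ch ->] := @line_MVT f (h *: u + p) v h (fun s sh => (hb _ (hsmall s sh)).1).
rewrite /GRing.scale /= mulrA mulVf ?mul1r; last by near: h; exact: nbhs_dnbhs_neq.
exact: (hb _ (hsmall c ch)).2.
Unshelve. all: by end_near. Qed.

End directional2.

Section C1_functions.
Context {R : realType} {V : normedModType R}.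
Implicit Types (f g : V -> R) (p u v : V).

(** Directional derivatives suffice: their continuity in the point makes them linear in the
    direction, see [derive_linear]. *)
Definition C1 f := continuous f /\
  forall v, (forall x, derivable f x v) /\ continuous ('D_v f).

Lemma C1_intro f (df : V -> V -> R) : continuous f ->
  (forall v x, is_derive x v f (df v x)) -> (forall v, continuous (df v)) -> C1 f.
Proof.
move=> cf hf cdf; split => // v; split => [x|]; first by have [] := hf v x.
have -> : 'D_v f = df v by apply/funext => x; have [_ ->] := hf v x.
exact: cdf.
Qed.

Lemma C1_is_derive f x v : C1 f -> is_derive x v f ('D_v f x).
Proof. by move=> [_ /(_ v)[h _]]; apply: DeriveDef. Qed.

Lemma C1_cst (a : R) : C1 (cst a).
Proof.
refine (@C1_intro (cst a) (fun _ => cst 0) _ _ _) => [|v]; exact: cst_continuous.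
Qed.

Lemma C1D f g : C1 f -> C1 g -> C1 (f + g).
Proof.
move=> hf hg; apply: (C1_intro (df := fun v x => 'D_v f x + 'D_v g x)) => [|v x|v].
- by move=> x; apply: cvgD; [exact: hf.1|exact: hg.1].
- by apply: is_deriveD; exact: C1_is_derive.
- by move=> x; apply: cvgD; [exact: (hf.2 v).2|exact: (hg.2 v).2].
Qed.

Lemma C1M f g : C1 f -> C1 g -> C1 (f * g).
Proof.
move=> hf hg; apply: (C1_intro (df := fun v x => f x * 'D_v g x + g x * 'D_v f x)) => [|v x|v].
- by move=> x; apply: cvgM; [exact: hf.1|exact: hg.1].
- by apply: is_deriveM; exact: C1_is_derive.
- by move=> x; apply: cvgD; apply: cvgM; [exact: hf.1|exact: (hg.2 v).2|exact: hg.1|exact: (hf.2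
    v).2].
Qed.

Lemma C1N f : C1 f -> C1 (- f).
Proof.
move=> hf; apply: (C1_intro (df := fun v x => - 'D_v f x)) => [|v x|v].
- by move=> x; apply: cvgN; exact: hf.1.
- by apply: is_deriveN; exact: C1_is_derive.
- by move=> x; apply: cvgN; exact: (hf.2 v).2.
Qed.

Lemma C1B f g : C1 f -> C1 g -> C1 (f - g).
Proof. by move=> hf hg; apply: C1D => //; exact: C1N. Qed.

Lemma C1_comp f (g dg : R -> R) : C1 f -> (forall t : R, is_derive t 1 g (dg t)) ->
  continuous dg -> C1 (g \o f).
Proof.
move=> hf hg cdg.
have cg : continuous g.
  by move=> t; apply/differentiable_continuous/derivable1_diffP; have [] := hg t.
apply: (C1_intro (df := fun v x => dg (f x) * 'D_v f x)) => [|v x|v].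
- by move=> x; apply: continuous_comp; [exact: hf.1|exact: cg].
- by apply: is_derive_comp => //; exact: C1_is_derive.
- move=> x; apply: cvgM; last exact: (hf.2 v).2.
  by apply: (@continuous_comp _ _ _ f dg); [exact: hf.1|exact: cdg].
Qed.

Lemma C1_sum (I : Type) (r : seq I) (F : I -> V -> R) :
  (forall i, C1 (F i)) -> C1 (\sum_(i <- r) F i).
Proof.
move=> hF; elim: r => [|i r IH]; first by rewrite big_nil; exact: C1_cst.
by rewrite big_cons; exact: C1D.
Qed.

Lemma is_derive_affine f p v (a : R) : (forall h : R, f (h *: v + p) = h * a + f p) ->
  is_derive p v f a.
Proof.
move=> E; apply/is_derive_line.
have -> : (fun h : R => f (h *: v + p)) = (fun h : R => h * a + f p) by apply/funext.
have h1 : is_derive (0:R) 1 (fun h : R => h) 1 by exact: is_derive_id.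
have h2 : is_derive (0:R) 1 (cst a : R -> R) 0 by exact: is_derive_cst.
have h3 : is_derive (0:R) 1 (cst (f p) : R -> R) 0 by exact: is_derive_cst.
apply: is_derive_eq (is_deriveD (is_deriveM h1 h2) h3) _.
by rewrite /GRing.scale /= mul0r mulr1 addr0 add0r.
Qed.

End C1_functions.

Section cutoffs.
Context {R : realType}.

Definition ramp (u : R) : R := Num.max 0 u.
(* C^1 quadratic spline, 0 for s <= 0 and 1 for s >= 1. *)
Definition step (s : R) : R := 2 * (ramp s ^+ 2 - 2 * ramp (s - 2^-1) ^+ 2 + ramp (s - 1) ^+ 2).
(** A hat on [0, 1] of height 2, hence of integral 1. Rescaled, it becomes the kernel of the
    boundary layers. *)
Definition dstep (s : R) : R := 4 * (ramp s - 2 * ramp (s - 2^-1) + ramp (s - 1)).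

Lemma ramp_continuous : continuous ramp.
Proof.
move=> u; apply/cvgrPdist_le => e e0; near=> t.
apply: (@le_trans _ _ `|u - t|).
  by rewrite /ramp !maxElt; do 2 case: ltP => ?; rewrite ler_norml; have := ler_norm (u - t);
      have := ler_norm (t - u); rewrite distrC => ? ?; apply/andP; split; lra.
by near: t; apply: cvgr_dist_le => //; exact: cvg_id.
Unshelve. all: by end_near. Qed.

(** Away from 0 the function is locally constant or a square. At 0 the difference quotient is at
    most [|h|]: squaring the ramp removes its corner. *)
Lemma is_derive_ramp2 (u : R) : is_derive u 1 (fun u => ramp u ^+ 2) (2 * ramp u).
Proof.
have [u0|u0|u0] := ltgtP u 0.
- apply: (@near_eq_is_derive _ _ _ (cst 0)).
    near=> t; rewrite /ramp max_l ?expr0n//=.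
    by apply: ltW; near: t; exact: lt_nbhsl.
  rewrite /ramp max_l ?mulr0; last exact: ltW.
  exact: is_derive_cst.
- apply: (@near_eq_is_derive _ _ _ (fun t : R => t ^+ 2)).
    near=> t; rewrite /ramp max_r//.
    by apply: ltW; near: t; exact: lt_nbhsr.
  rewrite /ramp max_r; last exact: ltW.
  have := @is_deriveX _ _ (fun t : R => t) 2 u 1 1 (is_derive_id _ _).
  by rewrite /GRing.scale /= expr1 mulr1.
- rewrite u0 /ramp maxxx mulr0.
  suff H : h^-1 *: (((fun u => ramp u ^+ 2) \o shift 0) (h *: 1) - ramp 0 ^+ 2) @[h --> (0:R)^']
      --> (0:R).
    by split; [apply/cvg_ex; exists 0|apply: cvg_lim].
  apply/cvgrPdist_le => e e0; near=> h.
  rewrite /= scaler1 addr0 /ramp maxxx expr0n /= subr0 sub0r normrN /GRing.scale /=.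
  have h0 : h != 0 by near: h; exact: nbhs_dnbhs_neq.
  rewrite normrM normrV ?unitfE// ler_pdivrMl ?normr_gt0//.
  apply: (@le_trans _ _ (`|h| ^+ 2)).
    rewrite normrX lerXn2r ?nnegrE//.
    by rewrite maxElt; case: ltP => ? //; rewrite normr0.
  rewrite expr2 ler_wpM2l//; near: h.
  by apply: dnbhs0_le.
Unshelve. all: by end_near. Qed.

Lemma is_derive_step (s : R) : is_derive s 1 step (dstep s).
Proof.
have sh (a : R) : is_derive s 1 (fun t => ramp (t - a) ^+ 2) (2 * ramp (s - a)).
  have h1 : is_derive s 1 (fun t : R => t - a) 1.
    apply: is_derive_eq (is_deriveB (is_derive_id _ _) (is_derive_cst a _ _)) _.
    by rewrite subr0.
  have := @is_derive1_comp _ (fun u => ramp u ^+ 2) (fun t =>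
      t - a) s _ _ (is_derive_ramp2 (s - a)) h1.
  by rewrite mulr1.
have h0 := is_derive_ramp2 s.
have H := is_deriveZ 2 (is_deriveD (is_deriveB h0 (is_deriveZ 2 (sh 2^-1))) (sh 1)).
apply: is_derive_eq H _.
by rewrite /dstep /GRing.scale /=; ring.
Qed.

Lemma dstep_continuous : continuous dstep.
Proof.
have c0 (a : R) : continuous (fun s => ramp (s - a)).
  move=> s; apply: (@continuous_comp _ _ _ (fun s => s - a) ramp); last exact: ramp_continuous.
  by apply: cvgB; [exact: cvg_id|exact: cvg_cst].
move=> s; apply: cvgM; first exact: cvg_cst.
apply: cvgD; last exact: c0.
apply: cvgB; first exact: ramp_continuous.
by apply: cvgM; [exact: cvg_cst|exact: c0].
Qed.

Lemma dstep_ge0 s : 0 <= dstep s.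
Proof. by rewrite /dstep /ramp !maxElt; do 3 (case: ltP => ?); lra. Qed.

Lemma dstep_le2 s : dstep s <= 2.
Proof. by rewrite /dstep /ramp !maxElt; do 3 (case: ltP => ?); lra. Qed.

Lemma dstep_eq0 s : s <= 0 \/ 1 <= s -> dstep s = 0.
Proof. by rewrite /dstep /ramp !maxElt; case; do 3 (case: ltP => ?); lra. Qed.

Lemma step_le0 s : s <= 0 -> step s = 0.
Proof. by rewrite /step /ramp !maxElt => h; do 3 (case: ltP => ?); rewrite ?expr0n /=; lra. Qed.

Lemma step_ge1 s : 1 <= s -> step s = 1.
Proof. by rewrite /step /ramp !maxElt => h; do 3 (case: ltP => ?); rewrite ?expr0n /= ?expr2;
    first [lra | nra]. Qed.

Lemma step_ge0 s : 0 <= step s.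
Proof. by rewrite /step /ramp !maxElt; do 3 (case: ltP => ?); rewrite ?expr0n /= ?expr2;
    first [lra | nra]. Qed.

Lemma step_le1 s : step s <= 1.
Proof. by rewrite /step /ramp !maxElt; do 3 (case: ltP => ?); rewrite ?expr0n /= ?expr2;
    first [lra | nra]. Qed.

End cutoffs.

Section rows.
Context {R : realType}.

Lemma cvg_row {T : Type} n (F : set_system T) {FF : Filter F} (f : T -> 'rV[R]_n) (l : 'rV[R]_n) :
  (forall i, f x 0 i @[x --> F] --> l 0 i) -> f x @[x --> F] --> l.
Proof.
move=> h; apply/cvgrPdist_lt => e e0.
have H : F [set x | forall i, `|l 0 i - f x 0 i| < e].
  by apply: filter_forall => i; have /cvgrPdist_lt/(_ _ e0) := h i.
near=> x.
have : ball l e (f x).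
  by apply/row_ballP; split => //; near: x.
by rewrite -ball_normE.
Unshelve. all: by end_near. Qed.

Lemma cvg_sumr {T : Type} (I : Type) (r : seq I) (F : set_system T) {FF : Filter F}
  (f : I -> T -> R) (l : I -> R) : (forall i, f i x @[x --> F] --> l i) ->
  (\sum_(i <- r) f i x) @[x --> F] --> \sum_(i <- r) l i.
Proof.
move=> h; elim: r => [|i r IH].
  by rewrite big_nil; under eq_fun do rewrite big_nil; exact: cvg_cst.
by rewrite big_cons; under eq_fun do rewrite big_cons; exact: cvgD.
Qed.

Lemma row_coord_continuous n (i : 'I_n) : continuous (fun x : 'rV[R]_n => x 0 i).
Proof. exact: coord_continuous. Qed.

Lemma mulmx_row_continuous n k (O : 'M[R]_(n, k)) : continuous (fun x : 'rV[R]_n => x *m O).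
Proof.
move=> x; apply: (@cvg_row _ _ (nbhs x) _) => i.
rewrite mxE; under eq_fun do rewrite mxE.
apply: cvg_sumr => j; apply: cvgM; last exact: cvg_cst.
exact: row_coord_continuous.
Qed.

Lemma row_behead_continuous n : continuous (@row_behead R n).
Proof.
move=> x; apply: (@cvg_row _ _ (nbhs x) _) => i.
have -> : (fun y : 'rV[R]_n.+1 => row_behead y 0 i) = (fun y : 'rV[R]_n.+1 => y 0 (lift ord0 i)).
  by apply/funext => y; rewrite mxE.
rewrite mxE; exact: row_coord_continuous.
Qed.

Lemma row_beheadD n (h : R) (u x : 'rV[R]_n.+1) :
  row_behead (h *: u + x) = h *: row_behead u + row_behead x.
Proof. by apply/rowP => i; rewrite !mxE. Qed.

Lemma C1_coord n (i : 'I_n) : C1 (fun x : 'rV[R]_n => x 0 i).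
Proof.
refine (@C1_intro R 'rV[R]_n _ (fun v : 'rV[R]_n => cst (v 0 i)) _ _ _) => [|v x|v].
- exact: row_coord_continuous.
- by apply: is_derive_affine => h; rewrite !mxE.
- exact: cst_continuous.
Qed.

(** Here [r] is a squared radius: the value is 1 up to squared Euclidean distance [r] from [c], and
    0 from [2 r] on. *)
Definition bump n (c : 'rV[R]_n) (r : R) (x : 'rV[R]_n) : R :=
  step (2 - dotp (x - c) (x - c) / r).

Lemma C1_dotp n (c : 'rV[R]_n) : C1 (fun x => dotp (x - c) (x - c)).
Proof.
have -> : (fun x => dotp (x - c) (x - c)) = \sum_i (((fun x : 'rV[R]_n =>
    x 0 i) - cst (c 0 i)) * ((fun x : 'rV[R]_n => x 0 i) - cst (c 0 i))).
  by apply/funext => x; rewrite fct_sumE; apply: eq_bigr => i _; rewrite !mxE.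
by apply: C1_sum => i; apply: C1M; apply: C1B; [exact: C1_coord|exact: C1_cst|exact:
    C1_coord|exact: C1_cst].
Qed.

Lemma C1_bump n (c : 'rV[R]_n) r : C1 (bump c r).
Proof.
have -> : bump c r = step \o (cst 2 - (fun x => dotp (x - c) (x - c)) * cst r^-1) by [].
apply: C1_comp is_derive_step dstep_continuous.
by apply: C1B; [exact: C1_cst|apply: C1M; [exact: C1_dotp|exact: C1_cst]].
Qed.

Lemma dotp_ge0 n (x : 'rV[R]_n) : 0 <= dotp x x.
Proof. by apply: sumr_ge0 => i _; rewrite -expr2 sqr_ge0. Qed.

Lemma dotp_eq0 n (x : 'rV[R]_n) : dotp x x = 0 -> x = 0.
Proof.
move=> /eqP; rewrite psumr_eq0; last by move=> i _; rewrite -expr2 sqr_ge0.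
move=> /allP h; apply/rowP => i; rewrite mxE.
by have := h i (mem_index_enum _); rewrite -expr2 sqrf_eq0 => /eqP.
Qed.

Lemma coord_dotp n (x : 'rV[R]_n) i : x 0 i ^+ 2 <= dotp x x.
Proof.
rewrite /dotp (bigD1 i)//= -expr2 lerDl.
by apply: sumr_ge0 => j _; rewrite -expr2 sqr_ge0.
Qed.

(** With [r = e^2 / 2] the bump vanishes at Euclidean distance [e] and beyond. Coordinates are
    bounded by the Euclidean norm, so the points where it does not vanish lie in the sup-norm
    ball. *)
Lemma bump_ball n (c : 'rV[R]_n) (e : R) : 0 < e -> forall x,
    bump c (e ^+ 2 / 2) x != 0 -> ball c e x.
Proof.
move=> e0 x hx; apply/row_ballP; split => // i.
rewrite ltNge; apply/negP => hi; move/eqP: hx; apply; apply: step_le0.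
have e2 : 0 < e ^+ 2 / 2 by rewrite divr_gt0// exprn_gt0.
rewrite subr_le0 ler_pdivlMr// mulrC divfK//.
apply: le_trans (coord_dotp (x - c) i); rewrite -[leRHS]real_normK ?num_real//.
by rewrite lerXn2r ?nnegrE ?(ltW e0)// !mxE distrC.
Qed.

Lemma bump_near n (c : 'rV[R]_n) r : 0 < r -> \forall x \near c, bump c r x = 1.
Proof.
move=> r0; near=> x; apply: step_ge1.
suff : dotp (x - c) (x - c) <= r.
  move=> h; have : dotp (x - c) (x - c) / r <= 1 by rewrite ler_pdivrMr// mul1r.
  by move: (_ / _) => d; lra.
apply: ltW; near: x.
have := (C1_dotp c).1 c; rewrite /continuous_at subrr.
have -> : dotp (0 : 'rV[R]_n) 0 = 0 by apply: big1 => i _; rewrite mxE mul0r.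
by move/cvgr_lt; apply.
Unshelve. all: by end_near. Qed.

End rows.

(** * Integration by parts for functions supported in a box *)

Section integration_by_parts.
Context {R : realType}.

Lemma integral_row_shift n (a : 'rV[R]_n) (f : 'rV[R]_n -> \bar R) :
  measurable_fun setT f ->
  (\int[lebesgue_row R n]_x f (x + a)%R = \int[lebesgue_row R n]_x f x)%E.
Proof.
move=> mf; rewrite integralE [RHS]integralE.
rewrite (funepos_comp f (fun x => x + a)) (funeneg_comp f (fun x => x + a)).
congr (_ - _)%E.
  by apply: (integral_row_translate a (f := funepos f)) => //; exact: measurable_funepos.
by apply: (integral_row_translate a (f := funeneg f)) => //; exact: measurable_funeneg.
Qed.

Lemma coord_norm n (v : 'rV[R]_n) i : `|v 0 i| <= `|v|.
Proof.
rewrite [in leRHS]/Num.norm /= mx_normrE.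
by rewrite (le_trans _ (@le_bigmax _ _ _ _ (fun p => `|v p.1 p.2|) (0, i)))//=.
Qed.

Lemma closed_row_box n (r : R) : closed (row_box n r).
Proof.
have -> : row_box n r = \bigcap_(i in [set: 'I_n]) ((fun x : 'rV[R]_n => x 0 i) @^-1`
   [set` `[- r, r]]).
  apply/seteqP; split => x h i; first by move=> _ /=; rewrite in_itv/= -ler_norml; exact: h.
  by have := h i I; rewrite /= in_itv/= -ler_norml.
apply: closed_bigI => i _; apply: closed_comp; last exact: itv_closed.
by move=> x _; exact: row_coord_continuous.
Qed.

Lemma compact_row_box n (r : R) : compact (row_box n r).
Proof. by apply: bounded_closed_compact; [exact: box_bounded|exact: closed_row_box]. Qed.

Lemma row_box_finite n (r : R) : (lebesgue_row R n (row_box n r) < +oo)%E.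
Proof. by apply: bounded_lebesgue_row; [exact: measurable_row_box|exact: box_bounded]. Qed.

Lemma derive_zero_near n (g : 'rV[R]_n -> R) v x : (\forall y \near x, g y = 0) -> 'D_v g x = 0.
Proof.
by move=> h; rewrite (@near_eq_derive _ _ _ _ (cst 0)) ?derive_cst.
Qed.

Lemma derive_zero_box n (g : 'rV[R]_n -> R) v (r : R) :
  (forall x, ~ row_box n r x -> g x = 0) -> forall x, ~ row_box n r x -> 'D_v g x = 0.
Proof.
move=> h x hx; apply: derive_zero_near.
have : nbhs x (~` row_box n r).
  by apply: open_nbhs_nbhs; split => //; apply: closed_openC; exact: closed_row_box.
by apply: filterS => y hy; exact: h.
Qed.

(* By translation invariance the difference quotients of g have integral 0. *)
Lemma integral_derive0 n (g : 'rV[R]_n -> R) v (r : R) :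
  (forall x, derivable g x v) -> continuous g -> continuous ('D_v g) ->
  (forall x, ~ row_box n r x -> g x = 0) ->
  \int[lebesgue_row R n]_x ('D_v g x) = 0.
Proof.
move=> dg cg cdg g0.
have aux (a b c d e : R) : c <= d + b -> b <= a -> d <= e -> c <= e + a + 1 by lra.
(* The enlarged box contains the supports of all translates by [s v] with [|s| <= 1], so integrating
   over it loses nothing, while its finite measure makes constants integrable. *)
pose r' := r + `|v| + 1; pose B := row_box n r'.
have mB : measurable B by exact: measurable_row_box.
have Bfin : (lebesgue_row R n B < +oo)%E by exact: row_box_finite.
have rB : row_box n r `<=` B.
  by move=> x hx i; rewrite (le_trans (hx i))// /r' -addrA lerDl addr_ge0.
have bounded (f : 'rV[R]_n -> R) : continuous f -> (forall x, ~ row_box n r x -> f x = 0) ->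
    exists2 M, 0 < M & forall x, `|f x| <= M.
  move=> cf f0.
  have [M M0 hM] := cont_on_bounded (@compact_row_box n r) (continuous_cont_on (fun x _ => cf x)).
  exists M => // x; have [/hM//|/f0 ->] := pselect (row_box n r x).
  by rewrite normr0 ltW.
have [M0 M00 hM0] := bounded g cg g0.
have dg0 := derive_zero_box v g0.
have [M1 M10 hM1] := bounded _ cdg dg0.
have mg : measurable_fun setT g by exact: continuous_measurable_row.
have mgs s : measurable_fun setT (fun x => g (s *: v + x)).
  apply: (measurableT_comp mg).
  have := @measurable_row_affine R n 1 (s *: v).
  by under eq_fun do rewrite scale1r addrC.
have bi (f : 'rV[R]_n -> R) (M : R) : measurable_fun setT f -> (forall x, `|f x| <= M) ->
    (lebesgue_row R n).-integrable B (EFin \o f).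
  move=> mf hf; apply: measurable_bounded_integrable => //; first exact: measurable_funTS.
  exists M; split; first exact: num_real.
  by move=> t Mt x _; exact: (le_trans (hf x) (ltW Mt)).
pose f (s : R) x := g (s *: v + x).
have fd (s : R) x : is_derive s 1 (f ^~ x) ('D_v g (s *: v + x)).
  by apply: is_derive_line_at; apply: DeriveDef.
have d1E (s : R) x : partial1of2 f s x = 'D_v g (s *: v + x).
  by rewrite partial1of2E; have [_ ->] := fd s x.
have I0 : `]-1, 1[%classic (0 : R) by rewrite /= in_itv /= ltrN10 ltr01.
have H := @differentiation_under_integral R _ _ (lebesgue_row R n) f B mB 0 (-1) 1 I0
  (fun s _ => bi _ M0 (mgs s) (fun x => hM0 _)) (fun s x _ _ => ex_derive (is_derive := fd s x))
  (cst M1) (fun _ => ltW M10).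
have HG : (lebesgue_row R n).-integrable B (EFin \o cst M1).
  apply: (bi _ M1); first exact: measurable_cst.
  by move=> x; rewrite ger0_norm// ltW.
have {}H := H HG (fun s x _ _ => eq_ind_r (fun z => `|z| <= M1) (hM1 _) (d1E s x)).
have E1 : \int[lebesgue_row R n]_x ('D_v g x) = \int[lebesgue_row R n]_(y in B) partial1of2 f 0 y.
  rewrite [RHS]Rintegral_mkcond; apply: eq_Rintegral => x _.
  rewrite /patch; case: ifPn => [_|/negP hx]; first by rewrite d1E scale0r add0r.
  by apply: dg0 => /rB h; apply: hx; rewrite inE.
rewrite E1 -H.
pose F (s : R) := \int[lebesgue_row R n]_(y in B) f s y.
have nearE : \forall s \near (0 : R), F s = cst (\int[lebesgue_row R n]_x g x) s.
  near=> s.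
  have s1 : `|s| <= 1.
    by apply: ltW; near: s; have := @nbhs0_lt R R 1 ltr01; apply: filterS.
  rewrite /F /Rintegral; congr fine.
  rewrite -(integral_row_shift (s *: v) (f := EFin \o g)); last exact/measurable_EFinP.
  rewrite [LHS]integral_mkcond; apply: eq_integral => x _.
  rewrite /patch; case: ifPn => [_|/negP hx] /=; first by rewrite /f addrC.
  have hn : ~ row_box n r (x + s *: v).
    move=> h; apply: hx; rewrite inE => i.
    have := h i; rewrite !mxE => hi.
    have e2 : `|s * v 0 i| <= `|v|.
      rewrite normrM; apply: le_trans (coord_norm v i).
      by rewrite ler_piMl.
    have e1 := ler_normB (x 0 i + s * v 0 i) (s * v 0 i).
    rewrite addrK in e1; rewrite /r'.
    exact: aux e1 e2 hi.
  by rewrite (g0 _ hn).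
by rewrite -/F derive1E (near_eq_derive _ nearE) derive_cst.
Unshelve. all: by end_near. Qed.

End integration_by_parts.

Section bounded_integrals.
Context d (T : measurableType d) (R : realType) (mu : {measure set T -> \bar R}).
Variable (D : set T).
Hypotheses (mD : measurable D) (Dfin : (mu D < +oo)%E).

Lemma bounded_integrable (f : T -> R) (M : R) : measurable_fun D f ->
  (forall x, D x -> `|f x| <= M) -> mu.-integrable D (EFin \o f).
Proof.
move=> mf hf; apply: measurable_bounded_integrable => //.
exists M; split; first exact: num_real.
by move=> t Mt x Dx; exact: (le_trans (hf x Dx) (ltW Mt)).
Qed.

Lemma bounded_cvg_Rintegral (f_ : nat -> T -> R) (f : T -> R) (M : R) :
  (forall n, measurable_fun D (f_ n)) -> (forall n x, D x -> `|f_ n x| <= M) ->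
  (forall x, D x -> f_ n x @[n --> \oo] --> f x) ->
  \int[mu]_(x in D) f_ n x @[n --> \oo] --> \int[mu]_(x in D) f x.
Proof.
move=> mf hM hf.
have mlim : measurable_fun D f by apply: measurable_fun_cvg hf.
have hMf x : D x -> `|f x| <= M.
  move=> Dx; have : `|f_ n x| @[n --> \oo] --> `|f x| by apply: cvg_norm; exact: hf.
  apply: (@closed_cvg _ _ _ _ _ (fun y => y <= M)); first exact: closed_le.
  by apply: nearW => n; exact: hM.
have ff : (\int[mu]_(x in D) (f x)%:E)%E \is a fin_num.
  by apply: integrable_fin_num => //; exact: bounded_integrable hMf.
apply: fine_cvg; rewrite fineK//.
apply: (@dominated_cvg _ _ _ mu D mD (fun n x => (f_ n x)%:E) (EFin \o f) (EFin \o cst M)) => //.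
- by move=> n; exact/measurable_EFinP.
- by move=> x Dx; apply: cvg_EFin; [exact: nearW|exact: hf].
- have M0 : mu.-integrable D (EFin \o cst `|M|).
    by apply: (@bounded_integrable _ `|M|); [exact: measurable_cst|move=> x _; rewrite /= normr_id].
  (* The bound [M] is known to be nonnegative only when [D] has a point, where it bounds an absolute
     value. *)
  have [[x Dx]|D0] := pselect (D !=set0).
    by have MM : `|M| = M; [rewrite ger0_norm// (le_trans _ (hMf x Dx))|rewrite -MM].
  have -> : D = set0 by apply/seteqP; split => // x Dx; apply: D0; exists x.
  exact: integrable_set0.
Qed.

End bounded_integrals.

(** * Change of variables from a formula for the measure of sets *)

Section transfer.
Context d1 d2 (Y : measurableType d1) (X : measurableType d2) (R : realType).
Variables (lam : {measure set Y -> \bar R}) (mu : {measure set X -> \bar R}).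
Variables (G : Y -> X) (J : Y -> R) (B : set X).
Hypotheses (mG : measurable_fun setT G) (mJ : measurable_fun setT J) (J0 : forall y, 0 <= J y)
  (mB : measurable B).
Hypothesis transferB : forall A, measurable A -> A `<=` B ->
  mu A = (\int[lam]_(y in G @^-1` A) (J y)%:E)%E.

Let preimM A : measurable A -> measurable (G @^-1` A).
Proof. by move=> mA; rewrite -[X in measurable X]setTI; exact: mG. Qed.

Import HBNNSimple.

(** The assumption concerns sets only, as [is_surface_measure] does. Linearity extends it to simple
    functions and monotone convergence to nonnegative ones. *)
Lemma ge0_integral_transfer (f : X -> \bar R) : measurable_fun setT f -> (forall x, 0 <= f x)%E ->
  (\int[mu]_(x in B) f x = \int[lam]_(y in G @^-1` B) (f (G y) * (J y)%:E))%E.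
Proof.
move=> mf f0; have mGB := preimM mB.
pose f_ := nnsfun_approx measurableT mf.
have fcvg x : (f_ n x)%:E @[n --> \oo] --> f x.
  by apply: (@cvg_nnsfun_approx _ _ _ _ measurableT _ mf) => // y _; exact: f0.
transitivity (limn (fun n => \int[mu]_(x in B) (f_ n x)%:E))%E.
  rewrite -monotone_convergence//.
  - by apply: eq_integral => y _; apply/esym/cvg_lim.
  - by move=> n; apply/measurable_EFinP; exact: measurable_funTS.
  - by move=> n y _; rewrite lee_fin.
  - by move=> y _ m n mn; rewrite lee_fin; exact/lefP/nd_nnsfun_approx.
rewrite [X in limn X](_ : _ =
    (fun n => \int[lam]_(y in G @^-1` B) ((f_ n (G y))%:E * (J y)%:E)))%E.
  rewrite -monotone_convergence//.
  - apply: eq_integral => y _; apply/cvg_lim => //.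
    by apply: cvgeZr.
  - move=> n; apply: emeasurable_funM; apply/measurable_EFinP; apply: measurable_funTS => //.
    exact: measurableT_comp.
  - by move=> n y _; rewrite mule_ge0// lee_fin.
  - move=> y _ m n mn; rewrite lee_wpmul2r ?lee_fin//.
    exact/lefP/nd_nnsfun_approx.
apply/funext => n.
under eq_integral do rewrite fimfunE -fsumEFin//.
rewrite ge0_integral_fsum//; last 2 first.
- by move=> y; apply/measurable_EFinP; apply: measurable_funM => //; exact: measurable_funTS.
- by move=> y x _; rewrite EFinM nnfun_muleindic_ge0.
transitivity (\sum_(k \in range (f_ n))
    \int[lam]_(y in G @^-1` B) ((k * \1_(f_ n @^-1` [set k]) (G y))%:E * (J y)%:E))%E; last first.
  rewrite -ge0_integral_fsum//.
  - apply: eq_integral => y _; rewrite fimfunE -fsumEFin// ge0_mule_fsuml//.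
    by move=> r; rewrite EFinM nnfun_muleindic_ge0.
  - move=> r; apply: emeasurable_funM; apply/measurable_EFinP; apply: measurable_funTS => //.
    apply: measurable_funM => //; apply: measurableT_comp => //.
  - by move=> r x _; rewrite mule_ge0 ?lee_fin// -lee_fin EFinM nnfun_muleindic_ge0.
apply: eq_fsbigr => r _.
have mr : measurable (f_ n @^-1` [set r]) by exact: measurable_sfunP.
have [r0|r0] := ltP r 0.
  have e0 : f_ n @^-1` [set r] = set0 by exact: preimage_nnfun0.
  rewrite e0 !integral0_eq// => x _; rewrite indic0 mulr0 ?mul0e//.
rewrite integralZl_indic_nnsfun// integral_indic//.
rewrite transferB; [|exact: measurableI|by move=> x []].
rewrite -ge0_integralZl//; first last.
- by move=> y _; rewrite lee_fin.
- by apply/measurable_EFinP; exact: measurable_funTS.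
- by apply: preimM; exact: measurableI.
rewrite [LHS]integral_mkcond [RHS]integral_mkcond; apply: eq_integral => y _.
have e1 : (y \in G @^-1` (f_ n @^-1` [set r] `&` B)) = (f_ n (G y) == r) && (G y \in B).
  by apply/idP/andP; rewrite !inE /preimage /= => -[/eqP ? ?]; split => //; exact/eqP.
have e2 : (y \in G @^-1` B) = (G y \in B) by apply/idP/idP; rewrite !inE.
have e3 : \1_(f_ n @^-1` [set r]) (G y) = (f_ n (G y) == r)%:R :> R.
  by rewrite indicE; congr ((nat_of_bool _)%:R); apply/idP/eqP; rewrite inE.
rewrite /patch e1 e2 e3; case: (G y \in B); rewrite ?andbT ?andbF//.
by case: eqP => _ /=; rewrite ?mulr1 ?mulr0 ?mul0e.
Qed.

Lemma integral_transfer (f : X -> R) : measurable_fun setT f ->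
  \int[mu]_(x in B) f x = \int[lam]_(y in G @^-1` B) (f (G y) * J y).
Proof.
move=> mf; rewrite /Rintegral; congr fine.
have mE : measurable_fun setT (EFin \o f) by exact/measurable_EFinP.
rewrite integralE [RHS]integralE.
rewrite (ge0_integral_transfer (f := funepos (EFin \o f)))//; last exact: measurable_funepos.
rewrite (ge0_integral_transfer (f := funeneg (EFin \o f)))//; last exact: measurable_funeneg.
congr (_ - _)%E; apply: eq_integral => y _.
  rewrite !funeposE /= -!EFin_max -EFinM; congr EFin.
  by rewrite maxr_pMl ?mul0r.
rewrite !funenegE /= -?EFinN -!EFin_max -EFinM; congr EFin.
by rewrite maxr_pMl ?mul0r// mulNr.
Qed.

End transfer.

Section row_fubini.
Context {R : realType}.
Local Notation leb1 := (@lebesgue_measure R).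

(** The first coordinate is integrated innermost: in a chart it runs across the boundary, so a
    boundary layer can be evaluated fibre by fibre. Boundedness and the support in a box give
    integrability on the product. *)
Lemma Rintegral_row_cons2 n (f : 'rV[R]_n.+1 -> R) (M r : R) :
  measurable_fun setT f -> (forall x, `|f x| <= M) -> (forall x, ~ row_box n.+1 r x -> f x = 0) ->
  measurable_fun setT (fun y => \int[leb1]_t f (row_cons (t, y))) /\
  \int[lebesgue_row R n.+1]_x f x = \int[lebesgue_row R n]_y \int[leb1]_t f (row_cons (t, y)).
Proof.
move=> mf hM f0.
have mB := @measurable_row_box R n.+1 r.
have iB : (lebesgue_row R n.+1).-integrable (row_box n.+1 r) (EFin \o f).
  by apply: (@bounded_integrable _ _ _ _ _ _ _ _ M) => //;
      [exact: row_box_finite|exact: measurable_funTS].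
have iT : (lebesgue_row R n.+1).-integrable setT (EFin \o f).
  have -> : EFin \o f = (EFin \o f) \_ (row_box n.+1 r).
    apply/funext => x; rewrite /patch; case: ifPn => // /negP hx /=.
    by rewrite f0// => h; apply: hx; rewrite inE.
  by apply/(integrable_mkcond _ _).1.
pose F := (EFin \o f) \o @row_cons R n.
have mF : measurable_fun setT F by apply: measurable_row_consE; exact/measurable_EFinP.
have iF : (leb1 \x lebesgue_row R n)%E.-integrable setT F.
  apply/integrableP; split => //.
  have /integrableP[_] := iT; apply: le_lt_trans.
  rewrite /= /lebesgue_row_step ge0_integral_pushforward//.
  - exact: measurable_row_cons.
  - by apply/measurable_EFinP; apply: measurableT_comp.
have mFy y : measurable_fun setT (fun t : R => f (row_cons (t, y))).
  apply: (measurableT_comp mf); apply: (measurableT_comp (@measurable_row_cons _ _ n)).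
  exact: pair2_measurable.
have E y : (\int[leb1]_t F (t, y) = (\int[leb1]_t f (row_cons (t, y)))%:E)%E.
  rewrite /Rintegral fineK//.
  have -> : (\int[leb1]_t (f (row_cons (t, y)))%:E = \int[leb1]_(t in `[(- r)%R,
      r]) (f (row_cons (t, y)))%:E)%E.
    rewrite [RHS]integral_mkcond; apply: eq_integral => t _; rewrite /patch;
        case: ifPn => // /negP ht.
    rewrite f0// => h; apply: ht; rewrite inE /= in_itv/= -ler_norml.
    by have := h ord0; rewrite mxE unlift_none.
  apply: integrable_fin_num => //.
  apply: (@bounded_integrable _ _ _ _ _ _ _ _ M) => //.
    by have := @lebesgue_measure_itv R `[- r, r]; rewrite /= => ->; case: ifP => _; rewrite ?ltry.
  exact: (measurable_funS measurableT (@subsetT _ _) (mFy y)).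
have mG := measurable_fubini_G iF.
have FG : fubini_G leb1 F = EFin \o (fun y => \int[leb1]_t f (row_cons (t, y))).
  by apply/funext => y; rewrite /fubini_G E.
split; first by apply/measurable_EFinP; rewrite -FG.
rewrite [LHS]/Rintegral [RHS]/Rintegral; congr fine.
transitivity (\int[(leb1 \x lebesgue_row R n)%E]_z F z)%E.
  rewrite /= /lebesgue_row_step integral_pushforward//.
  - exact: measurable_row_cons.
  - exact/measurable_EFinP.
by rewrite -integral21_prod_meas1// FG.
Qed.

End row_fubini.

(** * Boundary charts *)

Section pointwise_continuity.
Context {R : realType} {T : topologicalType}.
Implicit Types (f g : T -> R) (x : T).

Lemma cont_cst x (a : R) : continuous_at x (fun _ : T => a).
Proof. exact: cvg_cst. Qed.

Lemma cont_add f g x : continuous_at x f -> continuous_at x g ->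
  continuous_at x (fun y => f y + g y).
Proof. exact: cvgD. Qed.

Lemma cont_sub f g x : continuous_at x f -> continuous_at x g ->
  continuous_at x (fun y => f y - g y).
Proof. exact: cvgB. Qed.

Lemma cont_opp f x : continuous_at x f -> continuous_at x (fun y => - f y).
Proof. exact: cvgN. Qed.

Lemma cont_mul f g x : continuous_at x f -> continuous_at x g ->
  continuous_at x (fun y => f y * g y).
Proof. exact: cvgM. Qed.

Lemma cont_inv f x : f x != 0 -> continuous_at x f -> continuous_at x (fun y => (f y)^-1).
Proof. by move=> fx cf; apply: cvgV. Qed.

Lemma cont_sum (I : Type) (r : seq I) (f : I -> T -> R) x :
  (forall i, continuous_at x (f i)) -> continuous_at x (fun y => \sum_(i <- r) f i y).
Proof. by move=> h; apply: cvg_sumr. Qed.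

Lemma cont_comp {U W : topologicalType} (f : T -> U) (g : U -> W) x :
  continuous_at x f -> continuous_at (f x) g -> continuous_at x (fun y => g (f y)).
Proof. by move=> cf cg; apply: (@continuous_comp _ _ _ f g). Qed.

Lemma cont_row n (f : T -> 'rV[R]_n) x : (forall i, continuous_at x (fun y => f y 0 i)) ->
  continuous_at x f.
Proof. by move=> h; apply: cvg_row. Qed.

End pointwise_continuity.

Section dotp_lemmas.
Context {R : realType}.

Lemma dotpC n (u v : 'rV[R]_n) : dotp u v = dotp v u.
Proof. by apply: eq_bigr => i _; rewrite mulrC. Qed.

Lemma dotpDl n (u u' v : 'rV[R]_n) : dotp (u + u') v = dotp u v + dotp u' v.
Proof. by rewrite -big_split; apply: eq_bigr => i _; rewrite mxE mulrDl. Qed.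

Lemma dotpZl n a (u v : 'rV[R]_n) : dotp (a *: u) v = a * dotp u v.
Proof. by rewrite big_distrr; apply: eq_bigr => i _; rewrite mxE -mulrA. Qed.

Lemma dotpZr n a (u v : 'rV[R]_n) : dotp u (a *: v) = a * dotp u v.
Proof. by rewrite dotpC dotpZl dotpC. Qed.

Lemma dotpBl n (u u' v : 'rV[R]_n) : dotp (u - u') v = dotp u v - dotp u' v.
Proof. by rewrite dotpDl -scaleN1r dotpZl mulN1r. Qed.

Lemma dotpBr n (u v v' : 'rV[R]_n) : dotp u (v - v') = dotp u v - dotp u v'.
Proof. by rewrite dotpC dotpBl !(dotpC u). Qed.

Lemma dotp_trmx n (O : 'M[R]_n) u v : dotp u (v *m O^T) = dotp (u *m O) v.
Proof.
have E (a b : 'rV[R]_n) : dotp a b = (a *m b^T) 0 0.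
  by rewrite mxE; apply: eq_bigr => i _; rewrite mxE.
by rewrite !E trmx_mul trmxK mulmxA.
Qed.

Lemma dotp_row_cons n (u : 'rV[R]_n.+1) a (v : 'rV[R]_n) :
  dotp u (row_cons (a, v)) = u 0 ord0 * a + dotp (row_behead u) v.
Proof.
rewrite /dotp big_ord_recl !mxE unlift_none; congr (_ + _).
by apply: eq_bigr => i _; rewrite !mxE liftK.
Qed.

End dotp_lemmas.

Section derive_linear.
Context {R : realType}.

Lemma is_derive_scale {V : normedModType R} (f : V -> R) p v a df :
  is_derive p v f df -> is_derive p (a *: v) f (a * df).
Proof.
move=> /is_derive_line h; apply/is_derive_line.
have -> : (fun h : R => f (h *: (a *: v) + p)) = (fun h : R => f (h *: v + p)) \o (fun h => a * h).
  by apply/funext => t /=; rewrite scalerA mulrC.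
have ha : is_derive (0 : R) 1 (fun h : R => a * h) a.
  apply: (@is_derive_affine _ R^o) => t.
  by rewrite /GRing.scale /= mulr1 mulrDr mulrC.
rewrite mulrC; apply: (@is_derive1_comp _ (fun h : R => f (h *: v + p)) (fun h => a * h)) => //.
by rewrite mulr0.
Qed.

(** The direction is built up one basis vector at a time; each addition is [is_derive_addv], whose
    continuity assumption is part of [C1]. *)
Lemma derive_linear n (f : 'rV[R]_n -> R) (v x : 'rV[R]_n) : C1 f ->
  'D_v f x = \sum_j v 0 j * 'D_(delta_mx 0 j) f x.
Proof.
move=> hf.
suff H (r : seq 'I_n) : is_derive x (\sum_(j <- r) v 0 j *: delta_mx 0 j) f
    (\sum_(j <- r) v 0 j * 'D_(delta_mx 0 j) f x).
  by have [_] := H (index_enum _); rewrite -row_sum_delta.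
elim: r => [|j r IH].
  rewrite !big_nil; apply: is_derive_affine => h.
  by rewrite scaler0 add0r mulr0 add0r.
have hj := is_derive_scale (v 0 j) (C1_is_derive x (delta_mx 0 j) hf).
rewrite !big_cons addrC [X in is_derive _ _ _ X]addrC.
have [_ <-] := hj.
apply: is_derive_addv => //.
- by apply: (@nearW _ (nbhs x)) => y; have := (hf.2 (v 0 j *: delta_mx 0 j)).1 y.
- by have := (hf.2 (v 0 j *: delta_mx 0 j)).2 x.
Qed.

(** The filter [nbhs p] sees the point [p] itself, so a limit along it can only be [g p]. *)
Lemma cvg_continuous_at {V : normedModType R} (g : V -> R) p :
  cvg (g q @[q --> p]) -> {for p, continuous g}.
Proof.
move=> /cvg_ex[l hl]; suff E : l = g p by move: hl; rewrite E.
apply/eqP; rewrite -subr_eq0 -normr_eq0 eq_le normr_ge0 andbT.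
apply/ler_addgt0Pl => e e0; rewrite addr0.
by have /cvgrPdist_le/(_ e e0)/nbhs_singleton := hl.
Qed.

Lemma C2_closureT_C1 {V : normedModType R} (f : V -> R) : C2_closure setT f -> C1 f.
Proof.
move=> [cf df ef _ _]; split.
  move=> x; rewrite closureT in cf.
  by move/within_continuousP : cf => /cont_on_open; apply => //; exact: openT.
move=> v; split => [x|x]; first exact: df.
apply: cvg_continuous_at.
have := ef v x; rewrite closureT => /(_ I) /cvg_ex[l hl]; apply/cvg_ex; exists l.
by move=> B /hl hB; move: (hB : nbhs x (fun y => setT y -> B ('D_v f y))); apply: filterS => y;
    exact.
Qed.

End derive_linear.

Section chart_functions.
Context {R : realType} {m : nat}.
Local Notation V := ('rV[R]_m.+1).
Implicit Types (Omega W : set V) (O : 'M[R]_m.+1) (gam : 'rV[R]_m -> R).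

(** A defining function of the domain in the chart, positive inside. Vertical distance to the graph
    takes the place of the distance to the boundary. *)
Definition height O gam (x : V) : R := gam (row_behead (x *m O)) - (x *m O) 0 0.
Definition graph_grad gam y : 'rV[R]_m := \row_j 'D_(delta_mx 0 j) gam y.
(** Minus the gradient of [height]: it points outwards and has length [jacobian], so that [conormal]
    times dy is the vector surface element nu dS and no square root is left in the boundary
    integrals. *)
Definition conormal O gam (y : 'rV[R]_m) : V := row_cons (1, - graph_grad gam y) *m O^T.
Definition jacobian gam (y : 'rV[R]_m) : R := Num.sqrt (1 + \sum_(j < m) ('D_(delta_mx 0 j) gam
    y) ^+ 2).
Definition foot O (x : V) : 'rV[R]_m := row_behead (x *m O).

Lemma is_derive_height O gam x v : C1 gam ->
  is_derive x v (height O gam) (- dotp v (conormal O gam (foot O x))).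
Proof.
move=> hg.
have h1 : is_derive x v (fun x => gam (foot O x)) ('D_(row_behead (v *m O)) gam (foot O x)).
  apply/is_derive_line.
  have -> : (fun h : R => gam (foot O (h *: v + x))) = (fun h : R =>
      gam (h *: row_behead (v *m O) + foot O x)).
    by apply/funext => h; rewrite /foot mulmxDl -scalemxAl row_beheadD.
  exact: (is_derive_line _ _ _ _).1 (C1_is_derive _ _ hg).
have h2 : is_derive x v (fun x : V => (x *m O) 0 0) ((v *m O) 0 0).
  by apply: is_derive_affine => h; rewrite mulmxDl -scalemxAl !mxE.
apply: is_derive_eq (is_deriveB h1 h2) _.
rewrite dotp_trmx dotp_row_cons mulr1 opprD addrC derive_linear//; congr (_ + _).
rewrite -[- graph_grad _ _]scaleN1r dotpZr mulN1r opprK.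
by apply: eq_bigr => j _; rewrite !mxE.
Qed.

Lemma foot_continuous O : continuous (foot O).
Proof.
move=> x; apply: (@cont_comp _ _ _ (fun x : V => x *m O) (@row_behead R m)).
  exact: mulmx_row_continuous.
exact: row_behead_continuous.
Qed.

Lemma conormal_continuous O gam i : C1 gam -> continuous (fun y => conormal O gam y 0 i).
Proof.
move=> hg y; rewrite /conormal.
apply: (@cont_comp _ _ _ (fun y => row_cons (1, - graph_grad gam y) *m O^T) (fun x : V =>
    x 0 i)); last exact: row_coord_continuous.
apply: (@cont_comp _ _ _ (fun y => row_cons (1, - graph_grad gam y)) (fun x : V => x *m O^T));
    last exact: mulmx_row_continuous.
apply: cont_row => j.
have -> : (fun y => row_cons (1, - graph_grad gam y) 0 j) =
    (fun y => if unlift ord0 j is Some k then - 'D_(delta_mx 0 k) gam y else 1).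
  by apply/funext => z; rewrite mxE; case: unlift => //= k; rewrite !mxE.
case: unlift => [k|]; last exact: cont_cst.
by apply: cont_opp; exact: (hg.2 _).2.
Qed.

Lemma C1_height O gam : C1 gam -> C1 (height O gam).
Proof.
move=> hg; apply: (@C1_intro _ _ _ (fun v x => - dotp v (conormal O gam (foot O x)))) =>
    [x|v x|v x].
- apply: cont_sub.
    apply: (@cont_comp _ _ _ (foot O) gam); [exact: foot_continuous|exact: hg.1].
  apply: (@cont_comp _ _ _ (fun x : V => x *m O) (fun x : V => x 0 0)).
    exact: mulmx_row_continuous.
  exact: row_coord_continuous.
- exact: is_derive_height.
- apply: cont_opp; apply: cont_sum => i; apply: cont_mul; first exact: cont_cst.
  apply: (@cont_comp _ _ _ (foot O) (fun y => conormal O gam y 0 i)).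
    exact: foot_continuous.
  exact: conormal_continuous.
Qed.

Lemma jacobian_sqr gam y : jacobian gam y ^+ 2 = 1 + \sum_(j < m) ('D_(delta_mx 0 j) gam y) ^+ 2.
Proof.
rewrite sqr_sqrtr// addr_ge0//; apply: sumr_ge0 => j _; exact: sqr_ge0.
Qed.

Lemma jacobian_gt0 gam y : 0 < jacobian gam y.
Proof.
rewrite sqrtr_gt0 ltr_pwDl//; apply: sumr_ge0 => j _; exact: sqr_ge0.
Qed.

Lemma jacobian_continuous gam : C1 gam -> continuous (jacobian gam).
Proof.
move=> hg y.
apply: (@cont_comp _ _ _ (fun y => 1 + \sum_(j < m) ('D_(delta_mx 0 j) gam y) ^+ 2) Num.sqrt);
    last exact: sqrt_continuous.
apply: cont_add; first exact: cont_cst.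
apply: cont_sum => j.
have -> : (fun y => 'D_(delta_mx 0 j) gam y ^+ 2) = (fun y =>
    'D_(delta_mx 0 j) gam y * 'D_(delta_mx 0 j) gam y).
  by apply/funext => z; rewrite expr2.
by apply: cont_mul; exact: (hg.2 _).2.
Qed.

Lemma dotp_conormal O gam y : O *m O^T = 1%:M ->
  dotp (conormal O gam y) (conormal O gam y) = jacobian gam y ^+ 2.
Proof.
move=> OO; rewrite /conormal dotp_trmx -mulmxA (mulmx1C OO) mulmx1 dotp_row_cons.
rewrite mxE unlift_none mulr1 jacobian_sqr; congr (_ + _).
by apply: eq_bigr => j _; rewrite !mxE liftK !mxE mulrNN expr2.
Qed.

Lemma graph_pointK O gam y : O *m O^T = 1%:M -> graph_point O gam y *m O = row_cons (gam y, y).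
Proof. by move=> OO; rewrite /graph_point -mulmxA (mulmx1C OO) mulmx1. Qed.

Lemma foot_graph_point O gam y : O *m O^T = 1%:M -> foot O (graph_point O gam y) = y.
Proof.
move=> OO; rewrite /foot graph_pointK//.
by apply/rowP => i; rewrite !mxE liftK.
Qed.

Lemma height_graph_point O gam y : O *m O^T = 1%:M -> height O gam (graph_point O gam y) = 0.
Proof.
move=> OO; rewrite /height -/(foot _ _) foot_graph_point// graph_pointK// mxE unlift_none.
by rewrite subrr.
Qed.

Lemma graph_point_continuous O gam : C1 gam -> continuous (graph_point O gam).
Proof.
move=> hg y.
apply: (@cont_comp _ _ _ (fun y => row_cons (gam y, y)) (fun x : V => x *m O^T));
    last exact: mulmx_row_continuous.
apply: cont_row => j.
have -> : (fun y => row_cons (gam y, y) 0 j) = (fun y : 'rV[R]_m =>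
    if unlift ord0 j is Some k then y 0 k else gam y).
  by apply/funext => z; rewrite mxE.
case: unlift => [k|]; last exact: hg.1.
exact: row_coord_continuous.
Qed.

End chart_functions.

Section chart_boundary.
Context {R : realType} {m : nat}.
Local Notation V := ('rV[R]_m.+1).
Variables (Omega W : set V) (O : 'M[R]_m.+1) (gam : 'rV[R]_m -> R).
Hypotheses (oOmega : open Omega) (hc : C2_chart Omega W O gam).

Let oW : open W. Proof. by case: hc. Qed.
Let OO : O *m O^T = 1%:M. Proof. by case: hc. Qed.
Let hg : C1 gam. Proof. by case: hc => _ _ /C2_closureT_C1. Qed.

Lemma chart_inside x : W x -> Omega x <-> 0 < height O gam x.
Proof. by case: hc => _ _ _ h /h; rewrite /height subr_gt0. Qed.

Lemma bdryE x : bdry Omega x <-> closure Omega x /\ ~ Omega x.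
Proof. by rewrite /bdry; split => -[? ]; rewrite ((interior_id _).1 oOmega). Qed.

Lemma line_cvg (x u : V) : x + s *: u @[s --> 0^'+] --> x.
Proof.
apply: cvg_at_right_filter.
rewrite -[X in _ --> X]addr0 -(scale0r u).
by apply: cvgD; [exact: cvg_cst|apply: cvgZr_tmp; exact: cvg_id].
Qed.

Lemma line_near (x u : V) (P : set V) : nbhs x P -> \forall s \near 0^'+, P (x + s *: u).
Proof. exact: line_cvg. Qed.

Lemma height_line x u : height O gam x = 0 ->
  s^-1 * height O gam (x + s *: u) @[s --> 0^'+] --> - dotp u (conormal O gam (foot O x)).
Proof.
move=> h0; have [d <-] := @is_derive_height _ _ O gam x u hg.
have /cvg_ex[l hl] := d.
have -> : 'D_u (height O gam) x = l by apply: cvg_lim.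
have -> : (fun s : R => s^-1 * height O gam (x + s *: u)) = (fun h =>
    h^-1 *: ((height O gam \o shift x) (h *: u) - height O gam x)).
  by apply/funext => s /=; rewrite h0 subr0 addrC.
exact: cvg_dnbhs_at_right.
Qed.

Lemma height_line_gt0 x u : height O gam x = 0 -> dotp u (conormal O gam (foot O x)) < 0 ->
  \forall s \near 0^'+, 0 < height O gam (x + s *: u).
Proof.
move=> h0 hu.
have h : \forall s \near 0^'+, 0 < s^-1 * height O gam (x + s *: u).
  by apply: (cvgr_gt _ (height_line h0)); rewrite oppr_gt0.
near=> s.
have s0 : 0 < s by near: s; exact: nbhs_right_gt.
have := near h s; rewrite pmulr_rgt0 ?invr_gt0//; apply.
by [].
Unshelve. all: by end_near. Qed.

Lemma height_line_lt0 x u : height O gam x = 0 -> 0 < dotp u (conormal O gam (foot O x)) ->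
  \forall s \near 0^'+, height O gam (x + s *: u) < 0.
Proof.
move=> h0 hu.
have h : \forall s \near 0^'+, s^-1 * height O gam (x + s *: u) < 0.
  by apply: (cvgr_lt _ (height_line h0)); rewrite oppr_lt0.
near=> s.
have s0 : 0 < s by near: s; exact: nbhs_right_gt.
have := near h s; rewrite pmulr_rlt0 ?invr_gt0//; apply.
by [].
Unshelve. all: by end_near. Qed.

Lemma conormal_gt0 y : 0 < dotp (conormal O gam y) (conormal O gam y).
Proof. by rewrite dotp_conormal// exprn_gt0// jacobian_gt0. Qed.

(** A boundary point is not inside, so its height is at most 0, and a negative height would persist
    nearby and keep the domain away. Conversely, from a point of height 0 the height increases along
    minus the conormal, which leads into the domain. *)
Lemma chart_bdry x : W x -> bdry Omega x <-> height O gam x = 0.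
Proof.
move=> Wx; have nW : nbhs x W by exact: open_nbhs_nbhs.
rewrite bdryE; split => [[cx nx]|h0].
  have h0 : height O gam x <= 0 by rewrite leNgt; apply/negP => /(chart_inside Wx).
  apply/eqP; rewrite eq_le h0 /= leNgt; apply/negP => hlt.
  have hn : \forall y \near x, height O gam y < 0.
    by apply: (cvgr_lt _ ((C1_height O hg).1 x)).
  have [y [Oy [Wy hy]]] := cx _ (filterI nW hn).
  by move/(chart_inside Wy) : Oy; rewrite ltNge (ltW hy).
split; last by move/(chart_inside Wx); rewrite h0 ltxx.
move=> B nB.
pose u := - conormal O gam (foot O x).
have hu : dotp u (conormal O gam (foot O x)) < 0.
  by rewrite /u -scaleN1r dotpZl mulN1r oppr_lt0 conormal_gt0.
have H : \forall s \near 0^'+, 0 < height O gam (x + s *: u) /\ (W (x + s *: u) /\ B (x + s *: u)).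
  apply: filterI; first exact: height_line_gt0.
  by apply: filterI; exact: line_near.
have [s [h1 [h2 h3]]] := filter_ex H.
by exists (x + s *: u); split => //; exact/(chart_inside h2).
Qed.

Definition chart_normal x : V := (jacobian gam (foot O x))^-1 *: conormal O gam (foot O x).

(** If two unit vectors [v] and [v'] differ, then [v' - v] points inwards according to [v] and
    outwards according to [v'], which no short segment can satisfy. *)
Lemma is_outer_normal_uniq x (v v' : V) : is_outer_normal Omega x v -> is_outer_normal Omega x v'
    -> v = v'.
Proof.
move=> [v1 vin vout] [v1' vin' vout'].
have [vv|vv] := leP 1 (dotp v v').
  have : dotp (v - v') (v - v') <= 0.
    rewrite dotpBl !dotpBr v1 v1' (dotpC v' v).
    by move: (dotp v v') vv => z; lra.
  move=> h; have /dotp_eq0/eqP : dotp (v - v') (v - v') = 0.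
    by apply/le_anti; rewrite h dotp_ge0.
  by rewrite subr_eq0 => /eqP.
exfalso; pose u := v' - v.
have hu : dotp u v < 0 by rewrite /u dotpBl v1 subr_lt0 dotpC.
have hu' : 0 < dotp u v' by rewrite /u dotpBl v1' subr_gt0.
have H : \forall s \near 0^'+, Omega (x + s *: u) /\ ~ closure Omega (x + s *: u).
  by apply: filterI; [exact: vin|exact: vout'].
have [s [h1 h2]] := filter_ex H.
by apply: h2; exact: subset_closure.
Qed.

(** Since [outer_normal] is a choice among the vectors satisfying [is_outer_normal], both existence,
    read off the sign of the derivative of [height], and uniqueness are required. *)
Lemma outer_normalE x : W x -> bdry Omega x -> outer_normal Omega x = chart_normal x.
Proof.
move=> Wx bx; have h0 := (chart_bdry Wx).1 bx.
have nW : nbhs x W by exact: open_nbhs_nbhs.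
have J0 := jacobian_gt0 gam (foot O x).
have H : is_outer_normal Omega x (chart_normal x).
  split.
  - rewrite /chart_normal dotpZl dotpZr dotp_conormal// expr2.
    by rewrite mulKf ?gt_eqF// mulVf// gt_eqF.
  - move=> u; rewrite /chart_normal dotpZr pmulr_rlt0 ?invr_gt0// => hu.
    apply: filterS2 (height_line_gt0 h0 hu) (line_near u nW) => s h1 h2.
    exact/(chart_inside h2).
  - move=> u; rewrite /chart_normal dotpZr pmulr_rgt0 ?invr_gt0// => hu.
    apply: filterS2 (height_line_lt0 h0 hu) (line_near u nW) => s h1 h2 cl.
    have hn : \forall y \near x + s *: u, height O gam y < 0.
      by apply: (cvgr_lt _ ((C1_height O hg).1 (x + s *: u))).
    have nW2 : nbhs (x + s *: u) W by exact: open_nbhs_nbhs.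
    have [y [Oy [Wy hy]]] := cl _ (filterI nW2 hn).
    by move/(chart_inside Wy) : Oy; rewrite ltNge (ltW hy).
have H' : is_outer_normal Omega x (outer_normal Omega x).
  by apply: (@getPex _ (is_outer_normal Omega x)); exists (chart_normal x).
exact: is_outer_normal_uniq H' H.
Qed.

Lemma chart_normal_continuous i : continuous (fun x => chart_normal x 0 i).
Proof.
move=> x.
have -> : (fun x => chart_normal x 0 i) = (fun x => (jacobian gam (foot O x))^-1 * conormal O gam
    (foot O x) 0 i).
  by apply/funext => z; rewrite mxE.
apply: cont_mul; last first.
  apply: (@cont_comp _ _ _ (foot O) (fun y => conormal O gam y 0 i)).
    exact: foot_continuous.
  exact: conormal_continuous.
apply: cont_inv; first by rewrite gt_eqF// jacobian_gt0.
apply: (@cont_comp _ _ _ (foot O) (jacobian gam)); first exact: foot_continuous.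
exact: jacobian_continuous.
Qed.

Lemma graph_point_bdry y : W (graph_point O gam y) -> bdry Omega (graph_point O gam y).
Proof. by move=> h; apply/(chart_bdry h); exact: height_graph_point. Qed.

End chart_boundary.

(** * Boundary layers under a graph *)

Section layer_1d.
Context {R : realType}.
Local Notation leb1 := (@lebesgue_measure R).

Implicit Types k s a e : R.

(** Supported on [[1/k, 2/k]] with integral 1. The shift by 1 keeps the layer off the boundary, so
    that a cutoff with this slope is constant near each boundary point of the chart. *)
Definition layer_kernel (k : R) (s : R) : R := k * dstep (k * s - 1).

Lemma layer_kernel_ge0 k s : 0 <= k -> 0 <= layer_kernel k s.
Proof. by move=> k0; rewrite mulr_ge0// dstep_ge0. Qed.

Lemma layer_kernel_le k s : 0 <= k -> layer_kernel k s <= 2 * k.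
Proof. by move=> k0; rewrite [leRHS]mulrC ler_wpM2l// dstep_le2. Qed.

Lemma layer_kernel_eq0 k s : 0 < k -> s <= k^-1 \/ 2 / k <= s -> layer_kernel k s = 0.
Proof.
move=> k0 h; rewrite /layer_kernel dstep_eq0 ?mulr0//.
case: h => [|] h; [left|right].
  by rewrite subr_le0 -ler_pdivlMl// mulr1.
by rewrite lerBrDr -[1 + 1]/(2%:R) -ler_pdivrMl// mulrC.
Qed.

Lemma layer_kernel_continuous k : continuous (layer_kernel k).
Proof.
move=> s; apply: cont_mul; first exact: cont_cst.
apply: (@cont_comp _ _ _ (fun s => k * s - 1) (@dstep R)); last exact: dstep_continuous.
apply: cont_sub; last exact: cont_cst.
by apply: cont_mul; [exact: cont_cst|exact: cvg_id].
Qed.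

Let I (k a : R) : set R := `[a - 2 / k, a - k^-1]%classic.

Lemma layer_kernel_itv k a : 0 < k ->
  leb1.-integrable (I k a) (EFin \o (fun t : R => layer_kernel k (a - t))) /\
  \int[leb1]_(t in I k a) layer_kernel k (a - t) = 1.
Proof.
move=> k0; have ab : a - 2 / k < a - k^-1.
  rewrite ltrD2l ltrN2 ltr_pdivlMr// mulVf ?gt_eqF//; lra.
(* An antiderivative of the kernel, which rises from -1 to 0 across the interval. *)
pose F (t : R) := - step (k * (a - t) - 1).
have dF (t : R) : is_derive t 1 F (layer_kernel k (a - t)).
  have h1 : is_derive t 1 (fun t : R => k * (a - t) - 1) (- k).
    by apply: (@is_derive_affine _ R^o) => h; rewrite /GRing.scale /=; ring.
  have h2 := @is_derive1_comp _ (@step R) (fun t : R =>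
      k * (a - t) - 1) t _ _ (is_derive_step _) h1.
  apply: is_derive_eq (is_deriveN h2) _.
  by rewrite /layer_kernel mulrN opprK mulrC.
have cK : continuous (fun t : R => layer_kernel k (a - t)).
  move=> t; apply: (@cont_comp _ _ _ (fun t => a - t) (layer_kernel k));
      last exact: layer_kernel_continuous.
  by apply: cont_sub; [exact: cont_cst|exact: cvg_id].
have cF : continuous F.
  by move=> t; apply/differentiable_continuous/derivable1_diffP; have [] := dF t.
split.
  apply: continuous_compact_integrable; first exact: segment_compact.
  by apply: continuous_subspaceT.
rewrite /Rintegral (@continuous_FTC2 _ _ F)//.
- rewrite -EFinB /= /F.
  have -> : k * (a - (a - k^-1)) - 1 = 0.
    by rewrite opprB addrCA subrr addr0 divff ?subrr// gt_eqF.
  have -> : k * (a - (a - 2 / k)) - 1 = 1.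
    rewrite opprB addrCA subrr addr0 mulrCA divff ?gt_eqF//; lra.
  by rewrite step_le0// step_ge1// opprK oppr0 add0r.
- exact: continuous_subspaceT.
- split.
  + by move=> t _; have [] := dF t.
  + by apply: cvg_at_right_filter; exact: cF.
  + by apply: cvg_at_left_filter; exact: cF.
- by move=> t _; rewrite derive1E; have [_ ->] := dF t.
Qed.

Variables (h : R -> R) (a L C : R).
Hypotheses (mh : measurable_fun setT h) (hC : forall t, `|h t| <= C).

Let intE k : 0 < k -> \int[leb1]_t (h t * layer_kernel k (a - t)) =
  \int[leb1]_(t in I k a) (h t * layer_kernel k (a - t)).
Proof.
move=> k0; rewrite [RHS]Rintegral_mkcond; apply: eq_Rintegral => t _.
rewrite /patch; case: ifPn => // /negP ht.
rewrite layer_kernel_eq0 ?mulr0//.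
have [h1|h1] := leP (a - t) k^-1; first by left.
have [h2|h2] := leP (2 / k) (a - t); first by right.
exfalso; apply: ht; rewrite inE /I /= in_itv /=.
by apply/andP; split; [rewrite lerBlDr -lerBlDl ltW|rewrite lerBrDr -lerBrDl ltW].
Qed.

Let mK k : measurable_fun setT (fun t : R => layer_kernel k (a - t)).
Proof.
apply: continuous_measurable_fun => t.
apply: (@cont_comp _ _ _ (fun t => a - t) (layer_kernel k)); last exact: layer_kernel_continuous.
by apply: cont_sub; [exact: cont_cst|exact: cvg_id].
Qed.

Let mI k : measurable (I k a : set (measurableTypeR R)). Proof. exact: measurable_itv. Qed.

Let Ifin k : (leb1 (I k a) < +oo)%E.
Proof. by rewrite lebesgue_measure_itv /=; case: ifP => _; rewrite ?ltry. Qed.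

Let ibd (k : R) (g : R -> R) (M : R) : 0 < k -> measurable_fun setT g ->
  (forall t, I k a t -> `|g t| <= M) ->
  leb1.-integrable (I k a) (EFin \o (fun t : R => g t * layer_kernel k (a - t))).
Proof.
move=> k0 mg hg; apply: (@bounded_integrable _ _ _ _ _ _ _ _ (M * (2 * k))).
- exact: mI.
- exact: Ifin.
- apply: (measurable_funS measurableT (@subsetT _ _)).
  exact: (measurable_funM mg (mK k)).
- move=> t It; rewrite normrM; apply: ler_pM => //; first exact: hg.
  by rewrite ger0_norm ?layer_kernel_ge0 ?layer_kernel_le// ltW.
Qed.

Let bound (k : R) (g : R -> R) (e : R) : 0 < k -> measurable_fun setT g ->
  (forall t, I k a t -> `|g t| <= e) ->
  `|\int[leb1]_(t in I k a) (g t * layer_kernel k (a - t))| <= e.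
Proof.
move=> k0 mg hg; have [iK K1] := layer_kernel_itv a k0.
have ig := ibd k0 mg hg.
apply: le_trans (le_normr_Rintegral (mI k) ig) _.
have -> : e = \int[leb1]_(t in I k a) (e * layer_kernel k (a - t)).
  by rewrite RintegralZl// -[LHS]mulr1; congr (_ * _); exact: (esym K1).
apply: le_Rintegral.
- exact: mI.
- have := integrable_norm ig; apply: eq_integrable; first exact: mI.
  by move=> t _.
- have := integrableZl (mI k) e iK.
  by apply: eq_integrable; first exact: mI.
- move=> t It; rewrite normrM; apply: ler_pM => //; first exact: hg.
  by rewrite ger0_norm// layer_kernel_ge0// ltW.
Qed.

Lemma layer_1d_bound k : 0 < k -> `|\int[leb1]_t (h t * layer_kernel k (a - t))| <= C.
Proof. by move=> k0; rewrite intE//; exact: bound. Qed.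

(** The kernels form an approximate identity concentrating at [a] from below, so a one-sided limit
    [L] of [h] at [a] is all they can see. *)
Lemma layer_1d_cvg : (forall e : R, 0 < e -> exists2 dl : R, 0 < dl & forall t : R,
    0 < a - t < dl -> `|h t - L| <= e) ->
  \int[leb1]_t (h t * layer_kernel n.+1%:R (a - t)) @[n --> \oo] --> L.
Proof.
move=> hL; apply/cvgrPdist_le => e e0; have [dl dl0 hdl] := hL e e0.
near=> n; have k0 : 0 < n.+1%:R :> R by [].
have [iK K1] := layer_kernel_itv a k0.
have LE : L = \int[leb1]_(t in I n.+1%:R a) (L * layer_kernel n.+1%:R (a - t)).
  by rewrite RintegralZl// -[LHS]mulr1; congr (_ * _); exact: (esym K1).
have ih : leb1.-integrable (I n.+1%:R a) (EFin \o (fun t : R =>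
    h t * layer_kernel n.+1%:R (a - t))).
  exact: (ibd k0 mh (fun t _ => hC t)).
have iL : leb1.-integrable (I n.+1%:R a) (EFin \o (fun t : R => L * layer_kernel n.+1%:R (a - t))).
  by have := integrableZl (mI n.+1%:R) L iK; apply: eq_integrable; first exact: mI.
rewrite (intE k0) {1}LE -RintegralB//.
under eq_Rintegral do rewrite -mulrBl.
apply: bound => //; first exact: measurable_funB.
move=> t; rewrite /I /= in_itv /= => /andP[t1 t2]; rewrite distrC; apply: hdl.
apply/andP; split.
  by rewrite (lt_le_trans (_ : 0 < n.+1%:R^-1 :> R)) ?invr_gt0// lerBrDl -lerBrDr.
apply: (@le_lt_trans _ _ (2 / n.+1%:R)); first by rewrite lerBlDl -lerBlDr.
rewrite ltr_pdivrMr// -ltr_pdivrMl//.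
rewrite (@lt_trans _ _ n%:R) ?ltr_nat//.
by near: n; exact: nbhs_infty_gtr.
Unshelve. all: by end_near. Qed.

End layer_1d.

Section chart_layer.
Context {R : realType} {m : nat}.
Local Notation V := ('rV[R]_m.+1).
Variables (Omega W K : set V) (O : 'M[R]_m.+1) (gam : 'rV[R]_m -> R) (rho : R).
Hypotheses (oOmega : open Omega) (hc : C2_chart Omega W O gam).
Hypotheses (cK : closed K) (KW : K `<=` W) (Kbox : K `<=` row_box m.+1 rho).

Let OO : O *m O^T = 1%:M. Proof. by case: hc. Qed.
Let hg : C1 gam. Proof. by case: hc => _ _ /C2_closureT_C1. Qed.
Let oW : open W. Proof. by case: hc. Qed.
Let G := graph_point O gam.

Let Kimage : exists2 r, 0 < r & forall x, K x -> row_box m.+1 r (x *m O).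
Proof.
have : compact ((fun x : V => x *m O) @` row_box m.+1 rho).
  apply: continuous_compact; last exact: compact_row_box.
  by apply: continuous_subspaceT; exact: mulmx_row_continuous.
move=> /compact_bounded/bounded_subset_box[r r0 h].
by exists r => // x Kx; apply: h; exists x => //; exact: Kbox.
Qed.

Variables (H : V -> R) (n : 'rV[R]_m -> R) (C : R).
Hypotheses (cH : cont_on (closure Omega) H) (HC : forall x, closure Omega x -> `|H x| <= C)
  (HK : forall x, closure Omega x -> ~ K x -> H x = 0) (cn : continuous n).

Let h := H \_ Omega.

Let mh : measurable_fun setT h.
Proof.
apply/(measurable_restrict _ _ _).1 => //; first exact: open_measurable_row.
rewrite setTI; apply: within_continuous_measurable_row; first exact: open_measurable_row.
by apply/within_continuousP; apply: cont_onW cH; exact: subset_closure.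
Qed.

Let hC x : `|h x| <= `|C|.
Proof.
rewrite /h /patch; case: ifPn => [/set_mem Ox|_]; last by rewrite normr0.
by apply: le_trans (ler_norm C); apply: HC; exact: subset_closure.
Qed.

Let hK x : h x != 0 -> Omega x /\ K x.
Proof.
rewrite /h /patch; case: ifPn => [/set_mem Ox|_]; last by rewrite eqxx.
move=> Hx; split => //; apply: contrapT => nK; move/eqP: Hx; apply.
by apply: HK => //; exact: subset_closure.
Qed.

Let slice (t : R) (y : 'rV[R]_m) : V := row_cons (t, y) *m O^T.

Let sliceK t y : slice t y *m O = row_cons (t, y).
Proof. by rewrite /slice -mulmxA (mulmx1C OO) mulmx1. Qed.

Let foot_slice t y : foot O (slice t y) = y.
Proof. by rewrite /foot sliceK; apply/rowP => i; rewrite !mxE liftK. Qed.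

Let height_slice t y : height O gam (slice t y) = gam y - t.
Proof. by rewrite /height -/(foot _ _) foot_slice sliceK mxE unlift_none. Qed.

Let slice_continuous y : continuous (fun t => slice t y).
Proof.
move=> t; apply: (@cont_comp _ _ _ (fun t => row_cons (t, y)) (fun x : V => x *m O^T)).
  apply: cont_row => j.
  have -> : (fun t => row_cons (t, y) 0 j) = (fun t =>
      if unlift ord0 j is Some k then y 0 k else t).
    by apply/funext => z; rewrite mxE.
  by case: unlift => [k|]; [exact: cont_cst|exact: cvg_id].
exact: mulmx_row_continuous.
Qed.

(** If the graph point over [y] lies in [W], points slightly below it are in the domain and [H] is
    continuous up to the boundary. Otherwise the graph point is off the closed set [K], and the
    integrand vanishes nearby. *)
Let limit_slice y (e : R) : 0 < e ->
  exists2 dl : R, 0 < dl & forall t, 0 < gam y - t < dl ->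
   `|h (slice t y) * n y - ((H \o G) \_ (G @^-1` W)) y * n y| <= e.
Proof.
move=> e0.
suff hn : \forall t \near gam y, t < gam y -> `|h (slice t y) * n y - ((H \o G) \_ (G @^-1` W)) y
    * n y| <= e.
  have /nbhs_ballP[dl /= dl0 hb] := hn; exists dl => // t /andP[t1 t2].
  apply: hb; last by rewrite -subr_gt0.
  by rewrite -ball_normE /ball_ /= ger0_norm// ltW.
have cs := @slice_continuous y (gam y).
have [WG|WG] := pselect (W (G y)); last first.
  have nKG : nbhs (G y) (~` K).
    by apply: open_nbhs_nbhs; split; [exact: closed_openC|move=> /KW].
  have nK : \forall t \near gam y, ~ K (slice t y) := cs _ nKG.
  apply: filterS nK => t nK _; rewrite /patch memNset//= mul0r subr0.
  have [->|/hK[]//] := eqVneq (h (slice t y)) 0.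
  by rewrite mul0r normr0 ltW.
have Gcl : closure Omega (G y).
  by have /(bdryE oOmega)[] := graph_point_bdry oOmega hc WG.
have e1 : 0 < e / (`|n y| + 1) by rewrite divr_gt0// ltr_wpDl.
have /cont_onE/(_ _ Gcl (fun z => `|z - H (G y)| <= e / (`|n y| + 1))) := cH.
have nb : nbhs (H (G y)) (fun z => `|z - H (G y)| <= e / (`|n y| + 1)).
  apply/nbhs_ballP; exists (e / (`|n y| + 1)) => //= z.
  by rewrite -ball_normE /ball_ /= distrC => /ltW.
move=> /(_ nb) hN.
have nW : nbhs (G y) W by exact: open_nbhs_nbhs.
have hN2 : \forall t \near gam y,
    (closure Omega (slice t y) -> `|H (slice t y) - H (G y)| <= e / (`|n y| + 1)) /\ W (slice t y).
  by apply: filterI; [exact: (cs _ hN)|exact: (cs _ nW)].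
apply: filterS hN2 => t [h1 h2] ty.
have Ot : Omega (slice t y).
  by apply/(chart_inside hc h2); rewrite height_slice subr_gt0.
rewrite /patch mem_set//= -mulrBl normrM.
have {}h1 := h1 (subset_closure Ot).
have -> : h (slice t y) = H (slice t y) by rewrite /h /patch mem_set.
apply: (@le_trans _ _ (e / (`|n y| + 1) * (`|n y| + 1))).
  by apply: ler_pM => //; rewrite lerDl.
by rewrite divfK// gt_eqF// ltr_wpDl.
Qed.

(** After rotation into chart coordinates and Fubini, each fibre carries a one-dimensional layer
    below [gam y], whose limit is the value on the graph. The kernel has integral 1, so the fibre
    integrals are bounded by [|C| * N] uniformly in [k], and bounded convergence applies over a
    box. *)
Lemma chart_layer_cvg :
  \int[lebesgue_row R m.+1]_(x in Omega) (H x * n (foot O x) * layer_kernel k.+1%:R (height O gam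
      x)) @[k --> \oo]
  --> \int[lebesgue_row R m]_(y in G @^-1` W) (H (G y) * n y).
Proof.
have [r r0 hr] := Kimage.
have [N N0 hN] := cont_on_bounded (@compact_row_box R m r) (continuous_cont_on (fun y _ => @cn y)).
pose f k (y : V) := h (y *m O^T) * n (row_behead y) * layer_kernel k (gam (row_behead y) - y 0
    ord0).
have f0 k y : ~ row_box m.+1 r y -> f k y = 0.
  move=> nb; rewrite /f; have [->|/hK[_ Kx]] := eqVneq (h (y *m O^T)) 0; first by rewrite !mul0r.
  by exfalso; apply: nb; have := hr _ Kx; rewrite -mulmxA (mulmx1C OO) mulmx1.
have behead_box y : row_box m.+1 r y -> row_box m r (row_behead y).
  by move=> hy i; rewrite mxE.
have mhn : measurable_fun setT (fun y : V => h (y *m O^T) * n (row_behead y)).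
  apply: measurable_funM; first by apply: (measurableT_comp mh); exact: measurable_row_mulmx.
  apply: continuous_measurable_row => y.
  by apply: (@cont_comp _ _ _ (@row_behead R m) n); [exact: row_behead_continuous|exact: cn].
have mf k : measurable_fun setT (f k).
  apply: measurable_funM => //; apply: continuous_measurable_row => y.
  apply: (@cont_comp _ _ _ (fun y : V => gam (row_behead y) - y 0 ord0) (layer_kernel k));
      last exact: layer_kernel_continuous.
  apply: cont_sub; last exact: row_coord_continuous.
  by apply: (@cont_comp _ _ _ (@row_behead R m) gam); [exact: row_behead_continuous|exact: hg.1].
have fM (k : R) y : 0 < k -> `|f k y| <= `|C| * N * (2 * k).
  move=> k0; have [by_|/f0 ->] := pselect (row_box m.+1 r y); last first.
    by rewrite normr0 !mulr_ge0// ltW.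
  rewrite /f normrM; apply: ler_pM => //.
    by rewrite normrM; apply: ler_pM => //; apply: hN; exact: behead_box.
  by rewrite ger0_norm ?layer_kernel_ge0 ?layer_kernel_le// ltW.
have kp (k : nat) : 0 < k.+1%:R :> R by [].
pose Phi k (y : 'rV[R]_m) := \int[lebesgue_measure]_t (f k.+1%:R (row_cons (t, y))).
have beheadE t (y : 'rV[R]_m) : row_behead (row_cons (t, y)) = y.
  by apply/rowP => i; rewrite !mxE liftK.
have PhiE k y : Phi k y = \int[lebesgue_measure]_t (h (slice t y) * n y * layer_kernel k.+1%:R
    (gam y - t)).
  by apply: eq_Rintegral => t _; rewrite /f beheadE mxE unlift_none.
have mslice y : measurable_fun setT (fun t => h (slice t y) * n y).
  apply: measurable_funM => //; apply: (measurableT_comp mh).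
  apply: (measurableT_comp (measurable_row_mulmx O^T)).
  apply: (measurableT_comp (@measurable_row_cons _ _ m)).
  exact: pair2_measurable.
pose D := row_box m r.
have mD : measurable D by exact: measurable_row_box.
have Phi0 k y : ~ D y -> Phi k y = 0.
  move=> nD; rewrite /Phi /Rintegral integral0_eq// => t _.
  by rewrite f0// => /behead_box; rewrite beheadE.
have PhiM k y : D y -> `|Phi k y| <= `|C| * N.
  move=> Dy; rewrite PhiE; apply: layer_1d_bound => // t.
  by rewrite normrM; apply: ler_pM => //; exact: hN.
have E1 k : \int[lebesgue_row R m.+1]_(x in Omega) (H x * n (foot O x) * layer_kernel k.+1%:R
    (height O gam x)) =
    \int[lebesgue_row R m]_(y in D) Phi k y.
  have -> : \int[lebesgue_row R m]_(y in D) Phi k y = \int[lebesgue_row R m]_y Phi k y.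
    rewrite [LHS]Rintegral_mkcond; apply: eq_Rintegral => y _; rewrite /patch.
    by case: ifPn => // /negP nD; rewrite Phi0// => Dy; apply: nD; rewrite inE.
  have [_ <-] := Rintegral_row_cons2 (mf _) (fun y => fM _ y (kp k)) (f0 k.+1%:R).
  rewrite [LHS]Rintegral_mkcond /Rintegral; congr fine.
  rewrite -(integral_row_orthogonal (f := EFin \o f k.+1%:R) OO); last exact/measurable_EFinP.
  apply: eq_integral => x _ /=; congr EFin.
  rewrite /f -mulmxA OO mulmx1 /patch /h /patch; case: ifPn => // _; by rewrite !mul0r.
under eq_fun do rewrite E1.
pose L y := ((H \o G) \_ (G @^-1` W)) y * n y.
have -> : \int[lebesgue_row R m]_(y in G @^-1` W) (H (G y) * n y) = \int[lebesgue_row R m]_(y in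
    D) L y.
  rewrite [LHS]Rintegral_mkcond [RHS]Rintegral_mkcond; apply: eq_Rintegral => y _.
  rewrite /L /patch; case: ifPn => [/set_mem WG|_]; last by rewrite mul0r; case: ifP.
  case: ifPn => // /negP nD /=; rewrite HK ?mul0r//.
    by have /(bdryE oOmega)[] := graph_point_bdry oOmega hc WG.
  move=> /hr; rewrite graph_pointK// => /behead_box; rewrite beheadE => Dy.
  by apply: nD; rewrite inE.
apply: (bounded_cvg_Rintegral mD (row_box_finite _ _) (M := `|C| * N)).
- move=> k; apply: measurable_funTS.
  by have [] := Rintegral_row_cons2 (mf _) (fun y => fM _ y (kp k)) (f0 k.+1%:R).
- by move=> k y Dy; exact: PhiM.
- move=> y Dy; under eq_fun do rewrite PhiE.
  apply: (@layer_1d_cvg _ _ _ _ (`|C| * N)) => //.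
  + by move=> t; rewrite normrM; apply: ler_pM => //; exact: hN.
  + by move=> e e0; exact: limit_slice.
Qed.

End chart_layer.

Section cont_on_algebra.
Context {R : realType} {T : topologicalType}.
Implicit Types (A : set T) (f g : T -> R).

Lemma cont_on_cst A (a : R) : cont_on A (fun _ : T => a).
Proof. by move=> x Ax; exact: cvg_cst. Qed.

Lemma cont_on_add A f g : cont_on A f -> cont_on A g -> cont_on A (fun x => f x + g x).
Proof. by move=> cf cg x Ax; apply: cvgD; [exact: cf|exact: cg]. Qed.

Lemma cont_on_mul A f g : cont_on A f -> cont_on A g -> cont_on A (fun x => f x * g x).
Proof. by move=> cf cg x Ax; apply: cvgM; [exact: cf|exact: cg]. Qed.

Lemma cont_on_sub A f g : cont_on A f -> cont_on A g -> cont_on A (fun x => f x - g x).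
Proof. by move=> cf cg x Ax; apply: cvgB; [exact: cf|exact: cg]. Qed.

Lemma cont_on_norm A f : cont_on A f -> cont_on A (fun x => `|f x|).
Proof. by move=> cf x Ax; apply: cvg_norm; exact: cf. Qed.

Lemma cont_on_sum (I : Type) (r : seq I) A (f : I -> T -> R) :
  (forall i, cont_on A (f i)) -> cont_on A (fun x => \sum_(i <- r) f i x).
Proof. by move=> cf x Ax; apply: cvg_sumr => i; exact: cf. Qed.

Lemma continuous_cont_onT A f : continuous f -> cont_on A f.
Proof. by move=> cf; apply: continuous_cont_on => x _; exact: cf. Qed.

Lemma eq_cont_on {U : topologicalType} A (f g : T -> U) :
  (forall x, A x -> f x = g x) -> cont_on A f -> cont_on A g.
Proof.
move=> fg /cont_onE cf; apply/cont_onE => x Ax B; rewrite -fg// => /(cf x Ax).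
by apply: filterS => y h Ay; rewrite -fg//; exact: h.
Qed.

End cont_on_algebra.

Section bounded_domain.
Context {R : realType} {m : nat}.
Local Notation V := ('rV[R]_m.+1).
Variables (Omega : set V).
Hypotheses (oOmega : open Omega) (bOmega : bounded_set Omega).

Let mO : measurable Omega. Proof. exact: open_measurable_row. Qed.

Lemma bounded_closure : bounded_set (closure Omega).
Proof.
have [r r0 Or] := bounded_subset_box bOmega.
have h : closure Omega `<=` row_box m.+1 r.
  by apply: (subset_trans (closure_subset Or)); rewrite -(closure_id _).1//; exact: closed_row_box.
have [M [Mr hM]] := box_bounded m.+1 r; exists M; split => // x Mx y /h; exact: hM.
Qed.

Lemma compact_closure_domain : compact (closure Omega).
Proof. by apply: bounded_closed_compact; [exact: bounded_closure|exact: closed_closure]. Qed.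

Lemma domain_finite : (lebesgue_row R m.+1 Omega < +oo)%E.
Proof. exact: bounded_lebesgue_row. Qed.

Lemma closed_bdry : closed (bdry Omega).
Proof.
have -> : bdry Omega = closure Omega `&` ~` Omega.
  by apply/seteqP; split => x; rewrite (bdryE oOmega).
by apply: closedI; [exact: closed_closure|exact: open_closedC].
Qed.

Lemma compact_bdry : compact (bdry Omega).
Proof.
apply: subclosed_compact compact_closure_domain _; first exact: closed_bdry.
by move=> x [].
Qed.

Lemma cont_measurable_domain (f : V -> R) : cont_on Omega f -> measurable_fun Omega f.
Proof. by move=> /within_continuousP; exact: within_continuous_measurable_row. Qed.

Lemma cont_integrable_domain (f : V -> R) : cont_on (closure Omega) f ->
  (lebesgue_row R m.+1).-integrable Omega (EFin \o f).
Proof.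
move=> cf; have [M M0 hM] := cont_on_bounded compact_closure_domain cf.
apply: (bounded_integrable mO domain_finite (M := M)).
  by apply: cont_measurable_domain; apply: cont_onW cf; exact: subset_closure.
by move=> x Ox; apply: hM; exact: subset_closure.
Qed.

End bounded_domain.

Lemma continuous_measurable_row_map {R : realType} n k (f : 'rV[R]_n -> 'rV[R]_k) :
  continuous f -> measurable_fun setT f.
Proof.
move=> cf; apply: measurable_fun_rowP => i; apply: continuous_measurable_row => x.
by apply: (@cont_comp _ _ _ f (fun y : 'rV[R]_k => y 0 i)); [exact: cf|exact: row_coord_continuous].
Qed.

Section patches.
Context {R : realType} {m : nat}.
Local Notation V := ('rV[R]_m.+1).
Variables (Omega : set V) (sigma : {measure set V -> \bar R}).
Hypotheses (hO : smooth_bounded_domain Omega) (hs : is_surface_measure Omega sigma).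

Let oOmega : open Omega. Proof. by case: hO. Qed.
Let bOmega : bounded_set Omega. Proof. by case: hO. Qed.
Let mbd : measurable (bdry Omega).
Proof. by apply: closed_measurable_row; exact: closed_bdry. Qed.

(** A closed [K] inside [W] allows functions supported in [K] to be extended by zero, and the box
    gives compactness. The bumps of a cover are not normalised to sum to 1; the gluing of the layers
    takes care of that. *)
Definition bdry_patch (K : set V) (r : V -> R) := exists W O gam rho,
  [/\ C2_chart Omega W O gam, closed K, K `<=` W & K `<=` row_box m.+1 rho] /\
  [/\ C1 r, forall x, 0 <= r x <= 1 & forall x, ~ K x -> r x = 0].

Lemma patch_at x : bdry Omega x -> exists K r, bdry_patch K r /\ \forall y \near x, K y /\ r y = 1.
Proof.
move=> bx; have [_ _ _ _ /(_ x bx)[W [ O [gam [hc Wx]]]]] := hO.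
have oW : open W by case: hc.
have /nbhs_ballP[d /= d0 hd] : nbhs x W by exact: open_nbhs_nbhs.
(* Half the radius: the closed ball [K] then still lies in [W]. *)
pose e := d / 2; have e0 : 0 < e by rewrite divr_gt0.
pose K := [set y | `|x - y| <= e].
have cK : closed K.
  by have := @closed_ball_closed _ _ x e; rewrite closed_ballE.
exists K, (bump x (e ^+ 2 / 2)); split; last first.
  apply: filterI; last by apply: bump_near; rewrite divr_gt0// exprn_gt0.
  have /nbhs_ballP := nbhsx_ballx x (e : R) e0.
  move=> [e' e'0 he']; apply/nbhs_ballP; exists e' => // y /he'.
  by rewrite -ball_normE /ball_ /= => /ltW.
exists W, O, gam, (`|x| + e); split; split => //.
- move=> y; rewrite /K /= => hy; apply: hd; rewrite -ball_normE /ball_ /=.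
  by rewrite (le_lt_trans hy)// /e ltr_pdivrMr// ltr_pMr// ltr1n.
- move=> y hy i; rewrite (le_trans (coord_norm y i))//.
  have -> : y = x - (x - y) by rewrite opprB addrC subrK.
  by rewrite (le_trans (ler_normB _ _))// lerD2l.
- exact: C1_bump.
- by move=> y; rewrite /bump step_ge0 step_le1.
- move=> y nK; apply/eqP; apply: contrapT => /negP h; apply: nK.
  by have := bump_ball e0 h; rewrite -ball_normE /ball_ /= => /ltW.
Qed.

(** Compactness of the boundary, applied to the open sets on which a bump is identically 1. This is
    more than a cover by supports, and it is what makes the glued function equal to 1 near the
    boundary. *)
Lemma patch_cover : exists (s : seq V) (K : V -> set V) (r : V -> V -> R),
  (forall c, c \in s -> bdry_patch (K c) (r c)) /\
  forall x, bdry Omega x -> exists2 c, c \in s & \forall y \near x, K c y /\ r c y = 1.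
Proof.
have /choice[Kr hKr] : forall x, exists Kr : set V * (V -> R), bdry Omega x ->
    bdry_patch Kr.1 Kr.2 /\ \forall y \near x, Kr.1 y /\ Kr.2 y = 1.
  (* A dummy value off the boundary: only boundary centres enter the cover. *)
  move=> x; have [bx|nbx] := pselect (bdry Omega x); last by exists (set0, cst 0).
  by have [K [r h]] := patch_at bx; exists (K, r).
pose f x := [set y | (Kr x).1 y /\ (Kr x).2 y = 1]^°.
have cb := compact_bdry oOmega bOmega; rewrite compact_cover in cb.
have [|x bx|D' D'D hcov] := cb _ (bdry Omega) f.
- by move=> x _; exact: open_interior.
- by exists x => //; have [_] := hKr x bx.
exists (finmap.enum_fset D'), (fun c => (Kr c).1), (fun c => (Kr c).2); split.
  by move=> c cD; have /set_mem bc := D'D c cD; have [] := hKr c bc.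
by move=> x /hcov[c cD hx]; exists c.
Qed.

(** In one chart the measure is the integral of the continuous function [jacobian] over a bounded
    set of feet. *)
Lemma patch_finite K r : bdry_patch K r -> (sigma (bdry Omega `&` K) < +oo)%E.
Proof.
move=> [W [ O [gam [rho [[hc cK KW Kb] _]]]]].
have mA : measurable (bdry Omega `&` K) by apply: measurableI => //; exact: closed_measurable_row.
have OO : O *m O^T = 1%:M by case: hc.
have hg : C1 gam by case: hc => _ _ /C2_closureT_C1.
rewrite (hs hc mA); last by move=> x [bx Kx]; split => //; exact: KW.
have [r1 r10 hr1] : exists2 r1, 0 < r1 & forall x, K x -> row_box m r1 (foot O x).
  have : compact (foot O @` row_box m.+1 rho).
    apply: continuous_compact; last exact: compact_row_box.
    by apply: continuous_subspaceT; exact: foot_continuous.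
  move=> /compact_bounded/bounded_subset_box[r1 r10 h].
  by exists r1 => // x Kx; apply: h; exists x => //; exact: Kb.
have cJ := jacobian_continuous hg.
have [M M0 hM] := cont_on_bounded (@compact_row_box R m r1) (continuous_cont_onT cJ).
have mJ : measurable_fun setT (EFin \o jacobian gam).
  by apply/measurable_EFinP; exact: continuous_measurable_row.
apply: (@le_lt_trans _ _ (\int[lebesgue_row R m]_(y in row_box m r1) (EFin \o jacobian gam) y)%E).
  apply: ge0_subset_integral => //.
  - rewrite -[X in measurable X]setTI.
    by apply: (continuous_measurable_row_map (f := graph_point O gam)) => //;
        exact: graph_point_continuous.
  - exact: measurable_row_box.
  - exact: measurable_funTS.
  - by move=> y [_ /hr1]; rewrite foot_graph_point.
apply: integrable_lty; first exact: measurable_row_box.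
apply: (bounded_integrable (measurable_row_box _) (row_box_finite _ _) (M := M)) => //.
by apply: measurable_funTS; exact: continuous_measurable_row.
Qed.

Lemma bdry_finite : (sigma (bdry Omega) < +oo)%E.
Proof.
have [s [K [r [hp hcov]]]] := patch_cover.
have mK c : c \in s -> measurable (bdry Omega `&` K c).
  by move=> /hp[W [ O [gam [rho [[_ cK _ _] _]]]]]; apply: measurableI => //;
      exact: closed_measurable_row.
pose U (s : seq V) := \big[setU/set0]_(c <- s) (bdry Omega `&` K c).
have H s' : {subset s' <= s} -> measurable (U s') /\ (sigma (U s') < +oo)%E.
  elim: s' => [|c s' IH] sub; first by rewrite /U big_nil measure0.
  have cs : c \in s by apply: sub; rewrite mem_head.
  have [mU fU] := IH (fun z zs => sub z (mem_behead (s := c :: s') zs)).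
  rewrite /U big_cons; split; first by apply: measurableU => //; exact: mK.
  apply: (@le_lt_trans _ _ (sigma (bdry Omega `&` K c) + sigma (U s'))%E).
    by apply: measureU2 => //; exact: mK.
  by rewrite lte_add_pinfty//; apply: patch_finite (hp _ cs).
have [mU fU] := H s (fun z zs => zs).
apply: le_lt_trans fU; apply: le_measure; rewrite ?inE// => x bx.
have [c cs hx] := hcov x bx; rewrite /U -bigcup_seq; exists c => //.
by split => //; have [] := nbhs_singleton hx.
Qed.

(** Continuity is local, and in a chart the normal is the explicit continuous function
    [chart_normal]. *)
Lemma outer_normal_cont i : cont_on (bdry Omega) (fun x => outer_normal Omega x 0 i).
Proof.
apply/cont_onE => x bx B; have [_ _ _ _ /(_ x bx)[W [ O [gam [hc Wx]]]]] := hO.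
have nW : nbhs x W by apply: open_nbhs_nbhs; split => //; case: hc.
rewrite (outer_normalE oOmega hc Wx bx) => /(@chart_normal_continuous _ _ _ _ _ _ hc i x) hB.
have nB : \forall y \near x, W y /\ B (chart_normal O gam y 0 i) by apply: filterI;
    [exact: nW|exact: hB].
apply: filterS nB => y -[Wy By] yb.
by rewrite (outer_normalE oOmega hc Wy yb).
Qed.

Lemma outer_normal_unit x : bdry Omega x -> dotp (outer_normal Omega x) (outer_normal Omega x) = 1.
Proof.
move=> bx; have [_ _ _ _ /(_ x bx)[W [ O [gam [hc Wx]]]]] := hO.
rewrite (outer_normalE oOmega hc Wx bx) /chart_normal dotpZl dotpZr dotp_conormal; last by case: hc.
have J0 := jacobian_gt0 gam (foot O x).
by rewrite expr2 mulKf ?gt_eqF// mulVf// gt_eqF.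
Qed.

Lemma cont_measurable_bdry (f : V -> R) : cont_on (bdry Omega) f -> measurable_fun (bdry Omega) f.
Proof. by move=> /within_continuousP; exact: within_continuous_measurable_row. Qed.

Lemma cont_integrable_bdry (f : V -> R) : cont_on (bdry Omega) f ->
  sigma.-integrable (bdry Omega) (EFin \o f).
Proof.
move=> cf; have [M M0 hM] := cont_on_bounded (compact_bdry oOmega bOmega) cf.
apply: (bounded_integrable mbd bdry_finite (M := M)) => //.
exact: cont_measurable_bdry.
Qed.

(** The density [jacobian] of the surface measure cancels the normalisation in [chart_normal], which
    leaves the conormal and matches the limit in [chart_layer_cvg]. *)
Lemma patch_bdry_integral K W O gam (f : V -> R) i :
  C2_chart Omega W O gam -> closed K -> K `<=` W -> cont_on (bdry Omega) f ->
  (forall x, bdry Omega x -> ~ K x -> f x = 0) ->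
  \int[sigma]_(x in bdry Omega) (f x * outer_normal Omega x 0 i) =
  \int[lebesgue_row R m]_(y in graph_point O gam @^-1` W)
    (f (graph_point O gam y) * conormal O gam y 0 i).
Proof.
move=> hc cK KW cf f0.
have OO : O *m O^T = 1%:M by case: hc.
have hg : C1 gam by case: hc => _ _ /C2_closureT_C1.
have oW : open W by case: hc.
pose B := W `&` bdry Omega.
have mB : measurable B by apply: measurableI => //; exact: open_measurable_row.
pose F := (fun x => f x * outer_normal Omega x 0 i) \_ (bdry Omega).
have mF : measurable_fun setT F.
  apply/(measurable_restrict _ _ _).1 => //; rewrite setTI.
  apply: cont_measurable_bdry; apply: cont_on_mul => //; exact: outer_normal_cont.
have mG : measurable_fun setT (graph_point O gam).
  by apply: continuous_measurable_row_map; exact: graph_point_continuous.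
have mJ : measurable_fun setT (jacobian gam).
  by apply: continuous_measurable_row; exact: jacobian_continuous.
transitivity (\int[sigma]_(x in B) F x).
  rewrite [LHS]Rintegral_mkcond [RHS]Rintegral_mkcond; apply: eq_Rintegral => x _.
  rewrite /F /B /patch; case: ifPn => [/set_mem bx|/negP nb]; case: ifPn => //.
  move=> /negP nB; rewrite f0 ?mul0r// => /KW Wx.
  by apply: nB; rewrite inE.
have hsB A : measurable A -> A `<=` B ->
    sigma A = (\int[lebesgue_row R m]_(y in graph_point O gam @^-1` A) (jacobian gam y)%:E)%E.
  by move=> mA AB; rewrite (hs hc mA).
have J0 y : 0 <= jacobian gam y by rewrite ltW// jacobian_gt0.
rewrite (integral_transfer mG mJ J0 mB hsB)//.
rewrite [LHS]Rintegral_mkcond [RHS]Rintegral_mkcond; apply: eq_Rintegral => y _.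
have E : (y \in graph_point O gam @^-1` B) = (y \in graph_point O gam @^-1` W).
  apply/idP/idP; rewrite !inE /B /preimage /=; first by case.
  by move=> Wy; split => //; exact: graph_point_bdry Wy.
rewrite /patch E; case: ifPn => // /set_mem /= Wy.
have by_ := graph_point_bdry oOmega hc Wy.
rewrite /F /patch mem_set// (outer_normalE oOmega hc Wy by_) /chart_normal mxE foot_graph_point//.
by rewrite -mulrA mulrAC mulVf ?mul1r// gt_eqF// jacobian_gt0.
Qed.

End patches.

(** * Boundary layers and cutoffs *)

Lemma integrable_addR {d} {T : measurableType d} {R : realType} (mu : {measure set T -> \bar R})
    (D : set T) (f g : T -> R) : measurable D -> mu.-integrable D (EFin \o f) ->
  mu.-integrable D (EFin \o g) -> mu.-integrable D (EFin \o (fun x => f x + g x)).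
Proof.
move=> mD fi gi.
rewrite (_ : EFin \o _ = (EFin \o f) \+ (EFin \o g))%E; last by apply/funext => x; rewrite /= EFinD.
exact: integrableD.
Qed.

Lemma C1_local {R : realType} {V : normedModType R} (f : V -> R) :
  (forall x : V, exists g : V -> R, C1 g /\ \forall y \near x, f y = g y) -> C1 f.
Proof.
move=> h; split=> [x|v].
  have [g [[cg _] fg]] := h x; rewrite /continuous_at (nbhs_singleton fg).
  by apply: cvg_trans (cg x); apply: near_eq_cvg; apply: filterS fg => y ->.
split=> x; have [g [[_ /(_ v)[dg cdg]] fg]] := h x.
  by apply: near_eq_derivable (dg x); apply: filterS fg => y ->.
have dE : \forall y \near x, 'D_v g y = 'D_v f y.
  have := nbhs_interior fg; apply: filterS => y hy.
  by rewrite (near_eq_derive v hy).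
rewrite /continuous_at -(nbhs_singleton dE).
by apply: cvg_trans (cdg x); exact: near_eq_cvg.
Qed.

Section layers.
Context {R : realType} {m : nat}.
Local Notation V := ('rV[R]_m.+1).
Variables (Omega : set V) (sigma : {measure set V -> \bar R}).
Hypotheses (hO : smooth_bounded_domain Omega) (hs : is_surface_measure Omega sigma).
Local Notation leb := (lebesgue_row R m.+1).
Local Notation nu i := (fun x => outer_normal Omega x 0 i).

Let oOmega : open Omega. Proof. by case: hO. Qed.
Let bOmega : bounded_set Omega. Proof. by case: hO. Qed.
Let mO : measurable Omega. Proof. exact: open_measurable_row. Qed.
Let mbd : measurable (bdry Omega).
Proof. by apply: closed_measurable_row; exact: closed_bdry. Qed.

Let intO f : cont_on (closure Omega) f -> leb.-integrable Omega (EFin \o f) :=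
  @cont_integrable_domain _ _ _ oOmega bOmega f.
Let intB f : cont_on (bdry Omega) f -> sigma.-integrable (bdry Omega) (EFin \o f) :=
  @cont_integrable_bdry _ _ _ _ hO hs f.

(* E_k concentrates near the boundary, where it equals the partial partition of unity S, and
   grad (E_k) dx converges weakly to S nu dS. Starting from 0, one chart is added at a time:
   r (1 - chi_k) + (1 - r) E_k, with chi_k a step function of k times the height above the graph. *)
Definition bdry_layer (E : nat -> V -> R) (S : V -> R) :=
  [/\ C1 S /\ forall k, C1 (E k),
      forall k x, 0 <= E k x <= 1,
      forall x, Omega x -> E k x @[k --> \oo] --> 0,
      forall k x, bdry Omega x -> \forall y \near x, E k y = S y
    & forall i : 'I_m.+1, let D k := 'D_(delta_mx 0 i) (E k) in
      (exists M, forall k, \int[leb]_(x in Omega) `|D k x| <= M) /\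
      forall g, cont_on (closure Omega) g ->
        \int[leb]_(x in Omega) (D k x * g x) @[k --> \oo] -->
        \int[sigma]_(x in bdry Omega) (S x * g x * nu i x)].

Lemma bdry_layer0 : bdry_layer (fun _ => cst 0) (cst 0).
Proof.
split => [|k x|x Ox|k x bx|i D].
- by split => [|k]; exact: C1_cst.
- by rewrite lexx ler01.
- exact: cvg_cst.
- have : \forall y \near x, True by exact: filterT.
  by apply: filterS.
have D0 k x : D k x = 0 by rewrite /D derive_cst.
have z0 (f : V -> R) : (forall x, f x = 0) -> \int[leb]_(x in Omega) f x = 0.
  by move=> h; rewrite (@eq_Rintegral _ _ _ _ _ (cst 0)) ?Rintegral_cst ?mul0r.
split=> [|g cg].
  by exists 0 => k; rewrite z0// => x; rewrite D0 normr0.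
have -> : (fun k : nat => \int[leb]_(x in Omega) (D k x * g x)) = cst 0.
  by apply/funext => k; rewrite z0// => x; rewrite D0 mul0r.
have -> : \int[sigma]_(x in bdry Omega) (cst 0 x * g x * nu i x) = 0; last exact: cvg_cst.
rewrite (@eq_Rintegral _ _ _ _ _ (cst 0)) ?Rintegral_cst ?mul0r// => x _.
by rewrite !mul0r.
Qed.

Section step.
Variables (W K : set V) (O : 'M[R]_m.+1) (gam : 'rV[R]_m -> R) (rho : R) (r : V -> R).
Hypotheses (hc : C2_chart Omega W O gam) (cK : closed K) (KW : K `<=` W) (Kb : K `<=` row_box
    m.+1 rho).
Hypotheses (C1r : C1 r) (r01 : forall x, 0 <= r x <= 1) (rK : forall x, ~ K x -> r x = 0).

Let OO : O *m O^T = 1%:M. Proof. by case: hc. Qed.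
Let hg : C1 gam. Proof. by case: hc => _ _ /C2_closureT_C1. Qed.
Let oW : open W. Proof. by case: hc. Qed.
Let rN x : ~ K x -> \forall y \near x, r y = 0.
Proof.
move=> nK; have : nbhs x (~` K) by apply: open_nbhs_nbhs; split => //; exact: closed_openC.
by apply: filterS => y /rK.
Qed.

Let chi (k : nat) (x : V) := step (k.+1%:R * height O gam x - 1).
Let N i (x : V) := conormal O gam (foot O x) 0 i.
Let ker (k : nat) (x : V) := layer_kernel k.+1%:R (height O gam x).

Let chi_derive k i x : is_derive x (delta_mx 0 i) (chi k) (- (N i x * ker k x)).
Proof.
have h1 := @is_derive_height _ _ O gam x (delta_mx 0 i) hg.
have h2 := is_deriveB (is_deriveM (is_derive_cst (k.+1%:R : R) x (delta_mx 0 i)) h1)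
    (is_derive_cst (1 : R) x (delta_mx 0 i)).
have := is_derive_comp h2 (is_derive_step _).
rewrite /chi.
move/is_derive_eq; apply; rewrite /N /ker /layer_kernel /= scaler0 addr0 subr0.
have -> : dotp (delta_mx 0 i) (conormal O gam (foot O x)) = conormal O gam (foot O x) 0 i.
  rewrite /dotp (bigD1 i)//= mxE !eqxx mul1r big1 ?addr0// => j ji.
  by rewrite mxE eqxx (negPf ji) mul0r.
set d := dstep _; set c := conormal _ _ _ _ _; set q := k.+1%:R.
rewrite -[q *: _]/(q * - c); ring.
Qed.

Let C1_chi k : C1 (chi k).
Proof.
have -> : chi k = step \o (cst k.+1%:R * height O gam - cst 1) by [].
apply: C1_comp is_derive_step dstep_continuous.
by apply: C1B; [apply: C1M; [exact: C1_cst|exact: C1_height]|exact: C1_cst].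
Qed.

Let chi_cvg x : Omega x -> K x -> chi k x @[k --> \oo] --> (1 : R).
Proof.
move=> Ox /KW Wx; have h0 : 0 < height O gam x by apply/(chart_inside hc Wx).
apply: cvg_near_cst; near=> k; apply: step_ge1.
(* From this index on, [(k + 1) * height - 1] is at least 1, where [step] equals 1. *)
have : 2 / height O gam x <= k%:R.
  by near: k; exact: nbhs_infty_ger.
rewrite ler_pdivrMr// => h2.
rewrite lerBrDr; apply: le_trans (_ : k%:R * height O gam x <= _).
  by apply: le_trans h2.
by apply: ler_wpM2r; [exact: ltW|rewrite ler_nat].
Unshelve. all: by end_near. Qed.

Let chi_bdry k x : bdry Omega x -> K x -> \forall y \near x, chi k y = 0.
Proof.
move=> bx /KW Wx; have h0 : height O gam x = 0 by apply/(chart_bdry oOmega hc Wx).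
have hn : \forall y \near x, height O gam y < k.+1%:R^-1.
  apply: (cvgr_lt _ ((C1_height O hg).1 x)).
  by rewrite h0 invr_gt0.
apply: filterS hn => y hy; apply: step_le0.
by rewrite subr_le0 mulrC -ler_pdivlMr// div1r ltW.
Qed.

Variables (E : nat -> V -> R) (S : V -> R).
Hypothesis hE : bdry_layer E S.

Let E' k x := r x * (1 - chi k x) + (1 - r x) * E k x.
Let S' x := r x + (1 - r x) * S x.

Let C1S : C1 S. Proof. by case: hE => -[]. Qed.
Let C1E k : C1 (E k). Proof. by case: hE => -[]. Qed.

Let derE k i x : 'D_(delta_mx 0 i) (E' k) x =
  'D_(delta_mx 0 i) r x * (1 - chi k x - E k x) + r x * N i x * ker k x
  + (1 - r x) * 'D_(delta_mx 0 i) (E k) x.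
Proof.
have -> : E' k = r * (cst 1 - chi k) + (cst 1 - r) * E k by [].
have hr := C1_is_derive x (delta_mx 0 i) C1r.
have hEk := C1_is_derive x (delta_mx 0 i) (C1E k).
have hchi := chi_derive k i x.
have := is_deriveD (is_deriveM hr (is_deriveB (is_derive_cst (1 : R) x (delta_mx 0 i)) hchi))
  (is_deriveM (is_deriveB (is_derive_cst (1 : R) x (delta_mx 0 i)) hr) hEk).
move/@derive_val => ->.
rewrite -[(cst 1 - chi k) x]/(1 - chi k x) -[(cst 1 - r) x]/(1 - r x).
rewrite /= sub0r opprK /GRing.scale /=.
move: ('D_ _ r x) ('D_ _ (E k) x) (chi k x) (E k x) (r x) (N i x) (ker k x) => a b c d e f g.
by ring.
Qed.

Let H_cont i : continuous (N i).
Proof.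
move=> x; apply: (@cont_comp _ _ _ (foot O) (fun y => conormal O gam y 0 i));
    first exact: foot_continuous.
exact: conormal_continuous.
Qed.

Let ker_cont k : continuous (ker k).
Proof.
move=> x; apply: (@cont_comp _ _ _ (height O gam) (layer_kernel k.+1%:R));
    last exact: layer_kernel_continuous.
exact: (C1_height O hg).1.
Qed.

Let layer_integral g n (k : nat) : cont_on (closure Omega) g -> continuous n ->
  leb.-integrable Omega (EFin \o (fun x => r x * g x * n (foot O x) * ker k x)).
Proof.
move=> cg cn; apply: intO; apply: cont_on_mul; last by apply: continuous_cont_onT; exact: ker_cont.
apply: cont_on_mul; first by apply: cont_on_mul => //; apply: continuous_cont_onT; exact: C1r.1.
apply: continuous_cont_onT => x; apply: (@cont_comp _ _ _ (foot O) n); last exact: cn.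
exact: foot_continuous.
Qed.

Let layer_cvg g n : cont_on (closure Omega) g -> continuous n ->
  \int[leb]_(x in Omega) (r x * g x * n (foot O x) * ker k x) @[k --> \oo]
  --> \int[lebesgue_row R m]_(y in graph_point O gam @^-1` W) (r (graph_point O gam y) * g
      (graph_point O gam y) * n y).
Proof.
move=> cg cn.
have crg : cont_on (closure Omega) (fun x => r x * g x).
  by apply: cont_on_mul => //; apply: continuous_cont_onT; exact: C1r.1.
have [C C0 hC] := cont_on_bounded (compact_closure_domain bOmega) crg.
apply: (chart_layer_cvg oOmega hc cK KW Kb crg hC) => // x _ nK.
by rewrite rK// mul0r.
Qed.

(** The gradient of the new layer has three parts, see [derE]. The one with the gradient of [r]
    tends to 0, the one with the kernel tends to the boundary integral of the new chart, and the old
    gradient times [1 - r] is the induction hypothesis tested with [(1 - r) * g]. *)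
Lemma bdry_layer_step : bdry_layer E' S'.
Proof.
have hE01 : forall k x, 0 <= E k x <= 1 by case: hE.
have hchi01 k x : 0 <= chi k x <= 1 by rewrite step_ge0 step_le1.
have cO := compact_closure_domain bOmega.
have fO := domain_finite oOmega bOmega.
split => [|k x|x Ox|k x bx|i D].
- split; first by apply: (C1D C1r); apply: (C1M (C1B (C1_cst 1) C1r) C1S).
  move=> k; apply: (C1D (C1M C1r (C1B (C1_cst 1) (C1_chi k)))).
  exact: (C1M (C1B (C1_cst 1) C1r) (C1E k)).
- rewrite /E'; move: (r01 x) (hchi01 k x) (hE01 k x).
  move: (r x) (chi k x) (E k x) => a b c /andP[a0 a1] /andP[b0 b1] /andP[c0 c1].
  by apply/andP; split; nra.
- have hEx : E k x @[k --> \oo] --> 0 by case: hE => _ _ /(_ x Ox).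
  have h2 : (1 - r x) * E k x @[k --> \oo] --> (1 - r x) * 0 by apply: cvgMr.
  have h1 : r x * (1 - chi k x) @[k --> \oo] --> (0 : R).
    have [Kx|nK] := pselect (K x); last first.
      by rewrite rK//; under eq_fun do rewrite mul0r; exact: cvg_cst.
    have -> : (0 : R) = r x * (1 - 1) by rewrite subrr mulr0.
    by apply: cvgMr; apply: cvgB; [exact: cvg_cst|exact: chi_cvg].
  have -> : (0 : R) = 0 + (1 - r x) * 0 by rewrite mulr0 addr0.
  exact: cvgD h1 h2.
- have hEb : \forall y \near x, E k y = S y by case: hE => _ _ _ /(_ k x bx).
  have hrb : \forall y \near x, r y * (1 - chi k y) = r y.
    have [Kx|nK] := pselect (K x).
      by apply: filterS (chi_bdry k bx Kx) => y ->; rewrite subr0 mulr1.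
    by apply: filterS (rN nK) => y ->; rewrite mul0r.
  have hh : \forall y \near x, E k y = S y /\ r y * (1 - chi k y) = r y by apply: filterI.
  by apply: filterS hh => y [e1 e2]; rewrite /E' /S' e1 e2.
have [[M hM] hcv] : (exists M, forall k, \int[leb]_(x in Omega) `|'D_(delta_mx 0 i) (E k) x| <=
    M) /\
      forall g, cont_on (closure Omega) g ->
        \int[leb]_(x in Omega) ('D_(delta_mx 0 i) (E k) x * g x) @[k --> \oo] -->
        \int[sigma]_(x in bdry Omega) (S x * g x * nu i x) by case: hE => _ _ _ _ /(_ i).
have cdr : continuous ('D_(delta_mx 0 i) r) by case: C1r => _ /(_ (delta_mx 0 i))[].
have cdE k : continuous ('D_(delta_mx 0 i) (E k)) by case: (C1E k) => _ /(_ (delta_mx 0 i))[].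
have cr : continuous r by exact: C1r.1.
have cE k : continuous (E k) by exact: (C1E k).1.
have cchi k : continuous (chi k) by exact: (C1_chi k).1.
have [Mr Mr0 hMr] := cont_on_bounded cO (continuous_cont_onT cdr).
pose bulk k x := 1 - chi k x - E k x.
have cbulk k : cont_on (closure Omega) (bulk k).
  by apply: cont_on_sub; [apply: cont_on_sub; [exact: cont_on_cst|]|]; exact: continuous_cont_onT.
have bulk2 k x : `|bulk k x| <= 1.
  rewrite /bulk; move: (hchi01 k x) (hE01 k x); move: (chi k x) (E k x) =>
      a b /andP[? ?] /andP[? ?].
  by rewrite ler_norml; apply/andP; split; lra.
have cabs : cont_on (closure Omega) (cst 1 : V -> R) by exact: cont_on_cst.
have cNa : continuous (fun y => `|conormal O gam y 0 i|).
  move=> y; apply: (@cont_comp _ _ _ (fun y => conormal O gam y 0 i) (fun t : R => `|t|));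
      last exact: norm_continuous.
  exact: conormal_continuous.
have Dk k x : D k x = 'D_(delta_mx 0 i) r x * bulk k x + r x * N i x * ker k x
  + (1 - r x) * 'D_(delta_mx 0 i) (E k) x by rewrite /D derE.
have cD k : continuous (D k).
  have /(_ k)[_ /(_ (delta_mx 0 i))[_ //]] : forall k, C1 (E' k).
  move=> {}k; apply: (C1D (C1M C1r (C1B (C1_cst 1) (C1_chi k)))).
  exact: (C1M (C1B (C1_cst 1) C1r) (C1E k)).
split=> [|g cg].
  (* The uniform bound on the kernel part comes from its own limit: tested with the absolute value
     of the conormal component, the sequence converges, hence is bounded. *)
  have [Ml hMl] : exists Ml, forall k, `|\int[leb]_(x in Omega) (r x * 1 * `|conormal O gam (foot
      O x) 0 i| * ker k x)| <= Ml.
    have := @layer_cvg (cst 1) _ cabs cNa; move/cvgP/cvg_seq_bounded => [Q [Qr hQ]].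
    by exists (Q + 1) => k; apply: hQ => //; rewrite ltrDl.
  have i2 k := @layer_integral (cst 1) _ k cabs cNa.
  have i1 : leb.-integrable Omega (EFin \o (cst Mr : V -> R)) by apply: intO; exact: cont_on_cst.
  have i3 k : leb.-integrable Omega (EFin \o (fun x => `|'D_(delta_mx 0 i) (E k) x|)).
    by apply: intO; apply: cont_on_norm; exact: continuous_cont_onT.
  have i12 k : leb.-integrable Omega (EFin \o (fun x =>
      Mr + r x * 1 * `|conormal O gam (foot O x) 0 i| * ker k x)).
    by apply: integrable_addR => //; exact: i2.
  exists (Mr * fine (leb Omega) + Ml + M) => k.
  apply: (@le_trans _ _ (\int[leb]_(x in Omega) ((Mr + r x * 1 * `|conormal O gam (foot O x) 0 i|
      * ker k x) + `|'D_(delta_mx 0 i) (E k) x|))).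
    apply: le_Rintegral => //.
    - by apply: intO; apply: cont_on_norm; exact: continuous_cont_onT.
    - by apply: integrable_addR => //; exact: i12.
    - move=> x Ox; rewrite Dk.
      have /andP[r0 r1] := r01 x.
      have k0 : 0 <= ker k x by apply: layer_kernel_ge0.
      apply: (le_trans (ler_normD _ _)); apply: lerD; last first.
        by rewrite normrM ler_piMl// ger0_norm ?subr_ge0// lerBlDr lerDl.
      apply: (le_trans (ler_normD _ _)); apply: lerD.
        by rewrite normrM -[Mr]mulr1; apply: ler_pM => //; apply: hMr; exact: subset_closure.
      by rewrite normrM (normrM (r x)) mulr1 (ger0_norm r0) (ger0_norm k0).
  rewrite RintegralD//.
  rewrite RintegralD//.
  apply: lerD; last exact: hM.
  apply: lerD; first by rewrite Rintegral_cst.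
  exact: le_trans (ler_norm _) (hMl k).
have [Cg Cg0 hCg] := cont_on_bounded cO cg.
have c1r : cont_on (closure Omega) (fun x => 1 - r x).
  by apply: cont_on_sub; [exact: cont_on_cst|exact: continuous_cont_onT].
have c1rg : cont_on (closure Omega) (fun x => (1 - r x) * g x) by exact: cont_on_mul.
have j1 k : leb.-integrable Omega (EFin \o (fun x => 'D_(delta_mx 0 i) r x * bulk k x * g x)).
  apply: intO; apply: cont_on_mul => //; apply: cont_on_mul; last exact: cbulk.
  exact: continuous_cont_onT.
have j2 k := layer_integral k cg (@conormal_continuous _ _ O gam i hg).
have j3 k : leb.-integrable Omega (EFin \o (fun x => 'D_(delta_mx 0 i) (E k) x * ((1 - r x) * g
    x))).
  by apply: intO; apply: cont_on_mul => //; exact: continuous_cont_onT.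
have j12 k : leb.-integrable Omega (EFin \o (fun x => 'D_(delta_mx 0 i) r x * bulk k x * g x + r
    x * g x * N i x * ker k x)).
  exact: integrable_addR.
have -> : (fun k => \int[leb]_(x in Omega) (D k x * g x)) =
  (fun k => \int[leb]_(x in Omega) ('D_(delta_mx 0 i) r x * bulk k x * g x)
    + \int[leb]_(x in Omega) (r x * g x * N i x * ker k x)
    + \int[leb]_(x in Omega) ('D_(delta_mx 0 i) (E k) x * ((1 - r x) * g x))).
  apply/funext => k.
  rewrite -(RintegralD mO (j1 k) (j2 k)) -(RintegralD mO (j12 k) (j3 k)).
  apply: eq_Rintegral => x _; rewrite Dk.
  move: ('D_ _ r x) (bulk k x) (N i x) (r x) (ker k x) (g x) ('D_ _ (E k) x) =>
      a1 a2 a3 a4 a5 a6 a7.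
  by ring.
have b1 : \int[leb]_(x in Omega) ('D_(delta_mx 0 i) r x * bulk k x * g x) @[k --> \oo] --> (0 : R).
  have -> : (0 : R) = \int[leb]_(x in Omega) 0 by rewrite Rintegral_cst// mul0r.
  apply: (bounded_cvg_Rintegral mO fO (M := Mr * 1 * Cg)) => [k|k x Ox|x Ox].
  - apply: cont_measurable_domain => //; apply: cont_on_mul; last by apply: cont_onW cg;
      exact: subset_closure.
    apply: cont_on_mul; first exact: continuous_cont_onT.
    by apply: cont_onW (cbulk k); exact: subset_closure.
  - have cx := subset_closure Ox.
    rewrite !normrM; apply: ler_pM; [exact: mulr_ge0|exact: normr_ge0| |exact: hCg].
    by apply: ler_pM; [exact: normr_ge0|exact: normr_ge0|exact: hMr|exact: bulk2].
  - have hEx : E k x @[k --> \oo] --> 0 by case: hE => _ _ /(_ x Ox).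
    have -> : 0 = 'D_(delta_mx 0 i) r x * 0 * g x by rewrite mulr0 mul0r.
    (* The limit 1 of [chi] is available on [K] only; off [K] the derivative of [r] vanishes. *)
    have [Kx|nK] := pselect (K x); last first.
      have d0 : 'D_(delta_mx 0 i) r x = 0.
        exact: derive_zero_near (rN nK).
      by rewrite d0; under eq_fun do rewrite !mul0r; rewrite !mul0r; exact: cvg_cst.
    apply: cvgMl; apply: cvgMr.
    have -> : (0 : R) = 1 - 1 - 0 by rewrite subrr subr0.
    apply: cvgB => //; apply: cvgB; [exact: cvg_cst|exact: chi_cvg].
have b2 := layer_cvg cg (@conormal_continuous _ _ O gam i hg).
have b3 := hcv _ c1rg.
have crg : cont_on (bdry Omega) (fun x => r x * g x).
  apply: cont_on_mul; first exact: continuous_cont_onT.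
  by apply: cont_onW cg => x [].
have cSg : cont_on (bdry Omega) (fun x => S x * ((1 - r x) * g x)).
  apply: cont_on_mul; first by apply: continuous_cont_onT; exact: C1S.1.
  by apply: cont_onW c1rg => x [].
have i1 : sigma.-integrable (bdry Omega) (EFin \o (fun x => r x * g x * nu i x)).
  by apply: intB; apply: cont_on_mul => //; exact: outer_normal_cont.
have i2 : sigma.-integrable (bdry Omega) (EFin \o (fun x => S x * ((1 - r x) * g x) * nu i x)).
  by apply: intB; apply: cont_on_mul => //; exact: outer_normal_cont.
have rgK x : bdry Omega x -> ~ K x -> r x * g x = 0 by move=> _ nK; rewrite rK// mul0r.
have -> : \int[sigma]_(x in bdry Omega) (S' x * g x * nu i x) =
    0 + \int[lebesgue_row R m]_(y in graph_point O gam @^-1` W)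
      (r (graph_point O gam y) * g (graph_point O gam y) * conormal O gam y 0 i)
    + \int[sigma]_(x in bdry Omega) (S x * ((1 - r x) * g x) * nu i x).
  rewrite add0r -(patch_bdry_integral hO hs i hc cK KW crg rgK) -(RintegralD mbd i1 i2).
  apply: eq_Rintegral => x _; rewrite /S'.
  by move: (r x) (g x) (S x) (outer_normal Omega x 0 i) => a1 a2 a3 a4; ring.
exact: cvgD (cvgD b1 b2) b3.
Qed.

End step.

(** By induction over the finite cover. Adding a chart keeps [S = 1] where it held, as
    [r + (1 - r) * 1 = 1], and creates it where the new bump is 1. *)
Lemma bdry_layer_cover : exists (E : nat -> V -> R) (S : V -> R), bdry_layer E S /\ forall x,
    bdry Omega x -> \forall y \near x, S y = 1.
Proof.
have [s [K [r [hp hcov]]]] := patch_cover hO.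
suff [E [S [hE hS]]] : exists (E : nat -> V -> R) (S : V -> R), bdry_layer E S /\
    forall c, c \in s -> forall y, r c y = 1 -> S y = 1.
  exists E, S; split => // x /hcov[c cs]; apply: filterS => y [_ h]; exact: hS cs _ h.
elim: s hp {hcov} => [|c s IH] hp.
  by exists (fun _ => cst 0), (cst 0); split => //; exact: bdry_layer0.
have [|E [S [hE hS]]] := IH.
  by move=> z zs; apply: hp; rewrite inE zs orbT.
have [W [ O [gam [rho [[hc cK KW Kb] [C1r r01 rK]]]]]] := hp c (mem_head _ _).
have := bdry_layer_step hc cK KW Kb C1r r01 rK hE.
set E' := (X in bdry_layer X _); set S' := (X in bdry_layer _ X) => hE'.
exists E', S'; split => // z; rewrite inE => /orP[/eqP -> y|zs y hy]; rewrite /S'.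
  by move=> ->; rewrite subrr mul0r addr0.
by rewrite (hS z zs y hy) mulr1 addrC subrK.
Qed.

(** The cutoff is [1 - E k] inside and 0 outside. Near the boundary [E k = S = 1], so both formulas
    vanish there and the glued function is C^1. *)
Lemma domain_cutoffs : exists eta : nat -> V -> R,
  [/\ forall k, C1 (eta k), forall k x, 0 <= eta k x <= 1,
      forall k x, ~ Omega x -> \forall y \near x, eta k y = 0
    & forall x, Omega x -> eta k x @[k --> \oo] --> (1 : R)] /\
  forall i : 'I_m.+1, let D k := 'D_(delta_mx 0 i) (eta k) in
      (exists M, forall k, \int[leb]_(x in Omega) `|D k x| <= M) /\
      forall g : V -> R, cont_on (closure Omega) g ->
        (- (\int[leb]_(x in Omega) (D k x * g x))) @[k --> \oo] -->
        \int[sigma]_(x in bdry Omega) (g x * nu i x).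
Proof.
have [E [S [[[C1S C1E] E01 E0 Eb ED] S1]]] := bdry_layer_cover.
pose eta k := (fun x => 1 - E k x) \_ Omega.
have etaO k x : Omega x -> \forall y \near x, eta k y = (cst 1 - E k) y.
  move=> Ox; have : nbhs x Omega by exact: open_nbhs_nbhs.
  by apply: filterS => y Oy; rewrite /eta /patch mem_set.
have eta0 k x : ~ Omega x -> \forall y \near x, eta k y = cst 0 y.
  move=> nO; have [cx|ncx] := pselect (closure Omega x); last first.
    have : nbhs x (~` closure Omega) by apply: open_nbhs_nbhs; split => //; apply: closed_openC;
        exact: closed_closure.
    by apply: filterS => y ny; rewrite /eta /patch memNset// => /subset_closure.
  have bx : bdry Omega x by apply/(bdryE oOmega).
  have h : \forall y \near x, E k y = S y /\ S y = 1 by apply: filterI; [exact: Eb|exact: S1].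
  by apply: filterS h => y [e1 e2]; rewrite /eta /patch; case: ifP => // _; rewrite e1 e2 subrr.
have C1c k : C1 (cst 1 - E k) := C1B (C1_cst 1) (C1E k).
have De k i x : Omega x -> 'D_(delta_mx 0 i) (eta k) x = - 'D_(delta_mx 0 i) (E k) x.
  move=> Ox; rewrite (near_eq_derive _ (etaO k x Ox)).
  have := is_deriveB (is_derive_cst (1 : R) x (delta_mx 0 i)) (C1_is_derive x (delta_mx 0 i) (C1E
      k)).
  by move/@derive_val => ->; rewrite sub0r.
exists eta; split; [split|] => [k|k x|k x nO|x Ox|i D].
- apply: C1_local => x; have [Ox|nO] := pselect (Omega x).
    by exists (cst 1 - E k); split => //; exact: etaO.
  by exists (cst 0); split; [exact: C1_cst|exact: eta0].
- rewrite /eta /patch; case: ifP => _; last by rewrite lexx ler01.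
  by have /andP[? ?] := E01 k x; rewrite subr_ge0 lerBlDr lerDl; apply/andP.
- exact: eta0.
- rewrite /eta /patch mem_set//.
  by rewrite -[X in _ --> X](subr0 (1 : R)); apply: cvgB; [exact: cvg_cst|exact: E0].
have [[M hM] hcv] := ED i; split=> [|g cg].
  exists M => k; apply: le_trans (hM k); rewrite le_eqVlt; apply/orP; left; apply/eqP.
  by apply: eq_Rintegral => x /set_mem Ox; rewrite /D De// normrN.
have -> : (fun k => - \int[leb]_(x in Omega) (D k x * g x)) =
    (fun k => \int[leb]_(x in Omega) ('D_(delta_mx 0 i) (E k) x * g x)).
  apply/funext => k.
  have -> : \int[leb]_(x in Omega) (D k x * g x) = \int[leb]_(x in Omega) (-1 * ('D_(delta_mx 0
      i) (E k) x * g x)).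
    by apply: eq_Rintegral => x /set_mem Ox; rewrite /D De// mulN1r mulNr.
  rewrite RintegralZl//; first by rewrite mulN1r opprK.
  apply: intO; apply: cont_on_mul => //; apply: continuous_cont_onT.
  by case: (C1E k) => _ /(_ (delta_mx 0 i))[].
have -> : \int[sigma]_(x in bdry Omega) (g x * nu i x) = \int[sigma]_(x in bdry Omega) (S x * g x
    * nu i x).
  by apply: eq_Rintegral => x /set_mem bx; rewrite (nbhs_singleton (S1 x bx)) mul1r.
exact: hcv.
Qed.

End layers.

(** * Orlicz densities *)

Section monotonicity.
Context {R : realType}.
Implicit Types (f df : R -> R) (a b s t : R).

Lemma ge0_is_derive_homo f df a b : a <= b ->
  (forall s, a < s < b -> is_derive s 1 f (df s)) ->
  (forall s, a < s < b -> 0 <= df s) -> cont_on [set s | a <= s <= b] f -> f a <= f b.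
Proof.
move=> ab fd d0 cf; apply: (@ger0_derive1_le_cc _ f a b) => //.
- by move=> x; rewrite in_itv /= => /fd[].
- move=> x; rewrite in_itv /= => xab; rewrite derive1E.
  by have := fd _ xab => -[_ ->]; exact: d0.
- by apply/within_continuousP; move: cf; congr (cont_on _ _); apply/seteqP; split => x;
    rewrite /= in_itv.
- by rewrite in_itv /= lexx ab.
- by rewrite in_itv /= lexx ab.
Qed.

Lemma near_lt s b : s < b -> \forall t \near s, t < b.
Proof. by move=> sb; apply: (@open_nbhs_nbhs R s [set t | t < b]); split; [exact: open_lt|]. Qed.

Lemma is_derive_cont f (a s : R) : is_derive s 1 f a -> {for s, continuous f}.
Proof. by move=> [h _]; apply/differentiable_continuous/derivable1_diffP. Qed.

(** The index condition says that [u^(-a) f(u)] is nondecreasing. *)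
Lemma index_le f df a s t : (forall s, 0 < s -> is_derive s 1 f (df s)) ->
  (forall s, 0 < s -> a * f s <= s * df s) -> 0 < s -> s <= t ->
  (t / s) `^ a * f s <= f t.
Proof.
move=> fd fi s0 st; have t0 := lt_le_trans s0 st.
pose g := (fun u : R => u `^ (- a)) * f.
have gd (u : R) : 0 < u -> is_derive u 1 g (u `^ (- a) * df u + f u * (- a * u `^ (- a - 1))).
  by move=> u0; have := is_deriveM (is_derive1_powR (- a) u0) (fd u u0).
have gst : g s <= g t.
  apply: (@ge0_is_derive_homo _ (fun u => u `^ (- a) * df u + f u * (- a * u `^ (- a - 1)))) => //.
  - by move=> u /andP[su _]; apply: gd; exact: lt_trans su.
  - move=> u /andP[su _]; have u0 := lt_trans s0 su.
    have -> : u `^ (- a) = u * u `^ (- a - 1).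
      by rewrite powRB ?(gt_eqF u0) ?implybT// powRr1 ?(ltW u0)// mulrCA divff ?mulr1// gt_eqF.
    have -> : u * u `^ (- a - 1) * df u + f u * (- a * u `^ (- a - 1)) = u `^ (- a - 1) * (u * df
        u - a * f u).
      by move: (u `^ _) (df u) (f u) => A B C; ring.
    by rewrite mulr_ge0 ?powR_ge0// subr_ge0 fi.
  - apply: continuous_cont_on => u /andP[su _]; apply: is_derive_cont; apply: gd.
    exact: lt_le_trans su.
have E (u : R) : 0 < u -> f u = u `^ a * g u.
  by move=> u0; rewrite /g -[(_ * f) u]/(u `^ (- a) * f u) powRN mulVKf// gt_eqF// powR_gt0.
rewrite (E s s0) (E t t0) mulrA -powRM ?divr_ge0 ?(ltW s0) ?(ltW t0)// divfK ?gt_eqF//.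
by rewrite ler_wpM2l ?powR_ge0.
Qed.

Lemma index_ge f df a s t : (forall s, 0 < s -> is_derive s 1 f (df s)) ->
  (forall s, 0 < s -> s * df s <= a * f s) -> 0 < s -> s <= t ->
  f t <= (t / s) `^ a * f s.
Proof.
move=> fd fi s0 st; rewrite -lerN2 -mulrN.
apply: (@index_le (- f) (fun s => - df s)) => //.
  by move=> u u0; apply: is_deriveN; exact: fd.
by move=> u u0; rewrite -[(- f) u]/(- f u) !mulrN lerN2 fi.
Qed.

End monotonicity.

Section orlicz.
Context {R : realType}.
Implicit Types (s t u l kap r : R).
Variables (phi : R -> R) (d0 d1 : R).
Hypothesis hphi : orlicz_density phi d0 d1.
Local Notation Phi := (orlicz_primitive phi).

Lemma density_d0 : 0 < d0. Proof. by case: hphi => _ _ _ []. Qed.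
Lemma density_d1 : 0 < d1. Proof. by case: hphi => _ _ _ []. Qed.

Lemma density_cont : cont_on [set s : R | 0 <= s] phi.
Proof. by case: hphi => /within_continuousP. Qed.

Lemma density0 : phi 0 = 0. Proof. by case: hphi. Qed.

Lemma density_gt0 s : 0 < s -> 0 < phi s.
Proof. by case: hphi => _ _ h _ _ /h[]. Qed.

Lemma density_ge0 s : 0 <= s -> 0 <= phi s.
Proof. by rewrite le_eqVlt => /predU1P[<-|/density_gt0/ltW//]; rewrite density0. Qed.

Lemma density_derive s : 0 < s -> is_derive s 1 phi (derive1 phi s).
Proof. by case: hphi => _ _ h _ _ /h[_ hd _]; rewrite derive1E; exact: derivableP. Qed.

Lemma density_index s : 0 < s -> d0 * phi s <= s * derive1 phi s <= d1 * phi s.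
Proof.
move=> s0; case: hphi => _ _ _ _ /(_ s s0); have p0 := density_gt0 s0.
by rewrite ler_pdivlMr// ler_pdivrMr.
Qed.

Lemma density_derive_ge0 s : 0 < s -> 0 <= derive1 phi s.
Proof.
move=> s0; have /andP[h _] := density_index s0.
rewrite -(pmulr_rge0 _ s0); apply: le_trans h.
by rewrite mulr_ge0 ?ltW// ?density_d0 ?density_gt0.
Qed.

Lemma density_derive_cont s : 0 < s -> {for s, continuous (derive1 phi)}.
Proof. by case: hphi => _ _ h _ _ /h[]. Qed.

Lemma density_continuous s : 0 < s -> {for s, continuous phi}.
Proof. by move=> /density_derive/is_derive_cont. Qed.

Lemma density_homo s t : 0 <= s -> s <= t -> phi s <= phi t.
Proof.
move=> s0 st; apply: (@ge0_is_derive_homo _ _ (derive1 phi)) => //.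
- by move=> u /andP[su _]; apply: density_derive; exact: le_lt_trans su.
- by move=> u /andP[su _]; apply: density_derive_ge0; exact: le_lt_trans su.
- by apply: cont_onW density_cont => u /= /andP[su _]; exact: le_trans su.
Qed.

Lemma density_scale l s : 1 <= l -> 0 <= s -> phi (l * s) <= l `^ d1 * phi s.
Proof.
move=> l1; rewrite le_eqVlt => /predU1P[<-|s0]; first by rewrite mulr0 density0 mulr0.
have -> : l `^ d1 = (l * s / s) `^ d1 by rewrite mulfK// gt_eqF.
apply: (@index_ge _ _ (derive1 phi)) => //; first exact: density_derive.
- by move=> u /density_index/andP[].
- by rewrite ler_peMl// ltW.
Qed.

Lemma density_integrable s : lebesgue_measure.-integrable `[0, s] (EFin \o phi).
Proof.
apply: continuous_compact_integrable; first exact: segment_compact.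
apply/within_continuousP; apply: cont_onW density_cont => u /=.
by rewrite in_itv /= => /andP[].
Qed.

(** For negative [s] the interval of integration is empty, so the primitive is extended by 0 to the
    left half line. *)
Lemma primitive_le0 s : s <= 0 -> Phi s = 0.
Proof.
rewrite le_eqVlt => /predU1P[->|s0]; rewrite /orlicz_primitive.
  by rewrite set_itv1 Rintegral_set1.
by rewrite set_itv_ge ?Rintegral_set0// bnd_simp -ltNge.
Qed.

Lemma primitive_derive s : 0 < s -> is_derive s 1 Phi (phi s).
Proof.
move=> s0; have su : s < s + 1 by rewrite ltrDl.
have [h1 h2] := continuous_FTC1_closed su (density_integrable _) s0 (density_continuous s0).
by rewrite -h2 derive1E; exact: derivableP.
Qed.

Lemma primitive_ge0 s : 0 <= Phi s.
Proof.
apply: Rintegral_ge0 => u /=; rewrite in_itv /= => /andP[u0 _]; exact: density_ge0.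
Qed.

(** Monotonicity of [phi] bounds the integrand by its last value. This gives continuity of the
    primitive at 0, where no derivative is at hand. *)
Lemma primitive_bound s : 0 <= s -> Phi s <= phi s * s.
Proof.
move=> s0; have -> : phi s * s = \int[lebesgue_measure]_(t in `[0, s]) phi s.
  rewrite Rintegral_cst//; have := @lebesgue_measure_itv R `[0, s]; rewrite /= => ->.
  rewrite lte_fin; case: ifPn => /= [_|]; first by rewrite subr0.
  by rewrite -leNgt => h; congr (_ * _); apply/eqP; rewrite eq_le s0 h.
apply: le_Rintegral => //; first exact: density_integrable.
  by apply: continuous_compact_integrable; [exact: segment_compact|apply: continuous_subspaceT =>
      u; exact: cvg_cst].
move=> u /=; rewrite in_itv /= => /andP[u0 us]; exact: density_homo.
Qed.

Lemma primitive_continuous : continuous Phi.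
Proof.
move=> s; have [s0|s0|->] := ltgtP s 0; last first.
- rewrite /continuous_at primitive_le0//.
  have p1 : 0 < phi 1 := density_gt0 ltr01.
  apply/cvgrPdist_le => e e0.
  have h1 : \forall t \near (0 : R), t < 1 by apply: near_lt.
  have h2 : \forall t \near (0 : R), t < e / phi 1 by apply: near_lt; rewrite divr_gt0.
  have h : \forall t \near (0 : R), t < 1 /\ t < e / phi 1 by apply: filterI.
  apply: filterS h => t [t1 te]; rewrite sub0r normrN ger0_norm ?primitive_ge0//.
  have [t0|t0] := leP t 0; first by rewrite primitive_le0// ltW.
  apply: (le_trans (primitive_bound (ltW t0))).
  apply: (@le_trans _ _ (phi 1 * (e / phi 1))); last by rewrite mulrC divfK// gt_eqF.
  apply: ler_pM; [exact/density_ge0/ltW|exact: ltW| |exact: ltW].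
  by apply: density_homo; exact: ltW.
- exact: (is_derive_cont (primitive_derive s0)).
- have h : \forall t \near s, cst 0 t = Phi t.
    by apply: filterS (near_lt s0) => t t0; rewrite primitive_le0// ltW.
  rewrite /continuous_at primitive_le0 ?ltW//.
  by apply: cvg_trans (near_eq_cvg h) _; exact: cvg_cst.
Qed.

Lemma primitive_abs_continuous : continuous (fun s : R => Phi `|s|).
Proof.
move=> s; apply: (@cont_comp _ _ _ (fun s : R => `|s|) Phi); first exact: norm_continuous.
exact: primitive_continuous.
Qed.

(** The differences between neighbouring terms vanish at 0, and the index condition on [phi] says
    that their derivatives are nonnegative; the product rule for [s phi(s)] accounts for the added
    1. *)
Lemma primitive_index s : 0 < s -> (1 + d0) * Phi s <= s * phi s <= (1 + d1) * Phi s.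
Proof.
move=> s0.
have cid : cont_on [set u : R | 0 <= u <= s] (fun u => u * phi u).
  apply: cont_on_mul; first by apply: continuous_cont_onT => u; exact: cvg_id.
  by apply: cont_onW density_cont => u /= /andP[].
have cP (c : R) : cont_on [set u : R | 0 <= u <= s] (fun u => c * Phi u).
  by apply: cont_on_mul; [exact: cont_on_cst|apply: continuous_cont_onT;
      exact: primitive_continuous].
have d u (c : R) : 0 < u -> is_derive u 1 (id * phi - (cst c * Phi)) (u * derive1 phi u + phi u -
    c * phi u).
  move=> u0; have := is_deriveB (is_deriveM (is_derive_id u 1) (density_derive u0))
    (is_deriveM (is_derive_cst c u 1) (primitive_derive u0)).
  by rewrite scaler0 addr0 /GRing.scale /= mulr1.
apply/andP; split; rewrite -subr_ge0.
  have -> : s * phi s - (1 + d0) * Phi s = (id * phi - (cst (1 + d0) * Phi)) s by [].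
  have {1}-> : 0 = (id * phi - (cst (1 + d0) * Phi)) 0.
    by rewrite -[RHS]/(0 * phi 0 - (1 + d0) * Phi 0) primitive_le0// mul0r mulr0 subrr.
  apply: (ge0_is_derive_homo (ltW s0)) => [u /andP[u0 _]|u /andP[u0 _]|].
  - exact: d.
  - have /andP[h _] := density_index u0; move: (phi u) (u * _) h => A B h; lra.
  - exact: (cont_on_sub cid (cP _)).
have -> : (1 + d1) * Phi s - s * phi s = (cst (1 + d1) * Phi - id * phi) s by [].
have {1}-> : 0 = (cst (1 + d1) * Phi - id * phi) 0.
  by rewrite -[RHS]/((1 + d1) * Phi 0 - 0 * phi 0) primitive_le0// mul0r mulr0 subrr.
apply: (ge0_is_derive_homo (df := fun u => - (u * derive1 phi u + phi u - (1 + d1) * phi u)) (ltW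
    s0)) => [u /andP[u0 _]|u /andP[u0 _]|].
- by rewrite -(opprB (id * phi)); apply: is_deriveN; exact: d.
- have /andP[_ h] := density_index u0; move: (phi u) (u * _) h => A B h; lra.
- exact: (cont_on_sub (cP _) cid).
Qed.

Lemma primitive_index0 s : 0 <= s -> (1 + d0) * Phi s <= s * phi s <= (1 + d1) * Phi s.
Proof.
rewrite le_eqVlt => /predU1P[<-|/primitive_index//].
by rewrite primitive_le0// !mulr0 mul0r lexx.
Qed.

Lemma primitive_homo s t : s <= t -> Phi s <= Phi t.
Proof.
have [s0 _|s0 st] := leP s 0; first by rewrite primitive_le0 ?primitive_ge0.
apply: (@ge0_is_derive_homo _ _ phi) => //.
- by move=> u /andP[su _]; apply: primitive_derive; exact: lt_trans su.
- by move=> u /andP[su _]; apply: density_ge0; apply/ltW; exact: lt_trans su.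
- by apply: continuous_cont_onT; exact: primitive_continuous.
Qed.

Lemma primitive_scale_le l s : 1 <= l -> 0 <= s -> Phi (l * s) <= l `^ (1 + d1) * Phi s.
Proof.
move=> l1; rewrite le_eqVlt => /predU1P[<-|s0].
  by rewrite mulr0 primitive_le0 ?mulr0.
have -> : l `^ (1 + d1) = (l * s / s) `^ (1 + d1) by rewrite mulfK// gt_eqF.
apply: (@index_ge _ _ phi) => //; first exact: primitive_derive.
- by move=> u /primitive_index/andP[].
- by rewrite ler_peMl// ltW.
Qed.

Lemma primitive_scale_ge l s : 1 <= l -> 0 <= s -> l `^ (1 + d0) * Phi s <= Phi (l * s).
Proof.
move=> l1; rewrite le_eqVlt => /predU1P[<-|s0].
  by rewrite mulr0 primitive_le0 ?mulr0.
have -> : l `^ (1 + d0) = (l * s / s) `^ (1 + d0) by rewrite mulfK// gt_eqF.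
apply: (@index_le _ _ phi) => //; first exact: primitive_derive.
- by move=> u /primitive_index/andP[].
- by rewrite ler_peMl// ltW.
Qed.

End orlicz.

(** It involves the density through [d1] alone, so it is the same for all dilations of [phi]. The
    base is a ratio [l >= 1] such that [r <= l u] in the second case of [orlicz_young]. *)
Definition young_constant {R : realType} (d1 kap : R) : R :=
  (1 + (1 + d1) / kap) `^ d1 * (1 + d1).

Section young.
Context {R : realType}.
Implicit Types (s t u l kap r : R).
Variables (phi : R -> R) (d0 d1 : R).
Hypothesis hphi : orlicz_density phi d0 d1.
Local Notation Phi := (orlicz_primitive phi).

Lemma young_constant_ge0 kap : 0 <= young_constant d1 kap.
Proof. by rewrite mulr_ge0 ?powR_ge0// addr_ge0// ltW// (density_d1 hphi). Qed.

(** No complementary function is used, only a dichotomy. If [u] is at most [kap r / (1 + d1)], the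
    upper index bound on [r phi(r)] gives [kap Phi(r)]. Otherwise [r <= l u], and the growth of
    [phi] reduces the product to a multiple of [u phi(u)]. *)
Lemma orlicz_young kap r u : 0 < kap -> 0 <= r -> 0 <= u ->
  phi r * u <= kap * Phi r + young_constant d1 kap * Phi u.
Proof.
move=> k0 r0 u0; have dd1 := density_d1 hphi.
have d1p : 0 < 1 + d1 by rewrite addr_gt0.
pose k' := kap / (1 + d1); have k'0 : 0 < k' by rewrite divr_gt0.
have /andP[_ hr] := primitive_index0 hphi r0.
have /andP[_ hu] := primitive_index0 hphi u0.
have Pr := primitive_ge0 hphi r; have Pu := primitive_ge0 hphi u.
have [ur|ru] := leP u (k' * r).
  apply: (@le_trans _ _ (kap * Phi r)); last by rewrite lerDl mulr_ge0// young_constant_ge0.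
  apply: (@le_trans _ _ (phi r * (k' * r))); first by rewrite ler_wpM2l// (density_ge0 hphi).
  have -> : phi r * (k' * r) = k' * (r * phi r) by ring.
  have -> : kap = k' * (1 + d1) by rewrite divfK// gt_eqF.
  by rewrite -mulrA ler_wpM2l// ltW.
apply: (@le_trans _ _ (young_constant d1 kap * Phi u)); last by rewrite lerDr mulr_ge0// ltW.
pose l := 1 + (1 + d1) / kap.
have l1 : 1 <= l by rewrite lerDl divr_ge0// ltW.
have rl : r <= l * u.
  apply: (@le_trans _ _ ((1 + d1) / kap * u)); last by rewrite ler_wpM2r// lerDr.
  have -> : (1 + d1) / kap * u = u / k' by rewrite /k' invf_div mulrC.
  by rewrite ler_pdivlMr// mulrC ltW.
apply: (@le_trans _ _ (l `^ d1 * phi u * u)).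
  rewrite ler_wpM2r//; apply: le_trans (density_scale hphi l1 u0).
  exact: (density_homo hphi r0).
by rewrite /young_constant -!mulrA ler_wpM2l ?powR_ge0// mulrC.
Qed.

End young.

(** * Regularisation and dilation of the density *)

Section regularization.
Context {R : realType}.
Implicit Types (s e : R).

(** A smooth substitute for the absolute value that stays above [e], hence away from 0, where [phi]
    need not be differentiable. *)
Definition regabs e s : R := Num.sqrt (s ^+ 2 + e ^+ 2).

Lemma regabs_sqr e s : regabs e s ^+ 2 = s ^+ 2 + e ^+ 2.
Proof. by rewrite sqr_sqrtr// addr_ge0 ?sqr_ge0. Qed.

Lemma regabs_gt0 e s : 0 < e -> 0 < regabs e s.
Proof. by move=> e0; rewrite sqrtr_gt0 ltr_wpDl ?sqr_ge0 ?exprn_gt0. Qed.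

Lemma regabs_ge_norm e s : `|s| <= regabs e s.
Proof. by rewrite -sqrtr_sqr ler_wsqrtr// lerDl sqr_ge0. Qed.

Lemma regabs_ge e s : 0 < e -> e <= regabs e s.
Proof.
move=> e0; have -> : e = Num.sqrt (e ^+ 2) by rewrite sqrtr_sqr gtr0_norm.
by rewrite ler_wsqrtr// sqrtr_sqr gtr0_norm// lerDr sqr_ge0.
Qed.

Lemma regabs_le e s : 0 < e -> regabs e s <= `|s| + e.
Proof.
move=> e0; rewrite -(@ler_pXn2r _ 2) ?nnegrE ?sqrtr_ge0 ?addr_ge0 ?(ltW e0)//.
rewrite regabs_sqr sqrrD real_normK ?num_real//.
by rewrite -addrA lerD2l lerDr mulrn_wge0// mulr_ge0// ltW.
Qed.

Lemma regabs_derive e s : 0 < e -> is_derive s 1 (regabs e) (s / regabs e s).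
Proof.
move=> e0; have h0 : 0 < s ^+ 2 + e ^+ 2 by rewrite ltr_wpDl ?sqr_ge0 ?exprn_gt0.
have h1 : is_derive s 1 (fun s : R => s ^+ 2 + e ^+ 2) (2 * s).
  have := is_deriveD (is_deriveX 2 (is_derive_id s (1 : R))) (is_derive_cst (e ^+ 2 : R) s (1 : R)).
  by move/is_derive_eq; apply; rewrite addr0 expr1 /GRing.scale /= mulr1 mulr_natl.
have := @is_derive1_comp _ _ (fun s : R => s ^+ 2 + e ^+ 2) s _ _ (is_derive1_sqrt h0) h1.
rewrite -/(regabs e s); have r0 := regabs_gt0 s e0.
by move/is_derive_eq; apply; rewrite invfM mulrACA mulVf// mul1r mulrC.
Qed.

Lemma regabs_continuous e : 0 < e -> continuous (regabs e).
Proof. by move=> e0 s; exact: (is_derive_cont (regabs_derive s e0)). Qed.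

Variables (phi : R -> R) (d0 d1 : R).
Hypothesis hphi : orlicz_density phi d0 d1.
Local Notation Phi := (orlicz_primitive phi).

Definition reg e s : R := Phi (regabs e s).
Definition dreg e s : R := phi (regabs e s) / regabs e s * s.
Definition ddreg e s : R := phi (regabs e s) / regabs e s
  + s ^+ 2 * (regabs e s * derive1 phi (regabs e s) - phi (regabs e s)) / regabs e s ^+ 3.

Lemma reg_derive e s : 0 < e -> is_derive s 1 (reg e) (dreg e s).
Proof.
move=> e0; have := @is_derive1_comp _ _ (regabs e) s _ _ (primitive_derive hphi (regabs_gt0 s
    e0)) (regabs_derive s e0).
by move/is_derive_eq; apply; rewrite /dreg mulrA mulrAC.
Qed.

Lemma dreg_derive e s : 0 < e -> is_derive s 1 (dreg e) (ddreg e s).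
Proof.
move=> e0; have r0 := regabs_gt0 s e0; have hr := regabs_derive s e0.
have h1 := @is_derive1_comp _ _ (regabs e) s _ _ (density_derive hphi r0) hr.
have h2 := is_deriveV (lt0r_neq0 r0) hr.
have := is_deriveM (is_deriveM h1 h2) (is_derive_id s (1 : R)).
have -> : (phi \o regabs e) * (fun t => (regabs e t)^-1) * id = dreg e by [].
move/is_derive_eq; apply; rewrite /ddreg /GRing.scale /=.
rewrite -[((phi \o regabs e) * _) s]/(phi (regabs e s) / regabs e s).
move: (regabs e s) (phi _) (derive1 phi _) r0 => r p q r0.
by rewrite -exprVn; field; rewrite gt_eqF.
Qed.

Lemma reg_continuous e : 0 < e -> continuous (reg e).
Proof. by move=> e0 s; exact: (is_derive_cont (reg_derive s e0)). Qed.

Lemma dreg_continuous e : 0 < e -> continuous (dreg e).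
Proof. by move=> e0 s; exact: (is_derive_cont (dreg_derive s e0)). Qed.

Lemma ddreg_continuous e : 0 < e -> continuous (ddreg e).
Proof.
move=> e0 s; have r0 := regabs_gt0 s e0; have cr := @regabs_continuous e e0.
have cphi : continuous_at s (fun s => phi (regabs e s)).
  by apply: (@cont_comp _ _ _ (regabs e) phi); [exact: cr|exact: (density_continuous hphi)].
have cdphi : continuous_at s (fun s => derive1 phi (regabs e s)).
  by apply: (@cont_comp _ _ _ (regabs e) (derive1 phi));
      [exact: cr|exact: (density_derive_cont hphi)].
have cX (f : R -> R) n : continuous_at s f -> continuous_at s (fun s => f s ^+ n).
  move=> cf; elim: n => [|n IH]; first exact: cont_cst.
  have -> : (fun s => f s ^+ n.+1) = (fun s => f s * f s ^+ n) by apply/funext => z; rewrite exprS.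
  exact: cont_mul.
apply: cont_add.
  by apply: cont_mul => //; apply: cont_inv; [exact: lt0r_neq0|exact: cr].
apply: cont_mul; last by apply: cont_inv; [rewrite expf_neq0// gt_eqF|apply: cX; exact: cr].
apply: cont_mul; first by apply: (cX id); exact: cvg_id.
by apply: cont_sub => //; apply: cont_mul => //; exact: cr.
Qed.

(** With [r = regabs e s], the second derivative is [phi(r) / r] times the average of 1 and the
    index [r phi'(r) / phi(r)] with weights [e^2 / r^2] and [s^2 / r^2]; the index is at least
    [d0]. *)
Lemma ddreg_ge e s : 0 < e -> Num.min d0 1 * (phi (regabs e s) / regabs e s) <= ddreg e s.
Proof.
move=> e0; have r0 := regabs_gt0 s e0.
have /andP[hi _] := density_index hphi r0.
have p0 := density_gt0 hphi r0.
have := regabs_sqr e s; rewrite /ddreg.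
have m1 : Num.min d0 1 <= 1 by rewrite ge_min lexx orbT.
have m2 : Num.min d0 1 <= d0 by rewrite ge_min lexx.
have s2 : 0 <= s ^+ 2 by rewrite sqr_ge0.
have e2 : 0 <= e ^+ 2 by rewrite sqr_ge0.
move: (Num.min d0 1) (regabs e s) (phi _) (_ * derive1 phi _) (s ^+ 2) (e ^+ 2) m1 m2 s2 e2 r0 hi
    p0.
move=> mn r p q s2 e2 m1 m2 s20 e20 r0 hi p0 hr.
rewrite -subr_ge0.
have -> : p / r + s2 * (q - p) / r ^+ 3 - mn * (p / r) = (p * r ^+ 2 + s2 * (q - p) - mn * p * r
    ^+ 2) / r ^+ 3.
  by field; rewrite gt_eqF.
apply: divr_ge0; last by rewrite exprn_ge0// ltW.
rewrite hr.
have h1 : 0 <= e2 * (1 - mn) * p by rewrite !mulr_ge0 ?subr_ge0// ltW.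
have h2 : 0 <= s2 * (q - d0 * p) by rewrite mulr_ge0// subr_ge0.
have h3 : 0 <= s2 * (d0 - mn) * p by rewrite !mulr_ge0 ?subr_ge0// ltW.
move: h1 h2 h3; lra.
Qed.

(* AM-GM, with P'^2 <= const P P'' from the index bounds. *)
Lemma ddreg_absorb e s A b y : 0 < e -> 0 < A ->
  - (b * dreg e s * y) <= A * ddreg e s * y ^+ 2 + b ^+ 2 * (1 + d1) / (4 * A * Num.min d0 1) *
      reg e s.
Proof.
move=> e0 A0; have r0 := regabs_gt0 s e0.
have m0 : 0 < Num.min d0 1 by rewrite lt_min ltr01 (density_d0 hphi).
have /andP[_ hi] := primitive_index hphi r0.
have p0 := density_gt0 hphi r0.
have hd := ddreg_ge s e0.
have hs : s ^+ 2 <= regabs e s ^+ 2 by rewrite regabs_sqr lerDl sqr_ge0.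
rewrite /dreg /reg; move: hd hs hi m0 r0 p0.
move: (Num.min d0 1) (regabs e s) (ddreg e s) (1 + d1) => mn r q d.
move: (phi r) (Phi r) => p P hd hs hi m0 r0 p0.
apply: (@le_trans _ _ (A * (mn * (p / r)) * y ^+ 2 + b ^+ 2 / (4 * A * mn) * (p / r * s ^+ 2))).
  rewrite -subr_ge0.
  have -> : A * (mn * (p / r)) * y ^+ 2 + b ^+ 2 / (4 * A * mn) * (p / r * s ^+ 2) - - (b * (p /
      r * s) * y)
     = p / r * (A * mn) * (y + b * s / (2 * A * mn)) ^+ 2.
    by field; rewrite !gt_eqF.
  by rewrite mulr_ge0 ?sqr_ge0// mulr_ge0 ?divr_ge0 ?mulr_ge0 ?ltW.
apply: lerD.
  by rewrite ler_wpM2r ?sqr_ge0// ler_wpM2l// ltW.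
have c0 : 0 <= b ^+ 2 / (4 * A * mn) by rewrite divr_ge0 ?sqr_ge0 ?mulr_ge0 ?ltW.
have -> : b ^+ 2 * d / (4 * A * mn) * P = b ^+ 2 / (4 * A * mn) * (d * P) by move: (_^-1) => z;
    ring.
rewrite ler_wpM2l//; apply: le_trans hi.
have -> : r * p = p / r * r ^+ 2 by field; rewrite gt_eqF.
by rewrite ler_wpM2l// divr_ge0// ltW.
Qed.

Lemma reg_ge e s : Phi `|s| <= reg e s.
Proof. by apply: (primitive_homo hphi); exact: regabs_ge_norm. Qed.

Lemma reg_le1 e s : 0 < e -> e <= 1 -> reg e s <= Phi (`|s| + 1).
Proof.
move=> e0 e1; apply: (primitive_homo hphi).
by apply: (le_trans (regabs_le s e0)); rewrite lerD2l.
Qed.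

Lemma dreg_le e s : 0 < e -> `|dreg e s| <= phi (regabs e s).
Proof.
move=> e0; have r0 := regabs_gt0 s e0; have p0 := density_gt0 hphi r0.
rewrite /dreg -mulrA normrM gtr0_norm// ler_piMr ?(ltW p0)// normrM gtr0_norm ?invr_gt0//.
by rewrite mulrC ler_pdivrMr// mul1r regabs_ge_norm.
Qed.

End regularization.

Section rescaling.
Context {R : realType}.
Variables (phi : R -> R) (d0 d1 k : R).
Hypotheses (hphi : orlicz_density phi d0 d1) (k0 : 0 < k).

Definition rescale (s : R) : R := phi (s / k) / k.

Let inner_derive (s : R) : is_derive s 1 (fun u : R => u / k) k^-1.
Proof.
have -> : (fun u : R => u / k) = id * cst k^-1 by [].
have := is_deriveM (is_derive_id s (1 : R)) (is_derive_cst (k^-1 : R) s (1 : R)).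
by move/is_derive_eq; apply; rewrite scaler0 add0r /GRing.scale /= mulr1.
Qed.

Let rescale_derive (s : R) : 0 < s -> is_derive s 1 rescale (derive1 phi (s / k) / k ^+ 2).
Proof.
move=> s0; have sk0 : 0 < s / k by rewrite divr_gt0.
have h := @is_derive1_comp _ _ (fun u : R => u / k) s _ _ (density_derive hphi sk0) (inner_derive
    s).
have := is_deriveM h (is_derive_cst (k^-1 : R) s (1 : R)).
by move/is_derive_eq; apply; rewrite scaler0 add0r /GRing.scale /= expr2 invfM mulrC mulrA.
Qed.

(** The quotient [s phi'(s) / phi(s)] is merely evaluated at [s / k] by a dilation, so both of its
    bounds survive. *)
Lemma orlicz_density_rescale : orlicz_density rescale d0 d1.
Proof.
split.
- apply/within_continuousP; rewrite /rescale; apply: cont_on_mul; last exact: cont_on_cst.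
  apply: (cont_on_comp (density_cont hphi)).
    by apply: continuous_cont_onT => s; exact: (is_derive_cont (inner_derive s)).
  by move=> s /= s0; rewrite divr_ge0// ltW.
- by rewrite /rescale mul0r (density0 hphi) mul0r.
- move=> s s0; have sk0 : 0 < s / k by rewrite divr_gt0.
  split; first by rewrite divr_gt0// (density_gt0 hphi).
    by have [] := rescale_derive s0.
  have E : \forall t \near s, derive1 phi (t / k) / k ^+ 2 = derive1 rescale t.
    have : nbhs s [set t | 0 < t] by apply: open_nbhs_nbhs; split; [exact: open_gt|].
    by apply: filterS => t t0; rewrite [RHS]derive1E; have [_ ->] := rescale_derive t0.
  change (derive1 rescale t @[t --> s] --> derive1 rescale s).
  rewrite -(nbhs_singleton E).
  apply: cvg_trans (near_eq_cvg E) _.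
  apply: (@cont_mul _ _ (fun t : R => derive1 phi (t / k)) (fun _ => (k ^+ 2)^-1) s);
      last exact: cont_cst.
  apply: (@cont_comp _ _ _ (fun t : R => t / k) (derive1 phi));
      last exact: (density_derive_cont hphi).
  exact: (is_derive_cont (inner_derive s)).
- by split; [exact: (density_d0 hphi)|exact: (density_d1 hphi)].
move=> s s0; have sk0 : 0 < s / k by rewrite divr_gt0.
have -> : s * derive1 rescale s / rescale s = s / k * derive1 phi (s / k) / phi (s / k).
  rewrite derive1E; have [_ ->] := rescale_derive s0; rewrite /rescale.
  have p0 := density_gt0 hphi sk0; move: (phi _) (derive1 phi _) p0 => p q p0.
  by field; rewrite !gt_eqF.
by case: hphi => _ _ _ _; apply.
Qed.

(** Both sides vanish at 0 and have the same derivative on the positive half line, so their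
    difference is monotone in both directions. *)
Lemma primitive_rescale s : orlicz_primitive rescale s = orlicz_primitive phi (s / k).
Proof.
have hk := orlicz_density_rescale.
have [s0|s0] := leP s 0.
  by rewrite !primitive_le0// pmulr_lle0// invr_gt0.
pose F (u : R) := orlicz_primitive rescale u; pose H (u : R) := orlicz_primitive phi (u / k).
have Fd (u : R) : 0 < u -> is_derive u 1 F (rescale u) by move=> u0; exact: (primitive_derive hk).
have Hd (u : R) : 0 < u -> is_derive u 1 H (rescale u).
  move=> u0; have uk0 : 0 < u / k by rewrite divr_gt0.
  exact: (@is_derive1_comp _ _ (fun u : R => u / k) u _ _ (primitive_derive hphi uk0)
      (inner_derive u)).
have cF : continuous F by exact: (primitive_continuous hk).
have cH : continuous H.
  move=> u; apply: (@cont_comp _ _ _ (fun t : R => t / k) (orlicz_primitive phi));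
      last exact: (primitive_continuous hphi).
  exact: (is_derive_cont (inner_derive u)).
have F0 : F 0 = 0 by exact: primitive_le0.
have H0 : H 0 = 0 by rewrite /H mul0r primitive_le0.
apply/eqP; rewrite -/(F s) -/(H s) -subr_eq0 eq_le; apply/andP; split.
  rewrite -oppr_ge0 opprB; have -> : 0 = (H - F) 0 by rewrite -[RHS]/(H 0 - F 0) F0 H0 subrr.
  apply: (ge0_is_derive_homo (f := H - F) (df := fun u => rescale u - rescale u) (ltW s0)).
  - by move=> u /andP[u0 _]; apply: is_deriveB; [exact: Hd|exact: Fd].
  - by move=> u _; rewrite subrr.
  - by apply: cont_on_sub; exact: continuous_cont_onT.
have -> : 0 = (F - H) 0 by rewrite -[RHS]/(F 0 - H 0) F0 H0 subrr.
apply: (ge0_is_derive_homo (f := F - H) (df := fun u => rescale u - rescale u) (ltW s0)).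
- by move=> u /andP[u0 _]; apply: is_deriveB; [exact: Fd|exact: Hd].
- by move=> u _; rewrite subrr.
- by apply: cont_on_sub; exact: continuous_cont_onT.
Qed.

End rescaling.

(** * Energy estimate *)

Section pointwise.
Context {R : realType}.
Variables (phi : R -> R) (d0 d1 : R).
Hypothesis hphi : orlicz_density phi d0 d1.
Local Notation Phi := (orlicz_primitive phi).
Variable (e : R).
Hypothesis e0 : 0 < e.
Implicit Types (s r : R).

(** The sign of [D] decides which of the two index bounds is used, and the maximum covers both
    cases. This is the origin of the maximum in (A2-3') and, with [- D] for [D], of the minimum in
    (A3-2'). *)
Lemma max_quotient_ge (D : R) r : 0 < r ->
  D * Phi r <= Num.max (D / (1 + d0)) (D / (1 + d1)) * (r * phi r).
Proof.
move=> r0; have /andP[h0 h1] := primitive_index hphi r0.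
have p0 := density_d0 hphi; have p1 := density_d1 hphi.
have q0 : 0 <= r * phi r by rewrite mulr_ge0 ?ltW// (density_gt0 hphi).
have [D0|D0] := leP 0 D.
  apply: (@le_trans _ _ (D / (1 + d0) * (r * phi r))); last by rewrite ler_wpM2r// le_max lexx.
  by rewrite -mulrA ler_wpM2l// ler_pdivlMl// addr_gt0.
apply: (@le_trans _ _ (D / (1 + d1) * (r * phi r))); last by rewrite ler_wpM2r// le_max lexx orbT.
by rewrite -mulrA ler_wnM2l ?(ltW D0)// ler_pdivrMl// addr_gt0.
Qed.

Lemma min_quotient_le (D : R) r : 0 < r ->
  Num.min (D / (1 + d0)) (D / (1 + d1)) * (r * phi r) <= D * Phi r.
Proof.
move=> r0; have := max_quotient_ge (- D) r0.
by rewrite !mulNr -oppr_min mulNr lerN2.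
Qed.

(** Condition (A2-1) speaks of [W ^+ 2], the index bounds of the square of [r = regabs e W]. Their
    difference is [e ^+ 2], which accounts for the error on the right. *)
Lemma interior_reaction (clo c mu D h W : R) : 0 < clo ->
  clo <= c - mu - Num.max (D / (1 + d0)) (D / (1 + d1)) -> - h * W <= mu * W ^+ 2 ->
  clo * (1 + d0) * reg phi e W + D * reg phi e W - dreg phi e W * (c * W + h)
  <= e * (`|c - mu| * phi (regabs e W)).
Proof.
move=> clo0 hc hh; have r0 := regabs_gt0 W e0.
have hD := max_quotient_ge D r0.
have /andP[h0 _] := primitive_index hphi r0.
have p0 := density_gt0 hphi r0.
have hr := regabs_sqr e W; have er := regabs_ge W e0.
have hcm := ler_norm (c - mu).
rewrite /dreg /reg; move: (regabs e W) hr er r0 hD h0 p0 => r hr er r0.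
move: (Phi r) (phi r) (Num.max _ _) hc => P p M hc hD h0 p0.
have pr0 : 0 < p / r by rewrite divr_gt0.
have t1 : - (p / r * W * (c * W + h)) <= - ((c - mu) * (r * p)) + (c - mu) * e ^+ 2 * (p / r).
  have -> : - ((c - mu) * (r * p)) + (c - mu) * e ^+ 2 * (p / r) = - ((c - mu) * (r ^+ 2 - e ^+
      2) * (p / r)).
    by field; rewrite gt_eqF.
  rewrite hr addrK.
  have : p / r * (- h * W) <= p / r * (mu * W ^+ 2) by rewrite ler_wpM2l// ltW.
  move: (p / r) => z; nra.
(* One factor [e] is spent on [e / r <= 1], which removes the possibly large quotient [p / r]. *)
have t2 : (c - mu) * e ^+ 2 * (p / r) <= e * (`|c - mu| * p).
  apply: (@le_trans _ _ (`|c - mu| * e ^+ 2 * (p / r))).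
    by rewrite ler_wpM2r ?(ltW pr0)// ler_wpM2r// sqr_ge0.
  have -> : `|c - mu| * e ^+ 2 * (p / r) = e * (`|c - mu| * p) * (e / r) by move: `|_| => z;
      field; rewrite gt_eqF.
  by rewrite ler_piMr ?mulr_ge0 ?(ltW e0) ?(ltW p0)// ler_pdivrMr// mul1r.
have rp0 : 0 <= r * p by rewrite mulr_ge0// ltW.
have t3 : (clo + M) * (r * p) <= (c - mu) * (r * p) by rewrite ler_wpM2r// -lerBrDr.
have t4 : clo * ((1 + d0) * P) <= clo * (r * p) by rewrite ler_wpM2l// ltW.
rewrite mulrDl in t3.
move: t1 t2 t3 t4 hD; rewrite !mulrA.
move: ((c - mu) * e * e * p / r) (e * _ * p) (M * r * p) (D * P) (p / r * W * _) ((c - mu) * r *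
    p) => *.
lra.
Qed.

(** The Robin-Poincare term [theta * P] is spent in two halves: one pays for the remainder that
    [ddreg_absorb] leaves of the cross term, the other for the disturbance in [orlicz_young]. The
    smallness condition on [theta] is what the first half asks for. *)
Lemma interior_ineq (clo c mu D h W alo a theta rho x0 g0 G2 divA bg f : R) :
  0 < clo -> 0 < alo -> alo <= a -> 0 < theta ->
  theta * (rho ^+ 2 * (1 + d1) / (4 * alo * Num.min d0 1)) <= 2^-1 ->
  `|x0| <= rho -> g0 ^+ 2 <= G2 ->
  clo <= c - mu - Num.max (D / (1 + d0)) (D / (1 + d1)) -> - h * W <= mu * W ^+ 2 ->
    clo * (1 + d0) * reg phi e W + dreg phi e W * (divA - bg - c * W - h + f) <=
  (dreg phi e W * divA + ddreg phi e W * (a * G2) - reg phi e W * D - dreg phi e W * bg + theta *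
      reg phi e W + theta * x0 * (dreg phi e W * g0))
  + young_constant d1 (theta / 2) * Phi `|f| + e * (`|c - mu| * phi (regabs e W)).
Proof.
move=> clo0 alo0 aloa theta0 hth hx hg hc hh; set P := reg phi e W; set p := dreg phi e W.
have hreact := interior_reaction clo0 hc hh; rewrite -/P -/p in hreact.
have r0 := regabs_gt0 W e0; have p0 := density_gt0 hphi r0.
have P0 : 0 <= P by exact: (primitive_ge0 hphi).
have m0 : 0 < Num.min d0 1 by rewrite lt_min ltr01 (density_d0 hphi).
have dd1 : 0 < 1 + d1 by rewrite addr_gt0// (density_d1 hphi).
have ddr0 : 0 <= ddreg phi e W.
  apply: le_trans (ddreg_ge hphi W e0); apply: mulr_ge0; first exact: ltW.
  by rewrite divr_ge0// ltW.
have habs := ddreg_absorb hphi W (theta * x0) g0 e0 alo0; rewrite -/P -/p in habs.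
have t1 : (theta * x0) ^+ 2 * (1 + d1) / (4 * alo * Num.min d0 1) * P <= theta / 2 * P.
  rewrite ler_wpM2r//.
  apply: (@le_trans _ _ (theta * (theta * (rho ^+ 2 * (1 + d1) / (4 * alo * Num.min d0 1)))));
      last by rewrite ler_wpM2l// ltW.
  have -> : (theta * x0) ^+ 2 * (1 + d1) / (4 * alo * Num.min d0 1) = theta * (theta * (x0 ^+ 2 *
      (1 + d1) / (4 * alo * Num.min d0 1))).
    by move: (_^-1) => z; ring.
  have tt := ltW theta0; apply: (ler_wpM2l tt); apply: (ler_wpM2l tt).
  have x2 : x0 ^+ 2 <= rho ^+ 2.
    by rewrite -(@real_normK _ x0) ?num_real// lerXn2r ?nnegrE// (le_trans _ hx).
  rewrite ler_wpM2r ?invr_ge0 ?mulr_ge0 ?(ltW alo0) ?(ltW m0)//.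
  by rewrite ler_wpM2r// ltW.
have t2 : alo * ddreg phi e W * g0 ^+ 2 <= ddreg phi e W * (a * G2).
  rewrite (mulrC alo) -mulrA ler_wpM2l//; apply: ler_pM => //; first exact: ltW.
  exact: sqr_ge0.
have t3 : p * f <= theta / 2 * P + young_constant d1 (theta / 2) * Phi `|f|.
  apply: le_trans (orlicz_young hphi _ (ltW r0) (normr_ge0 f)); last by rewrite divr_gt0.
  apply: (le_trans (ler_norm _)); rewrite normrM ler_wpM2r//; exact: (dreg_le hphi).
move: hreact habs t1 t2 t3.
move: (theta * x0) => tx.
move: (ddreg phi e W * (a * G2)) (alo * ddreg phi e W * g0 ^+ 2) (tx ^+ 2 * (1 + d1) / _ * P) (e
    * _) (young_constant _ _ * _).
move=> z1 z2 z3 z4 z5 hreact habs t1 t2 t3.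
have -> : p * (divA - bg - c * W - h + f) = p * divA - p * bg - p * (c * W + h) + p * f by ring.
have -> : tx * (p * g0) = tx * p * g0 by rewrite mulrA.
have t4 : theta / 2 * P + theta / 2 * P = theta * P by field.
rewrite (mulrC P D).
move: (clo * _ * P) (p * divA) (p * bg) (p * (c * W + h)) (p * f) (D * P) (theta * P) (theta / 2
    * P) (tx * p * g0) t4 hreact habs t1 t2 t3 => *.
lra.
Qed.

(** The boundary dissipation [psilo (1 + d0) P] is also spent in two halves: one against the
    Robin-Poincare flux, whence the condition on [theta * rho], the other against the disturbance by
    [orlicz_young]. *)
Lemma boundary_ineq (psilo psi bnu W theta rho x0 nu0 dn d : R) : 0 < psilo -> 0 < theta ->
  (W != 0 -> psilo <= (psi + W * Num.min (bnu / (1 + d0)) (bnu / (1 + d1))) / W) ->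
  `|x0| <= rho -> `|nu0| <= 1 -> theta * rho <= psilo * (1 + d0) / 2 -> dn + psi = d ->
    dreg phi e W * dn - reg phi e W * bnu + theta * x0 * reg phi e W * nu0 <=
  young_constant d1 (psilo * (1 + d0) / 2) * Phi `|d| + e * ((psilo + `|bnu|) * phi (regabs e W)).
Proof.
move=> psilo0 theta0 hpsi hx hnu hth hdn; set P := reg phi e W; set p := dreg phi e W.
have r0 := regabs_gt0 W e0; have p0 := density_gt0 hphi r0.
have P0 : 0 <= P by exact: (primitive_ge0 hphi).
have q0 := density_d0 hphi; have q1 := density_d1 hphi.
have k0 : 0 < psilo * (1 + d0) / 2 by rewrite divr_gt0// mulr_gt0// addr_gt0.
set mn := Num.min _ _ in hpsi.
have mnb : `|mn| <= `|bnu|.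
  have hb (z : R) : 0 < z -> `|bnu / (1 + z)| <= `|bnu|.
    move=> z0; rewrite normrM ler_piMr// ger0_norm ?invr_ge0 ?addr_ge0 ?(ltW z0)//.
    by rewrite invf_le1 ?addr_gt0// lerDl ltW.
  by rewrite /mn minEle; case: ifP => _; exact: hb.
(* The infimum in (A3-2') leaves out 0, but multiplied by [W ^+ 2] its bound holds there too, both
   sides being 0. *)
have h1 : psilo * W ^+ 2 <= psi * W + mn * W ^+ 2.
  have [->|W0] := eqVneq W 0; first by rewrite expr0n /= !mulr0 addr0.
  have W2 : 0 < W ^+ 2 by rewrite exprn_even_gt0.
  have := hpsi W0; rewrite -(ler_pM2r W2).
  by have -> : (psi + W * mn) / W * W ^+ 2 = psi * W + mn * W ^+ 2 by field.
have hmn := min_quotient_le bnu r0; rewrite -/mn in hmn.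
have /andP[hi _] := primitive_index hphi r0.
have t1 : - (p * psi) - P * bnu <= - (psilo * (1 + d0) * P) + e * ((psilo + `|bnu|) * phi (regabs
    e W)).
  have hr := regabs_sqr e W; have er := regabs_ge W e0.
  rewrite /P /p /reg /dreg; move: (regabs e W) hr er r0 hmn hi p0 => r hr er r0.
  move: (Phi r) (phi r) => Q q hmn hi qq0.
  have qr0 : 0 < q / r by rewrite divr_gt0.
  have s1 : q / r * (psilo * W ^+ 2) <= q / r * (psi * W + mn * W ^+ 2) by rewrite ler_wpM2l// ltW.
  have s2 : (psilo - mn) * e ^+ 2 * (q / r) <= e * ((psilo + `|bnu|) * q).
    apply: (@le_trans _ _ ((psilo + `|bnu|) * e ^+ 2 * (q / r))).
      rewrite ler_wpM2r ?(ltW qr0)// ler_wpM2r ?sqr_ge0// lerD2l.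
      by apply: le_trans mnb; rewrite -normrN ler_norm.
    have -> : (psilo + `|bnu|) * e ^+ 2 * (q / r) = e * ((psilo + `|bnu|) * q) * (e / r) by move:
        `|_| => z; field; rewrite gt_eqF.
    by rewrite ler_piMr ?mulr_ge0 ?addr_ge0 ?(ltW e0) ?(ltW qq0) ?(ltW psilo0)// ler_pdivrMr//
        mul1r.
  have s3 : psilo * ((1 + d0) * Q) <= psilo * (r * q) by rewrite ler_wpM2l// ltW.
  have s4 : q / r * W ^+ 2 = r * q - e ^+ 2 * (q / r).
    have -> : W ^+ 2 = r ^+ 2 - e ^+ 2 by rewrite hr addrK.
    by field; rewrite gt_eqF.
  have s5 : q / r * (psilo * W ^+ 2) = psilo * (r * q) - psilo * (e ^+ 2 * (q / r)) by rewrite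
      mulrCA s4 mulrBr.
  have s6 : q / r * (psi * W + mn * W ^+ 2) = q / r * W * psi + mn * (r * q) - mn * (e ^+ 2 * (q
      / r)).
    by rewrite mulrDr (mulrCA _ mn) s4; ring.
  have s7 : (psilo - mn) * e ^+ 2 * (q / r) = psilo * (e ^+ 2 * (q / r)) - mn * (e ^+ 2 * (q /
      r)) by ring.
  rewrite s5 s6 in s1; rewrite s7 in s2; rewrite mulrA in s3; rewrite (mulrC Q).
  move: (q / r * W * psi) (mn * (r * q)) (mn * (e ^+ 2 * _)) (psilo * (e ^+ 2 * _)) (psilo * (r *
      q)) (bnu * Q) (e * _) s1 s2 s3 hmn => *.
  lra.
have t2 : theta * x0 * P * nu0 <= psilo * (1 + d0) / 2 * P.
  apply: (le_trans (ler_norm _)); rewrite !normrM (ger0_norm P0) (gtr0_norm theta0).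
  apply: (@le_trans _ _ (theta * rho * P * 1)); last by rewrite mulr1 ler_wpM2r.
  by apply: ler_pM => //; [rewrite !mulr_ge0// ltW|rewrite ler_wpM2r// ler_wpM2l// ltW].
have t3 : p * d <= psilo * (1 + d0) / 2 * P + young_constant d1 (psilo * (1 + d0) / 2) * Phi `|d|.
  apply: le_trans (orlicz_young hphi k0 (ltW r0) (normr_ge0 d)).
  apply: (le_trans (ler_norm _)); rewrite normrM ler_wpM2r//; exact: (dreg_le hphi).
have -> : p * dn = p * d - p * psi by rewrite -hdn; ring.
have t4 : psilo * (1 + d0) / 2 * P + psilo * (1 + d0) / 2 * P = psilo * (1 + d0) * P by field.
move: (psilo * (1 + d0) / 2 * P) (psilo * (1 + d0) * P) (young_constant _ _ * _) (e * _) (theta *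
    x0 * P * nu0) (p * d) (p * psi) (P * bnu) t4 t3 t2 t1 => *.
lra.
Qed.

End pointwise.

Section slices.
Context {R : realType} {m : nat}.
Local Notation V := ('rV[R]_m.+1).
Implicit Types (Omega : set V) (F : V * R -> R).

Lemma closed_cylinder_closure Omega : closed_cylinder Omega `<=` closure (cylinder Omega).
Proof.
move=> [x t] [/= cx t0] B [[B1 B2] /= [hB1 hB2] hB].
have [y [Oy By]] := cx B1 hB1.
have /nbhs_ballP[d /= d0 hd] := hB2.
(* The time is moved forward so that it becomes positive even when [t = 0]. *)
exists (y, t + d / 2); split; first by split => //=; rewrite ltr_wpDl// divr_gt0.
apply: hB; split => //=; apply: hd; rewrite -ball_normE /ball_ /= opprD addNKr normrN.
by rewrite gtr0_norm ?divr_gt0// ltr_pdivrMr// ltr_pMr// ltr1n.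
Qed.

Lemma open_cylinder Omega : open Omega -> open (cylinder Omega).
Proof.
move=> oO; rewrite openE => -[x t] [/= Ox t0].
exists (Omega, [set t | 0 < t]) => //=; split; first exact: open_nbhs_nbhs.
by apply: open_nbhs_nbhs; split => //; exact: open_gt.
Qed.

Lemma C2_closure_cont_on Omega F : C2_closure (cylinder Omega) F -> cont_on (closed_cylinder
    Omega) F.
Proof.
by move=> [/within_continuousP cF _ _ _ _]; apply: cont_onW cF; exact: closed_cylinder_closure.
Qed.

Lemma pair_continuous1 (x : V) (t : R) : {for x, continuous (fun x : V => (x, t))}.
Proof.
move=> B [[B1 B2] /= [h1 h2] hB]; have : nbhs x B1 by exact: h1.
by apply: filterS => y hy; apply: hB; split => //=; exact: nbhs_singleton h2.
Qed.

Lemma pair_continuous2 (x : V) (t : R) : {for t, continuous (fun t : R => (x, t))}.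
Proof.
move=> B [[B1 B2] /= [h1 h2] hB]; have : nbhs t B2 by exact: h2.
by apply: filterS => y hy; apply: hB; split => //=; exact: nbhs_singleton h1.
Qed.

Lemma cont_on_slice (A : set V) (I : set R) F t : I t -> cont_on (A `*` I) F ->
  cont_on A (fun x => F (x, t)).
Proof.
move=> It cF; apply: (cont_on_comp (f := fun x : V => (x, t)) cF) => //.
by apply: continuous_cont_on => x _; exact: pair_continuous1.
Qed.

Lemma cont_on_slice_time (A : set V) (I : set R) F x : A x -> cont_on (A `*` I) F ->
  cont_on I (fun t => F (x, t)).
Proof.
move=> Ax cF; apply: (cont_on_comp (f := fun t : R => (x, t)) cF) => //.
by apply: continuous_cont_on => t _; exact: pair_continuous2.
Qed.

Lemma slice_derive F x t (i : 'I_m.+1) (a : R) : is_derive (x, t) (dx i) F a ->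
  is_derive x (delta_mx 0 i) (fun x => F (x, t)) a.
Proof.
move=> /is_derive_line h; apply/is_derive_line; move: h.
congr (is_derive _ _ _ _); apply/funext => s; congr F; congr pair.
by rewrite /= scaler0 add0r.
Qed.

Lemma slice_derive_time F x t (a : R) : is_derive (x, t) dt F a ->
  is_derive t 1 (fun t => F (x, t)) a.
Proof.
move=> /is_derive_line h; apply/(@is_derive_line R R^o); move: h.
congr (is_derive _ _ _ _); apply/funext => s; congr F; congr pair.
by rewrite /= scaler0 add0r.
Qed.

(** The cutoff vanishes in a whole neighbourhood of each point outside, so the product is locally 0
    there, however [F] behaves near the boundary. The time derivative of [w], which has no boundary
    trace, is treated this way. *)
Lemma cutoff_continuous Omega (eta : V -> R) F x t : continuous eta ->
  (~ Omega x -> \forall y \near x, eta y = 0) -> (Omega x -> {for (x, t), continuous F}) ->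
  {for (x, t), continuous (fun p => eta p.1 * F p)}.
Proof.
move=> ceta eta0 cF; have [Ox|nO] := pselect (Omega x).
  apply: (@cont_mul R _ (fun p : V * R => eta p.1) F); last exact: cF.
  apply: (@cont_comp _ _ _ (fun p : V * R => p.1) eta); [exact: cvg_fst|exact: ceta].
move=> B /= hB; have h0 := eta0 nO.
have B0 : B 0 by have := nbhs_singleton hB; rewrite (nbhs_singleton h0) mul0r.
exists ([set y | eta y = 0], setT) => /=; first by split => //; exact: filterT.
by move=> [y u] /= [-> _]; rewrite mul0r.
Qed.

End slices.

Section parametric.
Context {R : realType} {m : nat}.
Local Notation V := ('rV[R]_m.+1).
Variables (mu : {measure set V -> \bar R}) (D A : set V).
Hypotheses (mD : measurable D) (Dfin : (mu D < +oo)%E) (DA : D `<=` A) (cA : compact A).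
Implicit Types (F G : V * R -> R) (s T : R).

Lemma param_integrable F I t : I t -> cont_on (A `*` I) F ->
  mu.-integrable D (EFin \o (fun x => F (x, t))).
Proof.
move=> It cF; have cFt := cont_on_slice It cF.
have [M M0 hM] := cont_on_bounded cA cFt.
apply: (bounded_integrable mD Dfin (M := M)); last by move=> x /DA; exact: hM.
apply: within_continuous_measurable_row => //; apply/within_continuousP.
exact: cont_onW cFt.
Qed.

(** Projecting times to [[s, T]] extends the integrand continuously to all times, so that continuity
    under the integral, a statement on open intervals, reaches the end points. *)
Let clamp s T (t : R) := Num.max s (Num.min t T).

Let clamp_continuous s T : continuous (clamp s T).
Proof.
move=> t; apply: (@continuous_max _ _ (cst s) (fun t => Num.min t T)); first exact: cst_continuous.
by apply: (@continuous_min _ _ id (cst T)); [exact: cvg_id|exact: cst_continuous].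
Qed.

Let clamp_in s T t : s <= T -> s <= clamp s T t <= T.
Proof. by move=> sT; rewrite /clamp le_max lexx /= ge_max sT ge_min lexx orbT. Qed.

Let clampE s T t : s <= t <= T -> clamp s T t = t.
Proof. by move=> /andP[st tT]; rewrite /clamp (min_idPl tT) (max_idPr st). Qed.

Lemma param_cont F s T : s <= T -> cont_on (A `*` [set t : R | s <= t <= T]) F ->
  cont_on [set t : R | s <= t <= T] (fun t => \int[mu]_(x in D) F (x, t)).
Proof.
move=> sT cF; set I := [set t : R | s <= t <= T].
pose Fc t x := F (x, clamp s T t).
have It t : I (clamp s T t) by exact: clamp_in.
have cAI : compact (A `*` I).
  apply: compact_setX => //.
  have -> : I = `[s, T]%classic by apply/seteqP; split => x; rewrite /= in_itv.
  exact: segment_compact.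
have [M M0 hM] := cont_on_bounded cAI cF.
apply: (@eq_cont_on _ _ _ (fun t => \int[mu]_(x in D) Fc t x)).
  by move=> t It'; rewrite /Fc clampE.
apply: continuous_cont_onT => t.
apply: (@continuity_under_integral _ _ _ mu Fc D mD (t - 1) (t + 1) _ _ (cst M) _ _ t _).
- by move=> u _; exact: (param_integrable (It u) cF).
- have H x : D x -> {in `]t - 1, t + 1[%classic, continuous (Fc^~ x)}.
    move=> Dx u _; have cFx := cont_on_slice_time (DA Dx) cF.
    apply: (cont_on_open openT) => //.
    apply: (cont_on_comp (f := clamp s T) cFx) => //.
      by apply: continuous_cont_onT; exact: clamp_continuous.
    by move=> v _; exact: clamp_in.
  exact: (aeW mu H).
- by apply: (bounded_integrable mD Dfin (M := M)); [exact: measurable_cst|move=> x _;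
    rewrite ger0_norm// ltW].
- move=> u _; have H x : D x -> `|Fc u x| <= cst M x by move=> Dx; apply: hM; split;
    [exact: DA|exact: It].
  exact: (aeW mu H).
- by rewrite inE /= in_itv /= ltrBlDr ltrDl ltr01.
Qed.

(** Differentiation under the integral is used at interior times only; continuity on the closed
    interval supplies the end points and a constant that dominates the derivative. *)
Lemma param_FTC F G s T : s < T -> cont_on (A `*` [set t : R | s <= t <= T]) F ->
  cont_on (A `*` [set t : R | s <= t <= T]) G ->
  (forall x t, D x -> s < t < T -> is_derive t 1 (fun t => F (x, t)) (G (x, t))) ->
  \int[mu]_(x in D) F (x, T) - \int[mu]_(x in D) F (x, s) =
  \int[lebesgue_measure]_(t in `[s, T]) \int[mu]_(x in D) G (x, t).
Proof.
move=> sT cF cG dF; set I := [set t : R | s <= t <= T].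
have cE := param_cont (ltW sT) cF; have cE' := param_cont (ltW sT) cG.
have IE : I = `[s, T]%classic by apply/seteqP; split => x; rewrite /= in_itv.
pose E t := \int[mu]_(x in D) F (x, t); pose E' t := \int[mu]_(x in D) G (x, t).
have cAI : compact (A `*` I) by apply: compact_setX => //; rewrite IE; exact: segment_compact.
have [M M0 hM] := cont_on_bounded cAI cG.
have dE t : s < t < T -> is_derive t 1 E (E' t).
  move=> tI.
  have tI' : (`]s, T[%classic : set R) t by rewrite /= in_itv.
  have i1 (u : R) : `]s, T[%classic u -> mu.-integrable D (EFin \o (fun x => F (x, u))).
    rewrite /= in_itv /= => /andP[su uT]; apply: (@param_integrable _ I) => //.
    by rewrite /I /= !ltW.
  have i2 (u : R) x : `]s, T[%classic u -> D x -> derivable (fun u => F (x, u)) u 1.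
    by rewrite /= in_itv /= => uI Dx; have [] := dF x u Dx uI.
  have dE1 (u : R) x : s < u < T -> D x -> partial1of2 (fun u x => F (x, u)) u x = G (x, u).
    by move=> uI Dx; rewrite partial1of2E; have [_ ->] := dF x u Dx uI.
  have i3 (u : R) x : `]s, T[%classic u -> D x -> `|partial1of2 (fun u x => F (x,
      u)) u x| <= cst M x.
    rewrite /= in_itv /= => uI Dx; rewrite dE1//; apply: hM; split; first exact: DA.
    by case/andP: uI => ? ?; rewrite /I /= !ltW.
  have iM : mu.-integrable D (EFin \o cst M).
    by apply: (bounded_integrable mD Dfin (M := M)); [exact: measurable_cst|move=> x _;
        rewrite ger0_norm// ltW].
  have Mp (x : V) : 0 <= cst M x by exact: ltW.
  have h1 := derivable_under_integral mD tI' i1 i2 Mp iM i3.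
  have h2 := differentiation_under_integral mD tI' i1 i2 Mp iM i3.
  apply: DeriveDef => //; rewrite -derive1E h2; apply: eq_Rintegral => x /set_mem Dx.
  exact: dE1.
have := @continuous_FTC2 R E' E s T sT.
move=> FTC; rewrite [RHS]/Rintegral FTC//.
- by rewrite -IE; apply/within_continuousP.
- have := continuous_within_itvP E sT => -[h _].
  have [|h1 h2 h3] := h; first by rewrite -IE; apply/within_continuousP.
  by split => // t; rewrite in_itv /= => tI; have [] := dE t tI.
- by move=> t; rewrite in_itv /= => tI; rewrite derive1E; have [_ ->] := dE t tI.
Qed.

End parametric.

Section cutoff_parts.
Context {R : realType} {m : nat}.
Local Notation V := ('rV[R]_m.+1).
Local Notation leb := (lebesgue_row R m.+1).
Variables (Omega : set V) (eta : V -> R).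
Hypotheses (oOmega : open Omega) (bOmega : bounded_set Omega) (C1eta : C1 eta).
Hypothesis eta0 : forall x, ~ Omega x -> \forall y \near x, eta y = 0.
Let mO : measurable Omega. Proof. exact: open_measurable_row. Qed.

Let cut_continuous (h f : V -> R) : continuous h -> (forall x, ~ Omega x -> \forall y \near x,
    h y = 0) ->
  cont_on Omega f -> continuous (fun x => h x * f x).
Proof.
move=> ch h0 cf x; have [Ox|nO] := pselect (Omega x).
  by apply: cont_mul; [exact: ch|exact: (cont_on_open oOmega cf Ox)].
have hh : \forall y \near x, 0 = h y * f y by apply: filterS (h0 x nO) => y ->; rewrite mul0r.
rewrite /continuous_at -(nbhs_singleton hh).
by apply: cvg_trans (near_eq_cvg hh) _; exact: cvg_cst.
Qed.

(** The product [eta * f], extended by 0, is differentiable on the whole space and supported in a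
    box, so the integral of its derivative vanishes. Nothing is asked of [f] or [df] at the
    boundary. *)
Lemma cutoff_parts (f df : V -> R) i : cont_on Omega f -> cont_on Omega df ->
  (forall x, Omega x -> is_derive x (delta_mx 0 i) f (df x)) ->
  [/\ leb.-integrable Omega (EFin \o (fun x => eta x * df x)),
      leb.-integrable Omega (EFin \o (fun x => 'D_(delta_mx 0 i) eta x * f x))
    & \int[leb]_(x in Omega) (eta x * df x) =
      - \int[leb]_(x in Omega) ('D_(delta_mx 0 i) eta x * f x)].
Proof.
move=> cf cdf fd; set D := 'D_(delta_mx 0 i) eta.
have cD : continuous D by case: C1eta => _ /(_ (delta_mx 0 i))[].
have D0 x : ~ Omega x -> \forall y \near x, D y = 0.
  move=> /eta0 /nbhs_interior; apply: filterS => y; exact: derive_zero_near.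
have c1 := cut_continuous C1eta.1 eta0 cdf.
have c2 := cut_continuous cD D0 cf.
have i1 : leb.-integrable Omega (EFin \o (fun x => eta x * df x)).
  by apply: cont_integrable_domain => //; exact: continuous_cont_onT.
have i2 : leb.-integrable Omega (EFin \o (fun x => D x * f x)).
  by apply: cont_integrable_domain => //; exact: continuous_cont_onT.
split => //; apply/eqP; rewrite eq_sym -subr_eq0 -opprD oppr_eq0; apply/eqP.
rewrite -RintegralD//.
pose g x := eta x * f x.
have gd x : is_derive x (delta_mx 0 i) g (D x * f x + eta x * df x).
  have [Ox|nO] := pselect (Omega x).
    have := is_deriveM (C1_is_derive x (delta_mx 0 i) C1eta) (fd x Ox).
    by move/is_derive_eq; apply; rewrite addrC /GRing.scale /= (mulrC (f x)).
  apply: (@near_eq_is_derive _ _ _ (cst 0)).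
    by apply: filterS (eta0 nO) => y; rewrite /g => ->; rewrite mul0r.
  rewrite (nbhs_singleton (eta0 nO)) (nbhs_singleton (D0 x nO)) !mul0r addr0.
  exact: is_derive_cst.
have gdE : 'D_(delta_mx 0 i) g = (fun x => D x * f x + eta x * df x).
  by apply/funext => x; have [_] := gd x.
have [r r0 Or] := bounded_subset_box bOmega.
have <- : \int[leb]_x 'D_(delta_mx 0 i) g x = 0.
  apply: (@integral_derive0 R m.+1 g (delta_mx 0 i) r) => [x| |  |x nb].
  - by have [] := gd x.
  - exact: (cut_continuous C1eta.1 eta0 cf).
  - by rewrite gdE => x; apply: cont_add; [exact: c2|exact: c1].
  - have nO : ~ Omega x by move=> /Or.
    by rewrite /g (nbhs_singleton (eta0 nO)) mul0r.
rewrite gdE [LHS]Rintegral_mkcond; apply: eq_Rintegral => x _; rewrite /patch.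
case: ifPn => // /negP nO; have {}nO : ~ Omega x by move=> Ox; apply: nO; rewrite inE.
by rewrite (nbhs_singleton (eta0 nO)) (nbhs_singleton (D0 x nO)) !mul0r addr0.
Qed.

End cutoff_parts.

Lemma C2_closure_derive_cont {R : realType} {V : normedModType R} (U : set V) (f : V -> R) u p :
  open U -> C2_closure U f -> U p -> {for p, continuous ('D_u f)}.
Proof.
move=> oU [_ _ ef _ _] Up; apply: cvg_continuous_at.
have /cvg_ex[l hl] := ef u p (subset_closure Up); apply/cvg_ex; exists l => B /hl hB.
have hU : nbhs p U by exact: open_nbhs_nbhs.
have hh : nbhs p (fun y => U y /\ (U y -> B ('D_u f y))) by apply: filterI.
by apply: filterS hh => y [Uy]; apply.
Qed.

Lemma sum_delta {R : pzRingType} n (f : 'I_n.+1 -> R) : \sum_i f i * (i == ord0)%:R = f ord0.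
Proof.
rewrite (bigD1 ord0)// eqxx mulr1 big1 => [|i /negPf ->]; last exact: mulr0.
exact: addr0.
Qed.

Section flux.
Context {R : realType} {m : nat}.
Local Notation V := ('rV[R]_m.+1).
Variables (Omega : set V) (S : system R m) (phi : R -> R) (d0 d1 : R).
Hypotheses (oOmega : open Omega) (hS : system_C2 Omega S) (hphi : orlicz_density phi d0 d1).
Variables (w0 : V -> R) (d f w : V * R -> R).
Hypothesis hw : classical_solution Omega S w0 d f w.
Variables (e theta : R).
Hypothesis e0 : 0 < e.

Let U : set (V * R) := cylinder Omega.
Let oU : open U. Proof. exact: open_cylinder. Qed.
Let Ucl : U `<=` closed_cylinder Omega.
Proof. by move=> [x t] [/= Ox t0]; split => /=; [exact: subset_closure|exact: ltW]. Qed.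

Local Notation a := (sys_a S).
Local Notation b i := (fun p => sys_b S p 0 i).
Local Notation wd i := ('D_(dx i) w).

(** The derivative of [w] extended by limits to the lateral boundary, as in [normal_derivative];
    this gives the flux a meaning there. *)
Definition space_grad (i : 'I_m.+1) (p : V * R) : R := limit_from (cylinder Omega) (wd i) p.

(* The last summand is the Robin-Poincare term. *)
Definition flux (i : 'I_m.+1) (p : V * R) : R :=
  dreg phi e (w p) * (a p * space_grad i p) - reg phi e (w p) * sys_b S p 0 i
  + theta * (p.1 0 ord0 * reg phi e (w p)) * (i == ord0)%:R.

(** Meant in the open cylinder only: the first term contains second derivatives of [w], which have
    no boundary values. *)
Definition dflux (i : 'I_m.+1) (p : V * R) : R :=
  dreg phi e (w p) * 'D_(dx i) (fun p => (a p *: grad w p) 0 i) p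
  + ddreg phi e (w p) * (a p * wd i p ^+ 2)
  - (reg phi e (w p) * 'D_(dx i) (b i) p + dreg phi e (w p) * (sys_b S p 0 i * wd i p))
  + theta * (reg phi e (w p) + p.1 0 ord0 * (dreg phi e (w p) * wd i p)) * (i == ord0)%:R.

Let aC2 : C2_closure U a. Proof. by case: hS => h _ _ _ _; exact: h. Qed.
Let bC2 i : C2_closure U (b i). Proof. by case: hS => _ h _ _ _; exact: h. Qed.
Let wC21 : C21 U w. Proof. by case: hw => -[h _ _] _; exact: h. Qed.

Lemma solution_cont_on : cont_on (closed_cylinder Omega) w.
Proof. by case: hw => -[_ /within_continuousP h _] _; exact: h. Qed.

Lemma solution_continuous p : U p -> {for p, continuous w}.
Proof. by case: wC21 => h _ _ _ Up; exact: h. Qed.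

Lemma solution_dx i p : U p -> is_derive p (dx i) w (wd i p).
Proof. by case: wC21 => _ _ h _ /(h i)[hd _]; exact: derivableP. Qed.

Lemma solution_dt p : U p -> is_derive p dt w ('D_dt w p) /\ {for p, continuous ('D_dt w)}.
Proof. by case: wC21 => _ h _ _ /h[hd hc]; split => //; exact: derivableP. Qed.

Lemma solution_dx_continuous i p : U p -> {for p, continuous (wd i)}.
Proof. by case: wC21 => _ _ h _ Up; have [_ hc] := h i p Up; exact: hc. Qed.

Lemma space_grad_in i p : U p -> space_grad i p = wd i p.
Proof. by move=> Up; rewrite /space_grad limit_from_in//; exact: solution_dx_continuous. Qed.

Lemma space_grad_cont_on i : cont_on (closure Omega `*` [set t : R | 0 < t]) (space_grad i).
Proof.
have h : cont_on (U `|` (bdry Omega `*` [set t : R | 0 < t])) (space_grad i).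
  apply: limit_from_continuous => //.
  - move=> [x t] [/= [cx _] t0]; apply: closed_cylinder_closure; split => //=; exact: ltW.
  - by move=> p; exact: solution_dx_continuous.
  - by case: hw => -[_ _ h] _; exact: h.
apply: cont_onW h => -[x t] [/= cx t0]; have [Ox|nO] := pselect (Omega x); [by left|right].
by split => //=; apply/(bdryE oOmega).
Qed.

Let pos_closed : closure Omega `*` [set t : R | 0 < t] `<=` closed_cylinder Omega.
Proof. by move=> [x t] [/= cx t0]; split => //=; exact: ltW. Qed.

Let coord_cont_on (A : set (V * R)) : cont_on A (fun p : V * R => p.1 0 ord0).
Proof.
apply: continuous_cont_onT => p.
apply: (@cont_comp _ _ _ (fun p : V * R => p.1) (fun x : V => x 0 ord0));
    last exact: row_coord_continuous.
exact: cvg_fst.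
Qed.

Lemma cont_on_solution (A : set (V * R)) (g : R -> R) : A `<=` closed_cylinder Omega ->
  continuous g -> cont_on A (fun p => g (w p)).
Proof.
move=> AU cg; apply: (@cont_on_comp _ _ _ A setT w g); [exact: continuous_cont_onT| |by []].
exact: cont_onW AU solution_cont_on.
Qed.

Lemma flux_cont_on i : cont_on (closure Omega `*` [set t : R | 0 < t]) (flux i).
Proof.
have cP := cont_on_solution pos_closed (@reg_continuous _ _ _ _ hphi _ e0).
have cp := cont_on_solution pos_closed (@dreg_continuous _ _ _ _ hphi _ e0).
have ca := cont_onW pos_closed (C2_closure_cont_on aC2).
have cb := cont_onW pos_closed (C2_closure_cont_on (bC2 i)).
apply: cont_on_add.
  apply: cont_on_sub; apply: cont_on_mul => //.
  by apply: cont_on_mul => //; exact: space_grad_cont_on.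
apply: cont_on_mul; last exact: cont_on_cst.
apply: cont_on_mul; first exact: cont_on_cst.
by apply: cont_on_mul.
Qed.

Let wcoord p i : is_derive p (dx i) (fun p : V * R => p.1 0 ord0) ((i == ord0)%:R : R).
Proof.
apply: is_derive_affine => s /=; rewrite !mxE /=.
by rewrite eq_sym.
Qed.

Let adiff p i : U p -> is_derive p (dx i) (fun p => (a p *: grad w p) 0 i)
   (a p * 'D_(dx i) (wd i) p + wd i p * 'D_(dx i) a p).
Proof.
move=> Up; have -> : (fun p => (a p *: grad w p) 0 i) = a * wd i by apply/funext => q; rewrite !mxE.
have ha : is_derive p (dx i) a ('D_(dx i) a p) by case: aC2 => _ /(_ (dx i) p Up) ? _ _ _;
    exact: derivableP.
have hd : is_derive p (dx i) (wd i) ('D_(dx i) (wd i) p).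
  by case: wC21 => _ _ _ /(_ i i p Up)[? _]; exact: derivableP.
by have := is_deriveM ha hd.
Qed.

Lemma flux_derive i p : U p -> is_derive p (dx i) (flux i) (dflux i p).
Proof.
move=> Up.
have hg := solution_dx i Up.
have hP := is_derive_comp hg (reg_derive hphi (w p) e0).
have hp := is_derive_comp hg (dreg_derive hphi (w p) e0).
have hb : is_derive p (dx i) (b i) ('D_(dx i) (b i) p).
  by case: (bC2 i) => _ /(_ (dx i) p Up) ? _ _ _; exact: derivableP.
have hA : is_derive p (dx i) (fun p => a p * wd i p) ('D_(dx i) (fun p => (a p *: grad w p) 0 i) p).
  have h := adiff i Up; have [_ ->] := h; move: h; congr (is_derive _ _ _ _).
  by apply/funext => q; rewrite !mxE.
(* Inside, the extended gradient is the gradient, so near [p] the flux is a product of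
   differentiable functions. *)
pose flux' := fun q => dreg phi e (w q) * (a q * wd i q) - reg phi e (w q) * sys_b S q 0 i
  + theta * (q.1 0 ord0 * reg phi e (w q)) * (i == ord0)%:R.
apply: (@near_eq_is_derive _ _ _ flux').
  have : nbhs p U by exact: open_nbhs_nbhs.
  by apply: filterS => q Uq; rewrite /flux space_grad_in.
have h1 := is_deriveM hp hA.
have h2 := is_deriveM hP hb.
have h3 := is_deriveM (is_derive_cst theta p (dx i)) (is_deriveM (wcoord p i) hP).
have h4 := is_deriveM h3 (is_derive_cst ((i == ord0)%:R : R) p (dx i)).
have := is_deriveD (is_deriveB h1 h2) h4.
move/is_derive_eq; apply; rewrite /dflux /GRing.scale /=.
rewrite !mulr0 !addr0 add0r.
case: (i == ord0); rewrite ?mulr0 ?mul0r ?addr0 ?mul1r ?mulr1.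
  rewrite /comp; move: ('D_(dx i) _ p) (reg _ _ _) (dreg _ _ _) (ddreg _ _ _) (a p) (wd i p)
      (sys_b S p 0 i) ('D_(dx i) (b i) p) (p.1 0 ord0).
  move=> z1 z2 z3 z4 z5 z6 z7 z8 z9; ring.
rewrite /comp; move: ('D_(dx i) _ p) (reg _ _ _) (dreg _ _ _) (ddreg _ _ _) (a p) (wd i p) (sys_b
    S p 0 i) ('D_(dx i) (b i) p).
move=> z1 z2 z3 z4 z5 z6 z7 z8; ring.
Qed.

Lemma dflux_continuous i p : U p -> {for p, continuous (dflux i)}.
Proof.
move=> Up.
have cw := solution_continuous Up.
have cP : continuous_at p (fun p => reg phi e (w p)).
  by apply: (@cont_comp _ _ _ w (reg phi e)) => //; exact: (reg_continuous hphi).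
have cp : continuous_at p (fun p => dreg phi e (w p)).
  by apply: (@cont_comp _ _ _ w (dreg phi e)) => //; exact: (dreg_continuous hphi).
have cdp : continuous_at p (fun p => ddreg phi e (w p)).
  by apply: (@cont_comp _ _ _ w (ddreg phi e)) => //; exact: (ddreg_continuous hphi).
have cwd := @solution_dx_continuous i p Up.
have ca : {for p, continuous a} by exact: cont_on_open oU (cont_onW Ucl (C2_closure_cont_on aC2))
    Up.
have cb : {for p, continuous (b i)} by exact: cont_on_open oU (cont_onW Ucl (C2_closure_cont_on
    (bC2 i))) Up.
have cdb : {for p, continuous ('D_(dx i) (b i))} by exact: C2_closure_derive_cont oU (bC2 i) Up.
have cda : {for p, continuous ('D_(dx i) a)} by exact: C2_closure_derive_cont oU aC2 Up.
have cdd : {for p, continuous ('D_(dx i) (wd i))} by case: wC21 => _ _ _ /(_ i i p Up)[].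
have cA : continuous_at p ('D_(dx i) (fun p => (a p *: grad w p) 0 i)).
  have h : \forall q \near p, a q * 'D_(dx i) (wd i) q + wd i q * 'D_(dx i) a q = 'D_(dx i) (fun
      p => (a p *: grad w p) 0 i) q.
    have : nbhs p U by exact: open_nbhs_nbhs.
    by apply: filterS => q Uq; have [_ ->] := adiff i Uq.
  rewrite /continuous_at -(nbhs_singleton h).
  apply: cvg_trans (near_eq_cvg h) _.
  by apply: (@cont_add R _ (fun q => a q * 'D_(dx i) (wd i) q) (fun q =>
      wd i q * 'D_(dx i) a q)); apply: cont_mul.
have cx : continuous_at p (fun p : V * R => p.1 0 ord0).
  apply: (@cont_comp _ _ _ (fun p : V * R => p.1) (fun x : V => x 0 ord0));
      last exact: row_coord_continuous.
  exact: cvg_fst.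
apply: cont_add.
  apply: cont_sub.
    apply: cont_add; first exact: cont_mul.
    apply: cont_mul => //; apply: cont_mul => //.
    have -> : (fun q => wd i q ^+ 2) = (fun q => wd i q * wd i q) by apply/funext => q;
        rewrite expr2.
    exact: cont_mul.
  by apply: cont_add; apply: cont_mul => //; exact: cont_mul.
apply: cont_mul; last exact: cont_cst.
apply: cont_mul; first exact: cont_cst.
by apply: cont_add => //; apply: cont_mul => //; exact: cont_mul.
Qed.

Lemma sum_dflux p : \sum_i dflux i p =
  dreg phi e (w p) * div (fun q => a q *: grad w q) p
  + ddreg phi e (w p) * (a p * \sum_i wd i p ^+ 2)
  - reg phi e (w p) * div (sys_b S) p - dreg phi e (w p) * dotp (sys_b S p) (grad w p)
  + theta * reg phi e (w p) + theta * p.1 0 ord0 * (dreg phi e (w p) * wd ord0 p).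
Proof.
rewrite /dflux !big_split /= -!mulr_sumr sumrN big_split /= -!mulr_sumr.
have -> : \sum_i theta * (reg phi e (w p) + p.1 0 ord0 * (dreg phi e (w p) * wd i p)) * (i ==
    ord0)%:R
  = theta * (reg phi e (w p) + p.1 0 ord0 * (dreg phi e (w p) * wd ord0 p)).
  exact: (@sum_delta _ _ (fun i => theta * (reg phi e (w p) + p.1 0 ord0 * (dreg phi e (w p) * wd
      i p)))).
have -> : \sum_i sys_b S p 0 i * wd i p = dotp (sys_b S p) (grad w p).
  by apply: eq_bigr => i _; rewrite mxE.
have aux (p1 D z1 p2 z2 P B th x g : R) :
  p1 * D + p2 * z1 - (P * z2 + p1 * B) + th * (P + x * (p1 * g)) =
  p1 * D + p2 * z1 - P * z2 - p1 * B + th * P + th * x * (p1 * g) by ring.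
exact: aux.
Qed.

Variables (clo alo rho : R) (mu : V * R -> R).
Hypotheses (clo0 : 0 < clo) (alo0 : 0 < alo) (haa : forall p,
    U p -> alo <= a p) (theta0 : 0 < theta)
  (hth : theta * (rho ^+ 2 * (1 + d1) / (4 * alo * Num.min d0 1)) <= 2^-1)
  (hrho : forall x : V, closure Omega x -> `|x 0 ord0| <= rho)
  (hmu : forall p s eta, U p -> - sys_h S (p, s, eta) * s <= mu p * s ^+ 2)
  (hc : forall p, U p -> clo <= sys_c S p - mu p - Num.max (div (sys_b S) p / (1 + d0))
                                      (div (sys_b S) p / (1 + d1))).

Lemma solution_interior p : U p ->
  clo * (1 + d0) * reg phi e (w p) + dreg phi e (w p) * 'D_dt w p <=
  \sum_i dflux i p + young_constant d1 (theta / 2) * orlicz_primitive phi `|f p|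
  + e * (`|sys_c S p - mu p| * phi (regabs e (w p))).
Proof.
move=> Up; rewrite sum_dflux.
have hx : `|p.1 0 ord0| <= rho by apply: hrho; case: Up => Ox _; exact: subset_closure.
have hg : wd ord0 p ^+ 2 <= \sum_i wd i p ^+ 2.
  by rewrite (bigD1 ord0)//= lerDl sumr_ge0// => i _; rewrite sqr_ge0.
have -> : 'D_dt w p = div (fun q => a q *: grad w q) p - dotp (sys_b S p) (grad w p) - sys_c S p
    * w p
    - sys_h S (p, w p, grad w p) + f p.
  by case: hw => _ [/(_ p Up) <- _ _]; move: (div _ p) => z; ring.
exact: (interior_ineq hphi e0 _ _ _ clo0 alo0 (haa Up) theta0 hth hx hg (hc Up) (hmu _ _ Up)).
Qed.

Variable (psilo : R).
Hypotheses (psilo0 : 0 < psilo) (hth2 : theta * rho <= psilo * (1 + d0) / 2)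
  (hpsi : condA32 Omega S d0 d1 psilo) (nu1 : forall x i,
      bdry Omega x -> `|outer_normal Omega x 0 i| <= 1).

(** The Robin condition replaces the conormal derivative in the flux by [d - psi], and the infimum
    in (A3-2') is bounded by its member at [s = w (x, t)] when this value is nonzero. *)
Lemma solution_boundary x t : bdry Omega x -> 0 < t ->
  \sum_i flux i (x, t) * outer_normal Omega x 0 i <=
  young_constant d1 (psilo * (1 + d0) / 2) * orlicz_primitive phi `|d (x, t)|
  + e * ((psilo + `|dotp (sys_b S (x, t)) (outer_normal Omega x)|) * phi (regabs e (w (x, t)))).
Proof.
move=> bx t0; set W := w (x, t); set bnu := dotp _ _.
have -> : \sum_i flux i (x, t) * outer_normal Omega x 0 i =
  dreg phi e W * (a (x, t) * normal_derivative Omega w (x, t)) - reg phi e W * bnu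
  + theta * x 0 ord0 * reg phi e W * outer_normal Omega x 0 ord0.
  have E i : flux i (x, t) * outer_normal Omega x 0 i =
     dreg phi e W * (a (x, t) * (space_grad i (x, t) * outer_normal Omega x 0 i))
     + - (reg phi e W * (sys_b S (x, t) 0 i * outer_normal Omega x 0 i))
     + theta * x 0 ord0 * reg phi e W * (outer_normal Omega x 0 i * (i == ord0)%:R).
    rewrite /flux /= -/W; move: (space_grad i _) (sys_b S _ 0 i) (a _) (reg _ _ _) (dreg _ _ _)
        (outer_normal _ _ _ _) (_%:R).
    by move=> z1 z2 z3 z4 z5 z6 z7; ring.
  rewrite (eq_bigr _ (fun i _ => E i)) !big_split /= sumrN -!mulr_sumr.
  by congr (_ + _ * _); exact: (@sum_delta _ _ (fun i => outer_normal Omega x 0 i)).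
have hd : a (x, t) * normal_derivative Omega w (x, t) + sys_psi S (x, t, W) = d (x, t).
  by case: hw => _ [_ /(_ x t bx t0) <- _].
have hx : `|x 0 ord0| <= rho by apply: hrho; case: bx.
apply: (boundary_ineq hphi e0 (psi := sys_psi S (x, t,
    W)) psilo0 theta0 _ hx (nu1 _ bx) hth2 hd) => W0.
have [_ /(_ x t bx t0)[hE hi]] := hpsi; apply: (le_trans hi).
apply: ge_inf; first by case: hE.
by exists W.
Qed.

End flux.

Lemma Rintegral_sumr {d} {T : measurableType d} {R : realType} (mu : {measure set T -> \bar R})
    (D : set T) (I : Type) (r : seq I) (f : I -> T -> R) : measurable D ->
  (forall i, mu.-integrable D (EFin \o f i)) ->
  mu.-integrable D (EFin \o (fun x => \sum_(i <- r) f i x)) /\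
  \int[mu]_(x in D) (\sum_(i <- r) f i x) = \sum_(i <- r) \int[mu]_(x in D) f i x.
Proof.
move=> mD fi; elim: r => [|i r [IH1 IH2]].
  rewrite big_nil; split.
    have -> : EFin \o (fun x => \sum_(i <- [::]) f i x) = cst 0%E by apply/funext => x;
        rewrite /= big_nil.
    exact: integrable0.
  rewrite (@eq_Rintegral _ _ _ _ _ (cst 0)) ?Rintegral_cst ?mul0r// => x _.
  by rewrite big_nil.
have E : (fun x => \sum_(j <- i :: r) f j x) = (fun x => f i x + \sum_(j <- r) f j x).
  by apply/funext => x; rewrite big_cons.
rewrite E big_cons; split; first exact: integrable_addR.
by rewrite RintegralD// IH2.
Qed.

Lemma cont_on_itv_integrable {R : realType} (s T : R) (f : R -> R) :
  cont_on [set t : R | s <= t <= T] f -> lebesgue_measure.-integrable `[s, T] (EFin \o f).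
Proof.
move=> cf; apply: continuous_compact_integrable; first exact: segment_compact.
by apply/within_continuousP; move: cf; congr (cont_on _ _); apply/seteqP; split => x;
    rewrite /= in_itv.
Qed.

Lemma le_Rintegral_itv {R : realType} (s T : R) (f : R -> R) : 0 <= s <= T ->
  cont_on [set t : R | 0 <= t <= T] f -> (forall t, 0 <= t <= T -> 0 <= f t) ->
  \int[lebesgue_measure]_(t in `[s, T]) f t <= \int[lebesgue_measure]_(t in `[0, T]) f t.
Proof.
move=> /andP[s0 sT] cf f0.
have i0 := cont_on_itv_integrable cf.
have i1 : lebesgue_measure.-integrable `]s, T] (EFin \o f).
  apply: integrableS i0 => //; last first.
    by move=> t; rewrite /= !in_itv /= => /andP[st ->]; rewrite (le_trans s0 (ltW st)).
have B := @Rintegral_itvB R f (BLeft 0) (BRight T) s i0 s0 sT.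
rewrite -(Rintegral_itv_obnd_cbnd i1) -B lerBlDr lerDl.
apply: Rintegral_ge0 => t; rewrite /= in_itv /= => /andP[t0 ts].
by apply: f0; rewrite t0 (le_trans ts).
Qed.

Section energy.
Context {R : realType} {m : nat}.
Local Notation V := ('rV[R]_m.+1).
Implicit Types (s t : R) (x : V).
Variables (Omega : set V) (sigma : {measure set V -> \bar R}) (S : system R m)
  (phi : R -> R) (d0 d1 : R).
Hypotheses (hO : smooth_bounded_domain Omega) (hs : is_surface_measure Omega sigma)
  (hS : system_C2 Omega S) (hphi : orlicz_density phi d0 d1).
Variables (w0 : V -> R) (d f w : V * R -> R).
Hypotheses (hd : C2_closure (cylinder Omega) d) (hf : C2_closure (cylinder Omega) f)
  (hw : classical_solution Omega S w0 d f w).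
Variables (e theta clo alo rho psilo : R) (mu : V * R -> R).
Hypotheses (e0 : 0 < e) (e1 : e <= 1) (clo0 : 0 < clo) (alo0 : 0 < alo)
  (haa : forall p, cylinder Omega p -> alo <= sys_a S p) (theta0 : 0 < theta)
  (hth : theta * (rho ^+ 2 * (1 + d1) / (4 * alo * Num.min d0 1)) <= 2^-1)
  (hrho : forall x : V, closure Omega x -> `|x 0 ord0| <= rho)
  (hmu : forall p s eta, cylinder Omega p -> - sys_h S (p, s, eta) * s <= mu p * s ^+ 2)
  (hc : forall p, cylinder Omega p -> clo <= sys_c S p - mu p -
     Num.max (div (sys_b S) p / (1 + d0)) (div (sys_b S) p / (1 + d1)))
  (psilo0 : 0 < psilo) (hth2 : theta * rho <= psilo * (1 + d0) / 2)
  (hpsi : condA32 Omega S d0 d1 psilo).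
(** The constant [K] bounds the factors of [e] in the interior and in the boundary inequality. It
    does so for all [e <= 1] at once, because [regabs e s <= |s| + 1]. *)
Variables (K T : R).
Hypothesis hK : forall x t, closure Omega x -> 0 <= t <= T ->
  (`|sys_c S (x, t) - mu (x, t)| + psilo + \sum_i `|sys_b S (x, t) 0 i|) * phi (`|w (x,
      t)| + 1) <= K.

Local Notation Phi := (orlicz_primitive phi).
Local Notation leb := (lebesgue_row R m.+1).
Local Notation lam := (clo * (1 + d0)).
Local Notation Y1 := (young_constant d1 (theta / 2)).
Local Notation Y2 := (young_constant d1 (psilo * (1 + d0) / 2)).
Local Notation F i := (flux Omega S phi w e theta i).

Let oOmega : open Omega. Proof. by case: hO. Qed.
Let bOmega : bounded_set Omega. Proof. by case: hO. Qed.
Let mO : measurable Omega. Proof. exact: open_measurable_row. Qed.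
Let mbd : measurable (bdry Omega).
Proof. by apply: closed_measurable_row; exact: closed_bdry. Qed.
Let fO : (leb Omega < +oo)%E. Proof. exact: domain_finite. Qed.
Let fB : (sigma (bdry Omega) < +oo)%E. Proof. exact: (bdry_finite hO hs). Qed.
Let cO : compact (closure Omega). Proof. exact: compact_closure_domain. Qed.
Let Ocl : Omega `<=` closure Omega. Proof. exact: subset_closure. Qed.
Let Bcl : bdry Omega `<=` closure Omega. Proof. by move=> x []. Qed.

Let CI (s t : R) : set (V * R) := closure Omega `*` [set u : R | s <= u <= t].

Let CIpos s t : 0 < s -> CI s t `<=` closure Omega `*` [set u : R | 0 < u].
Proof. by move=> s0 [x u] [/= cx /andP[su _]]; split => //=; exact: lt_le_trans su. Qed.

Let CIcl s t : 0 <= s -> CI s t `<=` closed_cylinder Omega.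
Proof. by move=> s0 [x u] [/= cx /andP[su _]]; split => //=; exact: le_trans su. Qed.

(** A real integral where [modular] is extended-valued. For data continuous up to the boundary the
    two agree, see [boundary_modular] and [domain_modular]. *)
Definition modular_time (nu : {measure set V -> \bar R}) (A : set V) (v : V * R -> R) (t : R) : R :=
  \int[nu]_(x in A) Phi `|v (x, t)|.

Local Notation md := (modular_time sigma (bdry Omega) d).
Local Notation mf := (modular_time leb Omega f).

Let PhiC2 v s t : 0 <= s -> C2_closure (cylinder Omega) v -> cont_on (CI s t) (fun p => Phi `|v p|).
Proof.
move=> s0 hv; apply: (@cont_on_comp _ _ _ (CI s t) setT v (fun r => Phi `|r|)) => //.
  by apply: continuous_cont_onT; exact: (primitive_abs_continuous hphi).
by apply: cont_onW (C2_closure_cont_on hv); exact: CIcl.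
Qed.

Lemma mf_cont s t : 0 <= s -> s <= t -> cont_on [set u : R | s <= u <= t] mf.
Proof. by move=> s0 st; apply: (param_cont (F := fun p => Phi `|f p|) mO fO Ocl cO st);
    exact: PhiC2. Qed.

Lemma md_cont s t : 0 <= s -> s <= t -> cont_on [set u : R | s <= u <= t] md.
Proof. by move=> s0 st; apply: (param_cont (F := fun p => Phi `|d p|) mbd fB Bcl cO st);
    exact: PhiC2. Qed.

Lemma modular_time_ge0 nu A v t : 0 <= modular_time nu A v t.
Proof. by apply: Rintegral_ge0 => x _; exact: (primitive_ge0 hphi). Qed.

Let K0 : forall t, 0 <= t <= T -> 0 <= K.
Proof.
move=> t tT; have [x Ox] : Omega !=set0 by case: hO.
apply: le_trans (hK (Ocl Ox) tT); apply: mulr_ge0.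
  by rewrite !addr_ge0 ?(ltW psilo0)// sumr_ge0.
by apply: (density_ge0 hphi); rewrite addr_ge0.
Qed.

Let phi_regabs s : phi (regabs e s) <= phi (`|s| + 1).
Proof.
apply: (density_homo hphi); first exact: sqrtr_ge0.
by apply: (le_trans (regabs_le s e0)); rewrite lerD2l.
Qed.

Let hK1 x t : closure Omega x -> 0 <= t <= T ->
  `|sys_c S (x, t) - mu (x, t)| * phi (regabs e (w (x, t))) <= K.
Proof.
move=> cx tT; apply: le_trans (hK cx tT).
apply: ler_pM => //; first by apply: (density_ge0 hphi); exact: sqrtr_ge0.
by rewrite -addrA lerDl addr_ge0 ?(ltW psilo0)// sumr_ge0.
Qed.

Let nu1 x i : bdry Omega x -> `|outer_normal Omega x 0 i| <= 1.
Proof.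
move=> bx; rewrite -(@expr_le1 _ 2)// real_normK ?num_real//.
by apply: (le_trans (coord_dotp _ i)); rewrite (outer_normal_unit hO bx).
Qed.

Let hK2 x t : bdry Omega x -> 0 <= t <= T ->
  (psilo + `|dotp (sys_b S (x, t)) (outer_normal Omega x)|) * phi (regabs e (w (x, t))) <= K.
Proof.
move=> bx tT; apply: le_trans (hK (Bcl bx) tT).
apply: ler_pM => //; [by rewrite addr_ge0// ltW|by apply: (density_ge0 hphi); exact: sqrtr_ge0|].
rewrite -addrA; apply: (@le_trans _ _ (psilo + \sum_i `|sys_b S (x, t) 0 i|));
    last by rewrite lerDr.
rewrite lerD2l; apply: (le_trans (ler_norm_sum _ _ _)); apply: ler_sum => i _.
by rewrite normrM ler_piMr// nu1.
Qed.

Section cutoff.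
Variable eta : V -> R.
Hypotheses (C1eta : C1 eta) (eta01 : forall x, 0 <= eta x <= 1)
  (eta0 : forall x, ~ Omega x -> \forall y \near x, eta y = 0).

(** The divergence is already integrated by parts: no second derivative of [w] remains, only the
    flux against the gradient of the cutoff, which has a limit. *)
Definition cut_rate (t : R) : R :=
  expR (lam * t) * (- (\sum_i \int[leb]_(x in Omega) ('D_(delta_mx 0 i) eta x * F i (x, t)))
   + Y1 * mf t + e * K * fine (leb Omega)).

Let ceta_fst A : cont_on A (fun p : V * R => eta p.1).
Proof.
apply: continuous_cont_onT => p; apply: (@cont_comp _ _ _ (fun p : V * R => p.1) eta);
    first exact: cvg_fst.
exact: C1eta.1.
Qed.

Let cexp_snd p : {for p, continuous (fun p : V * R => expR (lam * p.2))}.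
Proof.
apply: (@cont_comp _ _ _ (fun p : V * R => lam * p.2) expR); last exact: continuous_expR.
by apply: cont_mul; [exact: cont_cst|exact: cvg_snd].
Qed.

Let cexp : continuous (fun t : R => expR (lam * t)).
Proof.
move=> t; apply: (@cont_comp _ _ _ (fun t : R => lam * t) expR); last exact: continuous_expR.
by apply: cont_mul; [exact: cont_cst|exact: cvg_id].
Qed.

Lemma cut_flux_cont i s t : 0 < s -> cont_on (CI s t) (fun p => 'D_(delta_mx 0 i) eta p.1 * F i p).
Proof.
move=> s0; apply: cont_on_mul; last first.
  by apply: (cont_onW (@CIpos s t s0)); exact: (flux_cont_on oOmega hS hphi hw).
apply: continuous_cont_onT => p.
apply: (@cont_comp _ _ _ (fun p : V * R => p.1) ('D_(delta_mx 0 i) eta)); first exact: cvg_fst.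
by case: C1eta => _ /(_ (delta_mx 0 i))[].
Qed.

Lemma cut_rate_cont s t : 0 < s -> s <= t -> cont_on [set u : R | s <= u <= t] cut_rate.
Proof.
move=> s0 st; apply: cont_on_mul; first by apply: continuous_cont_onT.
apply: cont_on_add; last exact: cont_on_cst.
apply: cont_on_add; last by apply: cont_on_mul; [exact: cont_on_cst|exact: (mf_cont (ltW s0))].
rewrite (_ : (fun z => - _) = (fun z : R => 0 - \sum_i \int[leb]_(y in Omega) ('D_(delta_mx 0 i)
    eta y * F i (y, z)))); last first.
  by apply/funext => z; rewrite sub0r.
apply: cont_on_sub; first exact: cont_on_cst.
apply: cont_on_sum => i; apply: (param_cont (F := fun p =>
    'D_(delta_mx 0 i) eta p.1 * F i p) mO fO Ocl cO st).
exact: cut_flux_cont.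
Qed.

(** The weight [exp (lam t)] makes the time derivative of the density proportional to
    [lam P(w) + P'(w) w_t], to which [solution_interior] applies pointwise. Starting at [s > 0] is
    due to the flux, which is continuous up to the boundary for positive times only. *)
Lemma cut_energy s : 0 < s -> s < T ->
  \int[leb]_(x in Omega) (eta x * (expR (lam * T) * reg phi e (w (x, T)))) -
  \int[leb]_(x in Omega) (eta x * (expR (lam * s) * reg phi e (w (x, s)))) <=
  \int[lebesgue_measure]_(t in `[s, T]) cut_rate t.
Proof.
move=> s0 sT.
pose Q (p : V * R) := eta p.1 * (expR (lam * p.2) * reg phi e (w p)).
pose G (p : V * R) := eta p.1 * (expR (lam * p.2) * (lam * reg phi e (w p) + dreg phi e (w p) *
    'D_dt w p)).
have UO x t : Omega x -> s <= t -> cylinder Omega (x, t).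
  by move=> Ox st; split => //=; exact: lt_le_trans st.
have cQ : cont_on (CI s T) Q.
  apply: cont_on_mul => //; apply: cont_on_mul; first by apply: continuous_cont_onT.
  apply: (cont_on_solution hw); [exact: (CIcl (ltW s0))|exact: (reg_continuous hphi)].
have cG : cont_on (CI s T) G.
  apply: continuous_cont_on => -[x t] [/= cx /andP[st tT]].
  apply: (cutoff_continuous C1eta.1 (@eta0 x)) => Ox.
  have Up := UO x t Ox st.
  apply: (@cont_mul R _ (fun p : V * R => expR (lam * p.2)) (fun p =>
      lam * reg phi e (w p) + dreg phi e (w p) * 'D_dt w p)); first exact: cexp_snd.
  have cw := solution_continuous hw Up.
  apply: (@cont_add R _ (fun p => lam * reg phi e (w p)) (fun p => dreg phi e (w p) * 'D_dt w p)).
    apply: (@cont_mul R _ (fun _ => lam) (fun p => reg phi e (w p))); first exact: cont_cst.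
    by apply: (@cont_comp _ _ _ w (reg phi e)) => //; exact: (reg_continuous hphi).
  apply: (@cont_mul R _ (fun p => dreg phi e (w p)) ('D_dt w));
      last by have [] := solution_dt hw Up.
  by apply: (@cont_comp _ _ _ w (dreg phi e)) => //; exact: (dreg_continuous hphi).
have dQ x t : Omega x -> s < t < T -> is_derive t 1 (fun t => Q (x, t)) (G (x, t)).
  move=> Ox /andP[st tT]; apply: slice_derive_time; have Up := UO x t Ox (ltW st).
  have h1 : is_derive (x, t) dt (fun p : V * R => eta p.1) 0.
    by apply: is_derive_affine => h; rewrite /= scaler0 add0r mulr0 add0r.
  have h2 : is_derive (x, t) dt (fun p : V * R => lam * p.2) lam.
    by apply: is_derive_affine => h; rewrite /= /GRing.scale /= mulr1 mulrDr (mulrC h).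
  have h3 := is_derive_comp h2 (is_derive_expR (lam * t)).
  have [hwt _] := solution_dt hw Up.
  have h4 := is_derive_comp hwt (reg_derive hphi (w (x, t)) e0).
  have := is_deriveM h1 (is_deriveM h3 h4).
  move/is_derive_eq; apply; rewrite /G /GRing.scale /= mulr0 addr0.
  have aux (z1 z2 z3 z4 z5 z6 : R) : z1 * (z2 * (z4 * z5) + z3 * (z2 * z6)) = z1 * (z2 * (z6 * z3
      + z4 * z5)) by ring.
  exact: aux.
have FTC := param_FTC mO fO Ocl cO sT cQ cG dQ.
rewrite [X in X <= _]FTC.
have cEG := param_cont mO fO Ocl cO (ltW sT) cG.
apply: le_Rintegral => //.
- exact: cont_on_itv_integrable.
- by apply: cont_on_itv_integrable; exact: (cut_rate_cont s0 (ltW sT)).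
move=> t; rewrite /= in_itv /= => /andP[st tT].
have t0 := lt_le_trans s0 st.
have t0T : 0 <= t <= T by rewrite ltW.
have It : [set u : R | s <= u <= T] t by rewrite /= st.
pose dF i x := dflux S phi w e theta i (x, t).
have parts i := cutoff_parts oOmega bOmega C1eta eta0 (f := fun x => F i (x,
    t)) (df := dF i) (i := i).
have {}parts i : [/\ leb.-integrable Omega (EFin \o (fun x => eta x * dF i x)),
      leb.-integrable Omega (EFin \o (fun x => 'D_(delta_mx 0 i) eta x * F i (x, t)))
    & \int[leb]_(x in Omega) (eta x * dF i x) =
      - \int[leb]_(x in Omega) ('D_(delta_mx 0 i) eta x * F i (x, t))].
  apply: parts.
  - apply: (cont_onW Ocl); apply: (cont_on_slice (A := closure Omega) (I := [set u : R | 0 < u])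
      (F := F i) t0).
    exact: (flux_cont_on oOmega hS hphi hw).
  - apply: continuous_cont_on => x Ox.
    apply: (@cont_comp _ _ _ (fun x : V => (x, t)) (dflux S phi w e theta i));
        first exact: pair_continuous1.
    by apply: (dflux_continuous oOmega hS hphi hw); [exact: e0|exact: (UO x t Ox st)].
  - by move=> x Ox; apply: slice_derive; apply: (flux_derive oOmega hS hphi hw);
      [exact: e0|exact: (UO x t Ox st)].
have iF : leb.-integrable Omega (EFin \o (fun x => Phi `|f (x, t)|)).
  by apply: (param_integrable (F := fun p => Phi `|f p|) mO fO Ocl cO It);
      exact: (@PhiC2 f s T (ltW s0) hf).
have pi1 i : leb.-integrable Omega (EFin \o (fun x => eta x * dF i x)) by have [] := parts i.
have [iS ES] := Rintegral_sumr (index_enum 'I_m.+1) mO pi1.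
pose B x := Y1 * Phi `|f (x, t)| + e * K.
have iCf : leb.-integrable Omega (EFin \o (fun x => Y1 * Phi `|f (x, t)|)).
  rewrite (_ : EFin \o _ = (fun x => Y1%:E * (Phi `|f (x, t)|)%:E)%E); last by apply/funext => x;
      rewrite /= EFinM.
  exact: integrableZl.
have icst (c : R) : leb.-integrable Omega (EFin \o (fun _ : V => c)).
  by apply: cont_integrable_domain => //; exact: cont_on_cst.
have iB : leb.-integrable Omega (EFin \o B) by exact: integrable_addR.
have iH : leb.-integrable Omega (EFin \o (fun x => \sum_i eta x * dF i x + B x)) by exact:
    integrable_addR.
have -> : cut_rate t = \int[leb]_(x in Omega) (expR (lam * t) * (\sum_i eta x * dF i x + B x)).
  rewrite RintegralZl// RintegralD// ES /B RintegralD// RintegralZl// Rintegral_cst// /cut_rate.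
  have -> : \sum_i \int[leb]_(x in Omega) (eta x * dF i x) =
      - \sum_i \int[leb]_(x in Omega) ('D_(delta_mx 0 i) eta x * F i (x, t)).
    by rewrite -sumrN; apply: eq_bigr => i _; have [] := parts i.
  by rewrite addrA.
apply: le_Rintegral => //.
- exact: (param_integrable mO fO Ocl cO It cG).
- rewrite (_ : EFin \o _ = (fun x => (expR (lam * t))%:E * (\sum_i eta x * dF i x + B x)%:E)%E);
    last by apply/funext => x; rewrite /= EFinM.
  exact: integrableZl.
move=> x Ox; have Up := UO x t Ox st.
rewrite /G /= mulrCA ler_wpM2l ?expR_ge0// -mulr_sumr.
have /andP[et0 et1] := eta01 x.
have B0 : 0 <= B x.
  apply: addr_ge0; apply: mulr_ge0; [|exact: (primitive_ge0 hphi)|exact: ltW|exact: (K0 t0T)].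
  exact: (young_constant_ge0 hphi).
(* The cutoff is dropped from the nonnegative remainder [B] but kept on the divergence, where the
   integration by parts needs it. *)
have aux (z1 z2 z3 : R) : z1 <= 1 -> 0 <= z3 -> z1 * (z2 + z3) <= z1 * z2 + z3.
  by move=> z11 z30; rewrite mulrDr lerD2l ler_piMl.
apply: (@le_trans _ _ (eta x * (\sum_i dF i x + B x))); last exact: aux.
apply: (ler_wpM2l et0).
have := solution_interior hphi hw e0 clo0 alo0 haa theta0 hth hrho hmu hc Up.
rewrite /B addrA; move/le_trans; apply; rewrite lerD2l ler_wpM2l ?(ltW e0)//.
by apply: hK1 => //; exact: Ocl.
Qed.

End cutoff.

Let cexp0 : continuous (fun t : R => expR (lam * t)).
Proof.
move=> t; apply: (@cont_comp _ _ _ (fun t : R => lam * t) expR); last exact: continuous_expR.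
by apply: cont_mul; [exact: cont_cst|exact: cvg_id].
Qed.

Definition total_energy (t : R) : R :=
  \int[leb]_(x in Omega) (expR (lam * t) * reg phi e (w (x, t))).

Definition energy_rate (t : R) : R :=
  expR (lam * t) * (Y2 * md t + Y1 * mf t + e * K * (fine (sigma (bdry Omega)) + fine (leb Omega))).

Lemma energy_rate_cont s t : 0 <= s -> s <= t -> cont_on [set u : R | s <= u <= t] energy_rate.
Proof.
move=> s0 st; apply: cont_on_mul; first by apply: continuous_cont_onT.
apply: cont_on_add; last exact: cont_on_cst.
by apply: cont_on_add; apply: cont_on_mul; [exact: cont_on_cst|exact: md_cont|exact:
    cont_on_cst|exact: mf_cont].
Qed.

Let bdry_rate (t : R) : R := expR (lam * t) *
  (\sum_i \int[sigma]_(x in bdry Omega) (F i (x, t) * outer_normal Omega x 0 i)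
   + Y1 * mf t + e * K * fine (leb Omega)).

(** Bounded integrals of the cutoff gradients, with a flux bounded on a compact set, bound the rates
    uniformly in [k] and in time; this constant allows the limit under the time integral. *)
Let cut_rate_bounded (eta : nat -> V -> R) s : 0 < s -> s <= T -> (forall k, C1 (eta k)) ->
  (forall i : 'I_m.+1, exists M, forall k, \int[leb]_(x in Omega) `|'D_(delta_mx 0 i) (eta k) x|
      <= M) ->
  exists M, forall k t, s <= t <= T -> `|cut_rate (eta k) t| <= M.
Proof.
move=> s0 sT C1e /choice[M hM].
have cF i : cont_on (CI s T) (F i).
  by apply: (cont_onW (@CIpos s T s0)); exact: (flux_cont_on oOmega hS hphi hw).
have cCI : compact (CI s T).
  apply: compact_setX => //.
  have -> : [set u : R | s <= u <= T] = `[s, T]%classic by apply/seteqP; split => z;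
      rewrite /= in_itv.
  exact: segment_compact.
have /choice[B hB] : forall i, exists B, 0 < B /\ forall p, CI s T p -> `|F i p| <= B.
  by move=> i; have [B B0 hB] := cont_on_bounded cCI (cF i); exists B.
pose rest t := Y1 * mf t + e * K * fine (leb Omega).
have crest : cont_on [set u : R | s <= u <= T] rest.
  apply: cont_on_add; last exact: cont_on_cst.
  by apply: cont_on_mul; [exact: cont_on_cst|exact: (mf_cont (ltW s0))].
have cI : compact [set u : R | s <= u <= T].
  have -> : [set u : R | s <= u <= T] = `[s, T]%classic by apply/seteqP; split => z;
      rewrite /= in_itv.
  exact: segment_compact.
have [Mr Mr0 hMr] := cont_on_bounded cI crest.
exists (expR (lam * T) * (\sum_i B i * M i + Mr)) => k t tI.
have /andP[st tT] := tI.
rewrite /cut_rate normrM (ger0_norm (expR_ge0 _)) -addrA.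
have lam0 : 0 <= lam by rewrite mulr_ge0 ?(ltW clo0)// addr_ge0// ltW// (density_d0 hphi).
apply: ler_pM => //; first by rewrite ler_expR ler_wpM2l.
apply: (le_trans (ler_normD _ _)); apply: lerD; last exact: hMr.
rewrite normrN; apply: (le_trans (ler_norm_sum _ _ _)); apply: ler_sum => i _.
have iDF : leb.-integrable Omega (EFin \o (fun x => 'D_(delta_mx 0 i) (eta k) x * F i (x, t))).
  apply: (param_integrable (F := fun p => 'D_(delta_mx 0 i) (eta k) p.1 * F i p) mO fO Ocl cO (I
      := [set u : R | s <= u <= T])) => //.
  exact: cut_flux_cont.
have cD : continuous ('D_(delta_mx 0 i) (eta k)) by case: (C1e k) => _ /(_ (delta_mx 0 i))[].
have iD : leb.-integrable Omega (EFin \o (fun x => `|'D_(delta_mx 0 i) (eta k) x|)).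
  by apply: cont_integrable_domain => //; apply: cont_on_norm; exact: continuous_cont_onT.
apply: (le_trans (le_normr_Rintegral mO iDF)).
have [B0 hBi] := hB i.
apply: (@le_trans _ _ (\int[leb]_(x in Omega) (B i * `|'D_(delta_mx 0 i) (eta k) x|))).
  apply: le_Rintegral => //.
  - rewrite (_ : EFin \o _ = (fun x => `|('D_(delta_mx 0 i) (eta k) x * F i (x, t))%:E|)%E)//.
    exact: integrable_abse iDF.
  - rewrite (_ : EFin \o _ = (fun x => (B i)%:E * (`|'D_(delta_mx 0 i) (eta k) x|)%:E)%E);
      last by apply/funext => x; rewrite /= EFinM.
    exact: integrableZl.
  - move=> x Ox; rewrite normrM mulrC ler_wpM2r//; apply: hBi; split => //=; exact: Ocl.
by rewrite RintegralZl// ler_wpM2l ?(ltW B0)// hM.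
Qed.

(** At each time the flux is a continuous test function on the closed domain, so the cutoff term
    tends to its surface integral, and convergence is bounded in time. The boundary inequality is
    applied only after this limit. *)
Lemma boundary_energy s : 0 < s -> s < T ->
  total_energy T - total_energy s <= \int[lebesgue_measure]_(t in `[s, T]) energy_rate t.
Proof.
move=> s0 sT.
have [eta [[C1e e01 eta0 etalim] edge]] := domain_cutoffs hO hs.
have [M hM] := cut_rate_bounded s0 (ltW sT) C1e (fun i => (edge i).1).
have mI : measurable (`[s, T]%classic : set R) by exact: measurable_itv.
have fI : (@lebesgue_measure R `[s, T]%classic < +oo)%E.
  by have := @lebesgue_measure_itv R `[s, T]; rewrite /= => ->; case: ifP => _;
      rewrite -?EFinD ltry.
have mcut k : measurable_fun `[s, T]%classic (cut_rate (eta k)).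
  apply/measurable_EFinP; have := cont_on_itv_integrable (cut_rate_cont (C1e k) s0 (ltW sT)).
  by move/measurable_int.
have lhs u : 0 <= u -> \int[leb]_(x in Omega) (eta k x * (expR (lam * u) * reg phi e (w (x,
    u)))) @[k --> \oo] --> total_energy u.
  move=> u0.
  have cR : cont_on (closure Omega) (fun x => expR (lam * u) * reg phi e (w (x, u))).
    apply: cont_on_mul; first exact: cont_on_cst.
    apply: (cont_on_slice (I := [set u : R | 0 <= u]) (F := fun p => reg phi e (w p)) u0).
    by apply: (cont_on_solution hw) => //; exact: (reg_continuous hphi).
  have [B B0 hB] := cont_on_bounded cO cR.
  apply: (bounded_cvg_Rintegral mO fO (M := B)) => [k|k x Ox|x Ox].
  - apply: cont_measurable_domain => //; apply: cont_on_mul; last exact: (cont_onW Ocl cR).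
    by apply: continuous_cont_onT; exact: (C1e k).1.
  - have /andP[h0 h1] := e01 k x.
    by rewrite normrM (ger0_norm h0); apply: le_trans (hB x (Ocl Ox)); rewrite ler_piMl.
  - rewrite -[X in _ --> X]mul1r; apply: cvgMl; exact: etalim.
have rhs : \int[lebesgue_measure]_(t in `[s, T]) cut_rate (eta k) t @[k --> \oo] -->
    \int[lebesgue_measure]_(t in `[s, T]) bdry_rate t.
  have cutM k (t : R) : `[s, T]%classic t -> `|cut_rate (eta k) t| <= M.
    by rewrite /= in_itv /=; exact: hM.
  apply: (@bounded_cvg_Rintegral _ _ R (@lebesgue_measure R) _ mI fI (fun k =>
      cut_rate (eta k)) bdry_rate M mcut cutM).
  move=> t; rewrite /= in_itv /= => /andP[st tT]; have t0 := lt_le_trans s0 st.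
  apply: cvgMr; apply: cvgD; last exact: cvg_cst.
  apply: cvgD; last exact: cvg_cst.
  have -> : (fun k => - \sum_i \int[leb]_(x in Omega) ('D_(delta_mx 0 i) (eta k) x * F i (x, t))) =
      (fun k => \sum_i - \int[leb]_(x in Omega) ('D_(delta_mx 0 i) (eta k) x * F i (x, t))).
    by apply/funext => k; rewrite sumrN.
  apply: cvg_sumr => i; apply: (edge i).2.
  apply: (cont_on_slice (I := [set u : R | 0 < u]) (F := F i) t0).
  exact: (flux_cont_on oOmega hS hphi hw).
have step1 : total_energy T - total_energy s <= \int[lebesgue_measure]_(t in `[s, T]) bdry_rate t.
  apply: (ler_cvg_to (cvgB (lhs T (ltW (lt_trans s0 sT))) (lhs s (ltW s0))) rhs).
  by apply: nearW => k; apply: cut_energy => //; exact: eta0.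
apply: (le_trans step1).
have cFn i : cont_on (bdry Omega `*` [set u : R | s <= u <= T]) (fun p =>
    F i p * outer_normal Omega p.1 0 i).
  apply: cont_on_mul.
    apply: (@cont_onW _ _ (CI s T)); first by move=> [x u] [/= bx uI]; split => //=; exact: Bcl.
    by apply: (cont_onW (@CIpos s T s0)); exact: (flux_cont_on oOmega hS hphi hw).
  apply: (@cont_on_comp _ _ _ _ (bdry Omega) (fun p : V * R => p.1) (fun x =>
      outer_normal Omega x 0 i)).
  - exact: (outer_normal_cont hO).
  - by apply: continuous_cont_on => p _; exact: cvg_fst.
  - by move=> p [].
have cB := compact_bdry oOmega bOmega.
apply: le_Rintegral => //.
- apply: cont_on_itv_integrable; apply: cont_on_mul; first by apply: continuous_cont_onT.
  apply: cont_on_add; last exact: cont_on_cst.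
  apply: cont_on_add; last by apply: cont_on_mul; [exact: cont_on_cst|exact: (mf_cont (ltW s0)
      (ltW sT))].
  apply: cont_on_sum => i.
  exact: (param_cont (F := fun p => F i p * outer_normal Omega p.1 0 i) mbd fB (@subset_refl _ _)
      cB (ltW sT) (cFn i)).
- by apply: cont_on_itv_integrable; exact: (energy_rate_cont (ltW s0) (ltW sT)).
move=> t; rewrite /= in_itv /= => /andP[st tT]; have t0 := lt_le_trans s0 st.
have It : [set u : R | s <= u <= T] t by rewrite /= st.
have t0T : 0 <= t <= T by rewrite ltW.
rewrite /bdry_rate /energy_rate ler_wpM2l ?expR_ge0//.
have pin i : sigma.-integrable (bdry Omega) (EFin \o (fun x => F i (x,
    t) * outer_normal Omega x 0 i)).
  exact: (param_integrable (F := fun p => F i p * outer_normal Omega p.1 0 i) mbd fB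
      (@subset_refl _ _) cB It (cFn i)).
have [iS <-] := Rintegral_sumr (index_enum 'I_m.+1) mbd pin.
have id : sigma.-integrable (bdry Omega) (EFin \o (fun x => Phi `|d (x, t)|)).
  by apply: (param_integrable (F := fun p => Phi `|d p|) mbd fB Bcl cO It);
      exact: (@PhiC2 d s T (ltW s0) hd).
have iCd : sigma.-integrable (bdry Omega) (EFin \o (fun x => Y2 * Phi `|d (x, t)|)).
  rewrite (_ : EFin \o _ = (fun x => Y2%:E * (Phi `|d (x, t)|)%:E)%E); last by apply/funext => x;
      rewrite /= EFinM.
  exact: integrableZl.
have icst : sigma.-integrable (bdry Omega) (EFin \o (fun _ : V => e * K)).
  by apply: (cont_integrable_bdry hO hs); exact: cont_on_cst.
have key : \int[sigma]_(x in bdry Omega) (\sum_i F i (x, t) * outer_normal Omega x 0 i) <=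
    Y2 * md t + e * K * fine (sigma (bdry Omega)).
  apply: (@le_trans _ _ (\int[sigma]_(x in bdry Omega) (Y2 * Phi `|d (x, t)| + e * K))).
    apply: le_Rintegral => //; first exact: integrable_addR.
    move=> x bx.
    apply: (le_trans (solution_boundary hphi hw e0 theta0 hrho psilo0 hth2 hpsi nu1 bx t0)).
    by rewrite lerD2l ler_wpM2l ?(ltW e0)//; exact: hK2.
  by rewrite RintegralD// RintegralZl// Rintegral_cst.
have aux (z0 z1 z2 z3 u v : R) : z0 <= z2 + u * v -> z0 + z1 + u * z3 <= z2 + z1 + u * (v + z3).
  by move=> h; rewrite mulrDr addrA lerD2r addrAC lerD2r.
exact: aux.
Qed.

Lemma energy_rate_ge0 t : 0 <= t <= T -> 0 <= energy_rate t.
Proof.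
move=> tT; apply: mulr_ge0; first exact: expR_ge0.
have C0 (z : R) : 0 <= young_constant d1 z by exact: (young_constant_ge0 hphi).
apply: addr_ge0; first by apply: addr_ge0; apply: mulr_ge0 => //; exact: modular_time_ge0.
apply: mulr_ge0; first by apply: mulr_ge0; [exact: ltW|exact: (K0 tT)].
by apply: addr_ge0; apply: fine_ge0.
Qed.

(** The flux need not extend to time 0, but the energy does, as [w] is continuous on the closed
    cylinder. Up to an arbitrary slack [z], the energy at a small [s] is replaced by the one at 0,
    and the nonnegative rate is integrated over the larger interval. *)
Lemma total_energy_le : 0 < T ->
  total_energy T <= total_energy 0 + \int[lebesgue_measure]_(t in `[0, T]) energy_rate t.
Proof.
move=> T0; apply/ler_addgt0Pr => z z0.
have cE : cont_on [set u : R | 0 <= u <= T] total_energy.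
  apply: (param_cont (F := fun p => expR (lam * p.2) * reg phi e (w p)) mO fO Ocl cO (ltW T0)).
  apply: cont_on_mul.
    apply: continuous_cont_onT => p.
    apply: (@cont_comp _ _ _ (fun p : V * R => lam * p.2) expR); last exact: continuous_expR.
    by apply: cont_mul; [exact: cont_cst|exact: cvg_snd].
  apply: (cont_on_solution hw); [exact: (@CIcl 0 T (lexx 0))|exact: (reg_continuous hphi)].
have I0 : [set u : R | 0 <= u <= T] 0 by rewrite /= lexx ltW.
have hB : nbhs (total_energy 0) [set y | y <= total_energy 0 + z].
  have hlt : total_energy 0 < total_energy 0 + z by rewrite ltrDl.
  by apply: filterS (near_lt hlt) => y /ltW.
have /nbhs_ballP[dl /= dl0 hdl] := (cont_onE _ _).1 cE 0 I0 _ hB.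
pose s := Num.min (dl / 2) (T / 2).
have s0 : 0 < s by rewrite lt_min !divr_gt0.
have half (u : R) : 0 < u -> u / 2 < u by move=> u0; rewrite ltr_pdivrMr// ltr_pMr// ltr1n.
have sT : s < T by rewrite gt_min (half T)// orbT.
have Es : total_energy s <= total_energy 0 + z.
  apply: hdl; last by rewrite (ltW s0) ltW.
  rewrite -ball_normE /ball_ /= sub0r normrN gtr0_norm// gt_min.
  by rewrite (half dl).
have hsub : \int[lebesgue_measure]_(t in `[s, T]) energy_rate t <= \int[lebesgue_measure]_(t in
    `[0, T]) energy_rate t.
  apply: le_Rintegral_itv; first by rewrite (ltW s0) ltW.
    exact: (energy_rate_cont (lexx 0) (ltW T0)).
  exact: energy_rate_ge0.
have aux (z1 z2 z3 z4 z5 : R) : z4 <= z5 -> z3 <= z2 + z -> z1 - z3 <= z4 -> z1 <= z2 + z5 + z.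
  by move=> h1 h2 h3; have := lerD (le_trans h3 h1) h2; rewrite subrK addrA (addrC z5).
exact: aux hsub Es (boundary_energy s0 sT).
Qed.

End energy.

Lemma reg_cvg {R : realType} (phi : R -> R) (d0 d1 s : R) : orlicz_density phi d0 d1 ->
  reg phi (n.+1%:R^-1) s @[n --> \oo] --> orlicz_primitive phi `|s|.
Proof.
move=> hphi; have h0 : (fun n : nat => n.+1%:R^-1 : R) @ \oo --> (0 : R) by exact: cvg_harmonic.
have h1 : (fun n : nat => s ^+ 2 + (n.+1%:R^-1) ^+ 2) @ \oo --> s ^+ 2.
  rewrite -[X in _ --> X]addr0; apply: cvgD; first exact: cvg_cst.
  have -> : (0 : R) = 0 * 0 by rewrite mulr0.
  under eq_fun do rewrite expr2.
  exact: cvgM.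
have h2 : regabs (n.+1%:R^-1) s @[n --> \oo] --> `|s|.
  by rewrite -sqrtr_sqr; exact: (@cvg_comp _ _ _ (fun n : nat =>
      s ^+ 2 + n.+1%:R^-1 ^+ 2) (@Num.sqrt R) _ _ _ h1 (@sqrt_continuous R (s ^+ 2))).
exact: (@cvg_comp _ _ _ (fun n : nat => regabs n.+1%:R^-1 s) (orlicz_primitive phi) _ _ _ h2
    (@primitive_continuous _ _ _ _ hphi `|s|)).
Qed.

Section estimate.
Context {R : realType} {m : nat}.
Local Notation V := ('rV[R]_m.+1).
Variables (Omega : set V) (sigma : {measure set V -> \bar R}) (S : system R m)
  (d0 d1 alo ahi clo psilo : R) (mu : V * R -> R).
Hypotheses (hO : smooth_bounded_domain Omega) (hs : is_surface_measure Omega sigma)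
  (hS : system_C2 Omega S) (d00 : 0 < d0) (d10 : 0 < d1) (h11 : condA11 Omega S alo ahi)
  (h21 : condA21 Omega S mu) (h23 : condA23 Omega S mu d0 d1 clo)
  (h32 : condA32 Omega S d0 d1 psilo).
Local Notation leb := (lebesgue_row R m.+1).
Local Notation lam := (clo * (1 + d0)).

Let oOmega : open Omega. Proof. by case: hO. Qed.
Let bOmega : bounded_set Omega. Proof. by case: hO. Qed.
Let mO : measurable Omega. Proof. exact: open_measurable_row. Qed.
Let fO : (leb Omega < +oo)%E. Proof. exact: domain_finite. Qed.
Let cO : compact (closure Omega). Proof. exact: compact_closure_domain. Qed.
Let Ocl : Omega `<=` closure Omega. Proof. exact: subset_closure. Qed.
Let Ucl : cylinder Omega `<=` closed_cylinder Omega.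
Proof. by move=> [x t] [/= Ox t0]; split => /=; [exact: subset_closure|exact: ltW]. Qed.

Let theta_choice (rho : R) : 0 < rho -> 0 < alo -> 0 < psilo -> exists theta : R,
  [/\ 0 < theta, theta * (rho ^+ 2 * (1 + d1) / (4 * alo * Num.min d0 1)) <= 2^-1
    & theta * rho <= psilo * (1 + d0) / 2].
Proof.
move=> rho0 alo0 psilo0; set Q := rho ^+ 2 * (1 + d1) / (4 * alo * Num.min d0 1).
have Q0 : 0 < Q.
  by rewrite divr_gt0// ?mulr_gt0 ?exprn_gt0 ?addr_gt0// lt_min d00 ltr01.
exists (Num.min (2^-1 / Q) (psilo * (1 + d0) / 2 / rho)); split.
- by rewrite lt_min; apply/andP; split; apply: divr_gt0 => //;
    rewrite ?invr_gt0// divr_gt0// mulr_gt0// addr_gt0.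
- by rewrite -(ler_pdivlMr _ _ Q0) ge_min lexx.
- by rewrite -(ler_pdivlMr _ _ rho0) ge_min lexx orbT.
Qed.

(** The order of the quantifiers is the point: [theta], hence [C0], is fixed from the domain, the
    system constants and the two indices, before [phi] is given. The Luxemburg estimate depends on
    it. *)
Lemma energy_estimate : exists C0, 0 < C0 /\ forall phi, orlicz_density phi d0 d1 ->
  forall w0 d f w, admissible_data Omega S w0 d f -> classical_solution Omega S w0 d f w ->
  forall T, 0 < T ->
  expR (lam * T) * \int[leb]_(x in Omega) orlicz_primitive phi `|w (x, T)| <=
  \int[leb]_(x in Omega) orlicz_primitive phi `|w0 x| +
  C0 * \int[lebesgue_measure]_(t in `[0, T]) (expR (lam * t) *
    (modular_time phi sigma (bdry Omega) d t + modular_time phi leb Omega f t)).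
Proof.
have [alo0 _ haa] := h11; have [clo0 hc] := h23; have [psilo0 _] := h32.
have [rho rho0 hrho] := cont_on_bounded cO (continuous_cont_onT (@row_coord_continuous R m.+1
    ord0)).
have [theta [theta0 hth hth2]] := theta_choice rho0 alo0 psilo0.
set C1 := young_constant d1 (theta / 2); set C2 := young_constant d1 (psilo * (1 + d0) / 2).
have yc (k : R) : 0 <= young_constant d1 k by rewrite mulr_ge0 ?powR_ge0// addr_ge0// ltW.
have C10 : 0 <= C1 by exact: yc.
have C20 : 0 <= C2 by exact: yc.
(* The sum dominates both Young constants, and the 1 makes it positive. *)
exists (C1 + C2 + 1); split; first by rewrite ltr_wpDl// addr_ge0.
move=> phi hphi w0 d f w [_ hd hf _] hw T T0.
set Phi := orlicz_primitive phi.
pose I := [set u : R | 0 <= u <= T].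
have cAI : compact (closure Omega `*` I).
  apply: compact_setX => //.
  have -> : I = `[0, T]%classic by apply/seteqP; split => z; rewrite /I /= in_itv.
  exact: segment_compact.
have AIcl : closure Omega `*` I `<=` closed_cylinder Omega.
  by move=> [x u] [/= cx /andP[su _]]; split.
have [aC2 bC2 cC2 _ _] := hS.
have cw : cont_on (closure Omega `*` I) w by exact: (cont_onW AIcl (solution_cont_on hw)).
(* This bound depends on [phi] and on the solution, which is harmless: it only occurs multiplied by
   [e n]. *)
have [K K0 hK] : exists2 K, 0 < K & forall p, (closure Omega `*` I) p ->
   `|(`|sys_c S p - mu p| + psilo + \sum_i `|sys_b S p 0 i|) * phi (`|w p| + 1)| <= K.
  apply: cont_on_bounded => //; apply: cont_on_mul.
    apply: cont_on_add.
      apply: cont_on_add; last exact: cont_on_cst.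
      apply: cont_on_norm; apply: cont_on_sub; first exact: (cont_onW AIcl (C2_closure_cont_on
          cC2)).
      by apply: (cont_onW AIcl); case: h21 => /within_continuousP.
    apply: cont_on_sum => i; apply: cont_on_norm.
    exact: (cont_onW AIcl (C2_closure_cont_on (bC2 i))).
  apply: (@cont_on_comp _ _ _ _ [set s : R | 0 <= s] (fun p => `|w p| + 1) phi) => //.
  - exact: (density_cont hphi).
  - by apply: cont_on_add; [exact: cont_on_norm|exact: cont_on_cst].
  - by move=> p _ /=; rewrite addr_ge0.
have hK' x t : closure Omega x -> 0 <= t <= T ->
  (`|sys_c S (x, t) - mu (x, t)| + psilo + \sum_i `|sys_b S (x, t) 0 i|) * phi (`|w (x,
      t)| + 1) <= K.
  by move=> cx tT; apply: le_trans (ler_norm _) (hK (x, t) _).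
have hmu p s eta : cylinder Omega p -> - sys_h S (p, s, eta) * s <= mu p * s ^+ 2.
  by case: h21 => _; apply.
have haa' p : cylinder Omega p -> alo <= sys_a S p by move=> /Ucl/haa/andP[].
pose e n : R := n.+1%:R^-1.
have e0 n : 0 < e n by rewrite invr_gt0.
have e1 n : e n <= 1 by rewrite invf_le1// ler1n.
have TE n := total_energy_le hO hs hS hphi hd hf hw (e0 n) (e1 n) clo0 alo0 haa' theta0 hth
  hrho hmu hc psilo0 hth2 h32 hK' T0.
have mdc : cont_on I (modular_time phi sigma (bdry Omega) d) by exact: (md_cont hO hs hphi hd
    (lexx 0) (ltW T0)).
have mfc : cont_on I (modular_time phi leb Omega f) by exact: (mf_cont hO hphi hf (lexx 0) (ltW
    T0)).
set md := modular_time _ _ _ d in mdc *; set mf := modular_time _ _ _ f in mfc *.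
have cexp : cont_on I (fun t : R => expR (lam * t)).
  apply: continuous_cont_onT => t; apply: (@cont_comp _ _ _ (fun t : R => lam * t) expR);
      last exact: continuous_expR.
  by apply: cont_mul; [exact: cont_cst|exact: cvg_id].
pose Z := \int[lebesgue_measure]_(t in `[0, T]) (expR (lam * t) * (md t + mf t)).
pose c := K * (fine (sigma (bdry Omega)) + fine (leb Omega)).
pose Y := \int[lebesgue_measure]_(t in `[0, T]) expR (lam * t).
have rate n : \int[lebesgue_measure]_(t in `[0, T]) energy_rate Omega sigma phi d0 d1 d f (e n)
    theta clo psilo K t
    <= (C1 + C2 + 1) * Z + e n * c * Y.
  have iZ : lebesgue_measure.-integrable `[0, T] (EFin \o (fun t =>
      expR (lam * t) * (md t + mf t))).
    by apply: cont_on_itv_integrable; apply: cont_on_mul => //; exact: cont_on_add.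
  have iY : lebesgue_measure.-integrable `[0, T] (EFin \o (fun t => expR (lam * t))).
    exact: cont_on_itv_integrable.
  have iCZ : lebesgue_measure.-integrable `[0, T] (EFin \o (fun t =>
      (C1 + C2 + 1) * (expR (lam * t) * (md t + mf t)))).
    apply: cont_on_itv_integrable; apply: cont_on_mul; first exact: cont_on_cst.
    by apply: cont_on_mul => //; exact: cont_on_add.
  have iCY : lebesgue_measure.-integrable `[0, T] (EFin \o (fun t => e n * c * expR (lam * t))).
    by apply: cont_on_itv_integrable; apply: cont_on_mul => //; exact: cont_on_cst.
  have iS : lebesgue_measure.-integrable `[0, T] (EFin \o (fun t =>
      (C1 + C2 + 1) * (expR (lam * t) * (md t + mf t)) + e n * c * expR (lam * t))).
    apply: cont_on_itv_integrable; apply: cont_on_add; apply: cont_on_mul => //;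
        first exact: cont_on_cst.
      by apply: cont_on_mul => //; exact: cont_on_add.
    exact: cont_on_cst.
  have -> : (C1 + C2 + 1) * Z + e n * c * Y =
      \int[lebesgue_measure]_(t in `[0, T]) ((C1 + C2 + 1) * (expR (lam * t) * (md t + mf t)) + e
          n * c * expR (lam * t)).
    by rewrite RintegralD// !RintegralZl.
  apply: le_Rintegral => //.
    apply: cont_on_itv_integrable.
    by apply: (energy_rate_cont hO hs hphi hd hf) => //; exact: ltW.
  move=> t _; rewrite /energy_rate -/C1 -/C2 -/md -/mf /c.
  have md0 : 0 <= md t by exact: (modular_time_ge0 hphi).
  have mf0 : 0 <= mf t by exact: (modular_time_ge0 hphi).
  have aux (E u v k z : R) : 0 <= E -> 0 <= u -> 0 <= v ->
     E * (C2 * u + C1 * v + k * K * z) <= (C1 + C2 + 1) * (E * (u + v)) + k * (K * z) * E.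
    move=> E0 u0 v0; rewrite -subr_ge0.
    have -> : (C1 + C2 + 1) * (E * (u + v)) + k * (K * z) * E - E * (C2 * u + C1 * v + k * K * z)
      = E * (C1 * u + C2 * v + u + v) by ring.
    by rewrite mulr_ge0// !addr_ge0// mulr_ge0.
  by apply: aux => //; exact: expR_ge0.
(* At time 0 the exponential weight is 1 and [w] equals [w0] inside. The bound [Phi (B + 1)] serves
   all [n] because [e n <= 1]. *)
have ewlim : total_energy Omega phi d0 w (e n) clo 0 @[n --> \oo] --> \int[leb]_(x in Omega) Phi
    `|w0 x|.
  have cw0 : cont_on (closure Omega) (fun x => w (x, 0)).
    by apply: (cont_on_slice (I := I)) => //; rewrite /I /= lexx ltW.
  have [B B0 hB] := cont_on_bounded cO cw0.
  have w0E x : Omega x -> w (x, 0) = w0 x by case: hw => _ [_ _]; apply.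
  apply: (bounded_cvg_Rintegral mO fO (M := Phi (B + 1))) => [n|n x Ox|x Ox].
  - apply: cont_measurable_domain => //; apply: cont_on_mul; first exact: cont_on_cst.
    apply: (@cont_on_comp _ _ _ _ setT (fun x => w (x, 0)) (reg phi (e n))) => //.
      by apply: continuous_cont_onT; exact: (reg_continuous hphi).
    exact: (cont_onW Ocl).
  - rewrite mulr0 expR0 mul1r ger0_norm; last exact: (primitive_ge0 hphi).
    apply: (le_trans (reg_le1 hphi _ (e0 n) (e1 n))).
    by apply: (primitive_homo hphi); rewrite lerD2r hB//; exact: Ocl.
  - under eq_fun do rewrite mulr0 expR0 mul1r.
    have := @reg_cvg R phi d0 d1 (w (x, 0)) hphi.
    by rewrite (w0E x Ox).
have rhslim : total_energy Omega phi d0 w (e n) clo 0 + (C1 + C2 + 1) * Z + e n * c * Y @[n -->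
    \oo] -->
   \int[leb]_(x in Omega) Phi `|w0 x| + (C1 + C2 + 1) * Z + 0 * c * Y.
  apply: cvgD; first by apply: cvgD => //; exact: cvg_cst.
  by apply: cvgMl; apply: cvgMl; exact: cvg_harmonic.
move: rhslim; rewrite !mul0r addr0 => rhslim.
apply: (cvgr_to_ge rhslim); apply: nearW => n.
have cwT : cont_on (closure Omega) (fun x => w (x, T)).
  by apply: (cont_on_slice (I := I)) => //; rewrite /I /= lexx ltW.
have iP : leb.-integrable Omega (EFin \o (fun x => Phi `|w (x, T)|)).
  apply: cont_integrable_domain => //.
  apply: (@cont_on_comp _ _ _ _ setT (fun x => w (x, T)) (fun r => Phi `|r|)) => //.
  by apply: continuous_cont_onT; exact: (primitive_abs_continuous hphi).
have iR : leb.-integrable Omega (EFin \o (fun x => reg phi (e n) (w (x, T)))).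
  apply: cont_integrable_domain => //.
  apply: (@cont_on_comp _ _ _ _ setT (fun x => w (x, T)) (reg phi (e n))) => //.
  by apply: continuous_cont_onT; exact: (reg_continuous hphi).
apply: (@le_trans _ _ (total_energy Omega phi d0 w (e n) clo T)).
  have -> : total_energy Omega phi d0 w (e n) clo T = expR (lam * T) * \int[leb]_(x in Omega) reg
      phi (e n) (w (x, T)).
    by rewrite /total_energy (RintegralZl _ mO iR).
  apply: ler_wpM2l; first exact: expR_ge0.
  by apply: le_Rintegral => // x Ox; exact: (reg_ge hphi).
by apply: (le_trans (TE n)); rewrite -addrA lerD2l.
Qed.

End estimate.

(** * Input-to-state stability *)

Section exponential_kernel.
Context {R : realType}.
Implicit Types (a lam t T : R) (m : R -> R) (q : \bar R).

Definition decay lam T t := expR (- lam * (T - t)).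

Lemma decay_ge0 lam T t : 0 <= decay lam T t. Proof. exact: expR_ge0. Qed.

Lemma decay_le1 lam T t : 0 <= lam -> t <= T -> decay lam T t <= 1.
Proof. by move=> l0 tT; rewrite expR_le1 mulNr oppr_le0 mulr_ge0// subr_ge0. Qed.

Lemma decay_continuous lam T : continuous (decay lam T).
Proof.
move=> t; apply: (@cont_comp _ _ _ (fun t : R => - lam * (T - t)) (@expR R));
    last exact: continuous_expR.
apply: cont_mul; first exact: cont_cst.
by apply: cont_sub; [exact: cont_cst|exact: cvg_id].
Qed.

Lemma decay_derive lam T t : is_derive t 1 (decay lam T) (lam * decay lam T t).
Proof.
have h : is_derive t 1 (fun t : R => - lam * (T - t)) lam.
  have -> : (fun t : R => - lam * (T - t)) = (fun t => - lam * T + t * lam).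
    by apply/funext => u; ring.
  by apply: is_derive_affine => h; rewrite /GRing.scale/=; ring.
have := @is_derive1_comp _ (@expR R) (fun t : R => - lam * (T - t)) t _ _ (is_derive_expR _) h.
by rewrite mulrC.
Qed.

Lemma decay_integral_le lam T : 0 < lam -> 0 < T ->
  (\int[lebesgue_measure]_(t in `[0%R, T]) (decay lam T t)%:E <= (1 / lam)%:E)%E.
Proof.
move=> l0 T0.
have lN : lam != 0 by rewrite gt_eqF.
have Fd t : is_derive t 1 (fun t => lam^-1 * decay lam T t) (decay lam T t).
  have := @is_deriveZ _ _ _ (decay lam T) lam^-1 t 1 _ (decay_derive lam T t).
  by rewrite /GRing.scale/= mulKf.
have Fc : continuous (fun t => lam^-1 * decay lam T t) by move=> t; exact: (is_derive_cont (Fd t)).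
rewrite (@continuous_FTC2 _ (decay lam T) (fun t => lam^-1 * decay lam T t))//.
- rewrite -EFinB lee_fin {1}/decay subrr mulr0 expR0 mulr1 mul1r gerBl.
  by rewrite mulr_ge0 ?decay_ge0// invr_ge0 ltW.
- by apply: continuous_subspaceT; exact: decay_continuous.
- split.
  + by move=> t _; case: (Fd t).
  + by apply: cvg_at_right_filter; exact: Fc.
  + by apply: cvg_at_left_filter; exact: Fc.
- by move=> t _; rewrite derive1E; case: (Fd t).
Qed.

(** Hoelder's inequality in time, with the exponential as one factor. For [q = 1] it is bounded by
    1, for [q = +oo] it is integrated alone; in between, its norm of exponent [q'] gives the
    conjugate factor. *)
Lemma decay_Lq lam T m q : 0 < lam -> 0 < T -> (1 <= q)%E ->
  cont_on [set t : R | 0 <= t <= T] m -> (forall t, 0 <= m t) ->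
  ((\int[lebesgue_measure]_(t in `[0, T]) (decay lam T t * m t))%:E <=
   (conjugate_factor lam q)%:E *
   'N[lebesgue_measure]_q[(fun t => (m t)%:E) \_ `]0%R, T[])%E.
Proof.
move=> l0 T0 q1 cm m0.
set D := [set` `]0, T[].
have mD : measurable (D : set R) by exact: measurable_itv.
have cd : cont_on [set t : R | 0 <= t <= T] (decay lam T).
  by apply: continuous_cont_onT; exact: decay_continuous.
have ikm := cont_on_itv_integrable (cont_on_mul cd cm).
have im := cont_on_itv_integrable cm.
have DT : D `<=` `[0, T] by apply: subset_itv; rewrite bnd_simp.
have mdec a : measurable_fun setT (decay a T \_ D).
  apply/(measurable_restrictT _ mD); apply: measurable_funTS.
  by apply: continuous_measurable_fun; exact: decay_continuous.
have mK := mdec lam.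
have mm : measurable_fun D m.
  by apply: measurable_funS DT _ => //; apply/measurable_EFinP; exact: (measurable_int _ im).
have mM : measurable_fun setT (m \_ D) by apply/(measurable_restrictT _ mD).
have resE (f : R -> R) : (fun t => (f t)%:E) \_ D = EFin \o (f \_ D) by rewrite restrict_EFin.
rewrite resE.
have intE (f : R -> R) : (\int[@lebesgue_measure R]_(z in `]0%R, T[) (f z)%:E =
    \int[@lebesgue_measure R]_z ((f \_ D) z)%:E)%E.
  by rewrite integral_mkcond; apply: eq_integral => t _; rewrite !patchE /D; case: ifPn.
have KM t : (decay lam T \_ D \* m \_ D) t = ((fun t => decay lam T t * m t) \_ D) t.
  by rewrite /= !patchE; case: ifPn => // _; rewrite mulr0.
have K0 t : 0 <= (decay lam T \_ D) t by rewrite patchE; case: ifPn => // _; exact: decay_ge0.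
have M0 t : 0 <= (m \_ D) t by rewrite patchE; case: ifPn.
have LHS : (\int[lebesgue_measure]_(t in `[0, T]) (decay lam T t * m t))%:E =
    ('N[lebesgue_measure]_1[EFin \o (decay lam T \_ D \* m \_ D)%R])%E.
  rewrite Lnorm1 /Rintegral fineK; last exact: integrable_fin_num.
  rewrite integral_itv_bndoo; last first.
    apply/measurable_EFinP; apply: measurable_funM => //.
    by apply: measurable_funTS; apply: continuous_measurable_fun; exact: decay_continuous.
  rewrite intE.
  by apply: eq_integral => t _; rewrite /= -KM ger0_norm// mulr_ge0.
rewrite LHS.
case: q q1 => [r| |//]; rewrite /conjugate_factor.
- rewrite lee_fin le_eqVlt => /predU1P[<-|r1].
    rewrite eqxx mul1e !Lnorm1; apply: ge0_le_integral => //.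
    + by apply: measurableT_comp => //; apply/measurable_EFinP; exact: measurable_funM.
    + by apply: measurableT_comp => //; apply/measurable_EFinP.
    + move=> t _; rewrite /= lee_fin !ger0_norm//; last by rewrite mulr_ge0.
      apply: ler_piMl => //; rewrite patchE; case: ifPn => // /set_mem.
      by rewrite /D /= in_itv /= => /andP[_ tT]; apply: decay_le1; exact: ltW.
  rewrite gt_eqF//=; set p := r / (r - 1).
  have r0 : 0 < r := lt_trans ltr01 r1.
  have r10 : 0 < r - 1 by rewrite subr_gt0.
  have p0 : 0 < p by rewrite divr_gt0.
  have pr : p^-1 + r^-1 = 1.
    by rewrite /p; field; rewrite !gt_eqF.
  have H := @hoelder _ _ R (@lebesgue_measure R) _ _ p r mK mM p0 r0 pr.
  apply: (le_trans H).
  apply: lee_wpmul2r; first exact: Lnorm_ge0.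
  rewrite unlock (div1r p) -poweR_EFin; apply: gt0_ler_poweR.
  + by rewrite invr_ge0 ltW.
  + by rewrite in_itv /= leey andbT integral_ge0// => t _; rewrite poweR_ge0.
  + by rewrite in_itv /= leey andbT lee_fin divr_ge0// mulr_ge0// ltW.
  (* The power [p] of the decay at rate [lam] is the decay at rate [lam * p], whose integral is at
     most [1 / (lam * p)]. *)
  apply: le_trans (decay_integral_le (mulr_gt0 l0 p0) T0).
  rewrite integral_itv_bndoo; last first.
    by apply/measurable_EFinP; apply: measurable_funTS; apply: continuous_measurable_fun;
        exact: decay_continuous.
  rewrite intE; apply: ge0_le_integral => //.
  + by move=> t _; exact: poweR_ge0.
  + apply/measurable_EFinP; apply: (@measurableT_comp _ _ _ _ _ _ (@powR R ^~ p)) => //.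
    exact: measurableT_comp.
  + by apply/measurable_EFinP; exact: mdec.
  + move=> t _; rewrite poweR_EFin /= ger0_norm// !patchE; case: ifPn => _;
      last by rewrite powR0// gt_eqF.
    by rewrite /decay -expRM lee_fin ler_expR; lra.
(* The norm of exponent [+oo] unfolds to the essential supremum only for a measure of positive total
   mass. *)
- move=> _; have T1 : (0 < (@lebesgue_measure R) [set: R])%E.
    have : ((@lebesgue_measure R) [set` `[0%R, 1%R] ] <= (@lebesgue_measure R) [set: R])%E.
      by apply: le_measure; rewrite ?inE.
    by apply: lt_le_trans; have := @lebesgue_measure_itv R `[0, 1]; rewrite /= => ->;
        rewrite lte_fin ltr01 -EFinB lte_fin subr0.
  have Ny f : ('N[@lebesgue_measure R]_+oo[f] = ess_sup (@lebesgue_measure R) (abse \o f))%E.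
    by rewrite unlock T1.
  rewrite Ny.
  move: (ess_sup_ge (@lebesgue_measure R) (abse \o (EFin \o m \_ D))).
  have : (0 <= ess_sup (@lebesgue_measure R) (abse \o (EFin \o m \_ D)))%E.
    by apply: ess_sup_gee => //; apply: aeW => t; exact: abse_ge0.
  (* An infinite essential supremum makes the right-hand side infinite. *)
  case: (ess_sup _ _) => [M|_ _|//]; last by rewrite gt0_muley ?leey// lte_fin divr_gt0.
  rewrite lee_fin => M00 aeM.
  rewrite Lnorm1; apply: (@le_trans _ _ (\int[lebesgue_measure]_t ((decay lam T \_ D) t * M)%:E)%E).
    apply: ae_ge0_le_integral => //.
    + by apply: measurableT_comp => //; apply/measurable_EFinP; exact: measurable_funM.
    + by move=> t _; rewrite lee_fin mulr_ge0.
    + by apply/measurable_EFinP; apply: measurable_funM.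
    + apply: filterS aeM => t /= h _; rewrite lee_fin normrM (ger0_norm (K0 t)).
      by apply: ler_wpM2l.
  under eq_integral do rewrite EFinM.
  rewrite ge0_integralZr//.
  + apply: lee_wpmul2r => //.
    apply: le_trans (decay_integral_le l0 T0).
    rewrite integral_itv_bndoo; last first.
      by apply/measurable_EFinP; apply: measurable_funTS; apply: continuous_measurable_fun;
          exact: decay_continuous.
    by rewrite intE.
  + by apply/measurable_EFinP.
  + by move=> t _; rewrite lee_fin.
Qed.

Lemma le_decay_Rintegral a lam T (m1 m2 : R -> R) :
  cont_on [set t : R | 0 <= t <= T] m1 -> cont_on [set t : R | 0 <= t <= T] m2 ->
  (forall t, 0 <= t <= T -> a * m1 t <= m2 t) ->
  a * \int[lebesgue_measure]_(t in `[0, T]) (decay lam T t * m1 t) <=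
  \int[lebesgue_measure]_(t in `[0, T]) (decay lam T t * m2 t).
Proof.
move=> c1 c2 h.
have ck : cont_on [set t : R | 0 <= t <= T] (decay lam T).
  by apply: continuous_cont_onT; exact: decay_continuous.
have mI : measurable (`[0, T]%classic : set R) by exact: measurable_itv.
have i1 := cont_on_itv_integrable (cont_on_mul ck c1).
have i2 := cont_on_itv_integrable (cont_on_mul ck c2).
have i3 : lebesgue_measure.-integrable `[0, T] (EFin \o (fun t => a * (decay lam T t * m1 t))).
  apply: cont_on_itv_integrable; apply: cont_on_mul; first exact: cont_on_cst.
  exact: cont_on_mul.
have pw (t : R) : 0 <= t <= T -> a * (decay lam T t * m1 t) <= decay lam T t * m2 t.
  by move=> /h ht; rewrite mulrCA ler_wpM2l// decay_ge0.
by rewrite -RintegralZl//; apply: le_Rintegral.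
Qed.

Lemma conjugate_factor_gt0 lam q : 0 < lam -> (1 <= q)%E -> 0 < conjugate_factor lam q.
Proof.
move=> l0; case: q => [r| |//]; rewrite /conjugate_factor; last by rewrite divr_gt0.
rewrite lee_fin le_eqVlt => /predU1P[<-|r1]; first by rewrite eqxx.
rewrite gt_eqF// powR_gt0// divr_gt0// mulr_gt0// divr_gt0 ?subr_gt0//.
exact: lt_trans r1.
Qed.

End exponential_kernel.

Lemma powR_cont_on {R : realType} (a : R) : 0 < a -> cont_on [set s : R | 0 <= s] (fun s => s `^ a).
Proof.
move=> a0 s /=; rewrite le_eqVlt => /predU1P[<-|s0]; last first.
  by apply: cvg_within_filter; exact: (is_derive_cont (is_derive1_powR a s0)).
rewrite powR0 ?gt_eqF//; apply/cvgrPdist_lt => e e0; rewrite near_withinE.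
have b0 : 0 < e `^ a^-1 by rewrite powR_gt0.
near=> t => /= t0; rewrite sub0r normrN ger0_norm ?powR_ge0//.
have te : t < e `^ a^-1 by near: t; apply: near_lt.
have := @gt0_ltr_powR _ a a0 t (e `^ a^-1).
by rewrite !nnegrE => /(_ t0 (ltW b0) te); rewrite -powRrM mulVf ?gt_eqF// powRr1// ltW.
Unshelve. all: by end_near. Qed.

Section scaling.
Context {R : realType}.
Implicit Types (s t k l : R).
Variables (phi : R -> R) (d0 d1 : R).
Hypothesis hphi : orlicz_density phi d0 d1.
Local Notation Phi := (orlicz_primitive phi).

Lemma primitive_half s : 0 <= s -> Phi (s / 2) <= Phi s / 2.
Proof.
move=> s0; have h0 := density_d0 hphi.
rewrite ler_pdivlMr// mulrC.
have -> : Phi s = Phi (2 * (s / 2)) by rewrite mulrC divfK.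
apply: le_trans (primitive_scale_ge hphi _ _); rewrite ?ler1n ?divr_ge0//.
rewrite ler_wpM2r ?(primitive_ge0 hphi)//.
by apply: le1r_powR; rewrite ?ler1n// lerDl ltW.
Qed.

(** The two bounds on [a] serve the two regimes: for [k >= 1] the lower index governs the dilation,
    for [k < 1] the upper one. *)
Lemma primitive_div_le a k s : 0 < k -> 0 <= s -> 0 <= a ->
  a <= k `^ (1 + d0) -> a <= k `^ (1 + d1) -> a * Phi (s / k) <= Phi s.
Proof.
move=> k0 s0 a0 h0 h1; have [k1|k1] := leP 1 k.
  have -> : Phi s = Phi (k * (s / k)) by rewrite mulrC divfK// gt_eqF.
  apply: le_trans (primitive_scale_ge hphi k1 _); last by rewrite divr_ge0// ltW.
  by rewrite ler_wpM2r// (primitive_ge0 hphi).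
have k1' : 1 <= k^-1 by rewrite invf_ge1// ltW.
apply: (@le_trans _ _ (a * (k^-1 `^ (1 + d1) * Phi s))).
  by rewrite ler_wpM2l// (mulrC s); exact: (primitive_scale_le hphi).
rewrite mulrA ler_piMl ?(primitive_ge0 hphi)//.
have kp : 0 < k `^ (1 + d1) by rewrite powR_gt0.
have -> : k^-1 `^ (1 + d1) = (k `^ (1 + d1))^-1.
  by rewrite -powR_inv1 ?(ltW k0)// -powRrM mulN1r powRN.
by rewrite ler_pdivrMr// mul1r.
Qed.

(** Lowering the level from [2 k] by a factor [E] costs [E^(1 + d1)]. With
    [E = exp (lam T / (1 + d1))] this is exactly what the decay [exp (- lam T)] pays for; the factor
    2 produces the one half. *)
Lemma primitive_scale_half E k l s : 1 <= E -> 0 < k -> 0 < l -> 0 <= s -> 2 * k <= E * l ->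
  Phi (s / l) <= E `^ (1 + d1) * (Phi (s / k) / 2).
Proof.
move=> E1 k0 l0 s0 kl; have sk0 : 0 <= s / k / 2 by rewrite !divr_ge0// ltW.
apply: (@le_trans _ _ (Phi (E * (s / k / 2)))).
  apply: (primitive_homo hphi).
  have -> : E * (s / k / 2) = s * (E / (2 * k)) by field; rewrite gt_eqF.
  apply: ler_wpM2l => //.
  by rewrite -[leLHS]mul1r ler_pdivrMr// mulrAC ler_pdivlMr ?mulr_gt0// mul1r.
apply: (le_trans (primitive_scale_le hphi E1 sk0)).
by rewrite ler_wpM2l ?powR_ge0//; apply: primitive_half; rewrite divr_ge0// ltW.
Qed.

End scaling.

Section gains.
Context {R : realType}.
Implicit Types (g h : R -> R) (a G s t : R).

Lemma class_K_powR a : 0 < a -> class_K (fun s : R => s `^ a).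
Proof.
move=> a0; split.
- by apply/within_continuousP; exact: powR_cont_on.
- by rewrite powR0// gt_eqF.
- by move=> s t; rewrite !inE => s0 t0; apply: gt0_ltr_powR; rewrite ?nnegrE.
Qed.

Lemma class_K_linear G : 0 < G -> class_K (fun s : R => G * s).
Proof.
move=> G0; split; last 2 first.
- by rewrite mulr0.
- by move=> s t _ _ st; rewrite ltr_pM2l.
apply/within_continuousP; apply: cont_on_mul; first exact: cont_on_cst.
by apply: continuous_cont_onT => s; exact: cvg_id.
Qed.

Lemma class_K_ge0 g s : class_K g -> 0 <= s -> 0 <= g s.
Proof.
move=> [_ g0 gm]; rewrite le_eqVlt => /predU1P[<-|s0]; first by rewrite g0.
by rewrite -g0 ltW// gm// inE// ltW.
Qed.

Lemma class_K_add g h : class_K g -> class_K h -> class_K (fun s => g s + h s).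
Proof.
move=> [/within_continuousP cg g0 gm] [/within_continuousP ch h0 hm]; split.
- by apply/within_continuousP; exact: cont_on_add.
- by rewrite g0 h0 addr0.
- by move=> s t s0 t0 st; rewrite ltrD ?gm ?hm.
Qed.

Lemma class_K_comp g h : class_K g -> class_K h -> class_K (g \o h).
Proof.
move=> Kg Kh; have hp s : 0 <= s -> 0 <= h s by exact: class_K_ge0.
case: Kg Kh => [/within_continuousP cg g0 gm] [/within_continuousP ch h0 hm]; split.
- apply/within_continuousP; exact: (cont_on_comp cg ch hp).
- by rewrite /= h0.
- by move=> s t s0 t0 st; apply: gm; rewrite ?inE ?hp// hm.
Qed.

Lemma class_K_root a G : 0 < a -> 0 < G -> class_K (fun s : R => (G * s) `^ a^-1).
Proof.
move=> a0 G0; have ai0 : 0 < a^-1 by rewrite invr_gt0.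
exact: (class_K_comp (class_K_powR ai0) (class_K_linear G0)).
Qed.

End gains.

Lemma modular_Rintegral {R : realType} {disp : measure_display} {T : measurableType disp}
    (mu : {measure set T -> \bar R}) (Phi : R -> R) D (u : T -> R) : measurable D ->
  mu.-integrable D (EFin \o (fun x => Phi `|u x|)) ->
  modular mu Phi D u = (\int[mu]_(x in D) Phi `|u x|)%:E.
Proof. by move=> mD iu; rewrite /modular /Rintegral fineK//; exact: integrable_fin_num. Qed.

Lemma integrable_scaleR {R : realType} {disp : measure_display} {T : measurableType disp}
    (mu : {measure set T -> \bar R}) D (a : R) (f : T -> R) : measurable D ->
  mu.-integrable D (EFin \o f) -> mu.-integrable D (EFin \o (fun x => a * f x)).
Proof. by move=> mD fi; exact: (integrableZl mD a fi). Qed.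

Section iss_estimates.
Context {R : realType} {m : nat}.
Local Notation V := ('rV[R]_m.+1).
Implicit Types (s t T k : R) (q : \bar R) (d f : V * R -> R).
Variables (Omega : set V) (sigma : {measure set V -> \bar R}) (S : system R m)
  (d0 d1 alo ahi clo psilo : R) (mu : V * R -> R).
Hypotheses (hO : smooth_bounded_domain Omega) (hs : is_surface_measure Omega sigma)
  (hS : system_C2 Omega S) (d00 : 0 < d0) (d10 : 0 < d1) (h11 : condA11 Omega S alo ahi)
  (h21 : condA21 Omega S mu) (h23 : condA23 Omega S mu d0 d1 clo)
  (h32 : condA32 Omega S d0 d1 psilo).
Local Notation leb := (lebesgue_row R m.+1).

Let oOmega : open Omega. Proof. by case: hO. Qed.
Let bOmega : bounded_set Omega. Proof. by case: hO. Qed.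
Let mO : measurable Omega. Proof. exact: open_measurable_row. Qed.
Let mbd : measurable (bdry Omega).
Proof. by apply: closed_measurable_row; exact: closed_bdry. Qed.
Let fO : (leb Omega < +oo)%E. Proof. exact: domain_finite. Qed.
Let cO : compact (closure Omega). Proof. exact: compact_closure_domain. Qed.
Let Ocl : Omega `<=` closure Omega. Proof. exact: subset_closure. Qed.
Let Bcl : bdry Omega `<=` closure Omega. Proof. by move=> x []. Qed.

Lemma decay_estimate : exists C0, 0 < C0 /\ forall phi, orlicz_density phi d0 d1 ->
  forall w0 d f w, admissible_data Omega S w0 d f -> classical_solution Omega S w0 d f w ->
  forall lam T, lam <= clo * (1 + d0) -> 0 < T ->
  \int[leb]_(x in Omega) orlicz_primitive phi `|w (x, T)| <=
  expR (- lam * T) * \int[leb]_(x in Omega) orlicz_primitive phi `|w0 x| +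
  C0 * (\int[lebesgue_measure]_(t in `[0, T]) (decay lam T t * modular_time phi sigma (bdry
      Omega) d t)
    + \int[lebesgue_measure]_(t in `[0, T]) (decay lam T t * modular_time phi leb Omega f t)).
Proof.
have [C0 [C00 hE]] := energy_estimate hO hs hS d00 d10 h11 h21 h23 h32.
exists C0; split => // phi hphi w0 d f w adm sol lam T lamle T0.
have [_ hd hf _] := adm.
have := hE phi hphi w0 d f w adm sol T T0.
set lam0 := clo * (1 + d0) in lamle *.
set md := modular_time phi sigma (bdry Omega) d.
set mf := modular_time phi leb Omega f.
set E := \int[leb]_(x in Omega) _; set E0 := \int[leb]_(x in Omega) _ => hT.
have md0 t : 0 <= md t by exact: (modular_time_ge0 hphi).
have mf0 t : 0 <= mf t by exact: (modular_time_ge0 hphi).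
have cd := md_cont hO hs hphi hd (lexx 0) (ltW T0).
have cf := mf_cont hO hphi hf (lexx 0) (ltW T0).
have ck a : cont_on [set t : R | 0 <= t <= T] (decay a T).
  by apply: continuous_cont_onT; exact: decay_continuous.
have E00 : 0 <= E0 by apply: Rintegral_ge0 => x _; exact: (primitive_ge0 hphi).
have pw (t : R) : t <= T -> expR (- lam0 * T) * (expR (lam0 * t) * (md t + mf t)) <=
    decay lam T t * md t + decay lam T t * mf t.
  move=> tT; rewrite mulrA -expRD -mulrDr; apply: ler_wpM2r; first exact: addr_ge0 (md0 t) (mf0 t).
  rewrite ler_expR.
  have -> : - lam0 * T + lam0 * t = - lam0 * (T - t) by ring.
  by rewrite ler_wpM2r ?subr_ge0// lerN2.
have id := cont_on_itv_integrable (cont_on_mul (ck lam) cd).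
have iff := cont_on_itv_integrable (cont_on_mul (ck lam) cf).
have ce : cont_on [set t : R | 0 <= t <= T] (fun t => expR (lam0 * t) * (md t + mf t)).
  apply: cont_on_mul; last exact: cont_on_add.
  apply: (@cont_on_comp _ _ _ _ setT (fun t : R => lam0 * t) (@expR R)) => //.
    by apply: continuous_cont_onT; exact: continuous_expR.
  by apply: cont_on_mul; [exact: cont_on_cst|apply: continuous_cont_onT => t; exact: cvg_id].
have iee := cont_on_itv_integrable ce.
have h1 : E <= expR (- lam0 * T) * (E0 + C0 * \int[lebesgue_measure]_(t in `[0,
    T]) (expR (lam0 * t) * (md t + mf t))).
  rewrite -(ler_pM2l (expR_gt0 (lam0 * T))) mulrA -expRD mulNr subrr expR0 mul1r.
  exact: hT.
apply: (le_trans h1); rewrite mulrDr; apply: lerD.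
  by rewrite ler_wpM2r// ler_expR ler_wpM2r ?(ltW T0)// lerN2.
rewrite mulrCA ler_wpM2l ?(ltW C00)//.
rewrite -RintegralD//.
rewrite -RintegralZl//.
have mI : measurable (`[0, T]%classic : set R) by exact: measurable_itv.
apply: le_Rintegral => //.
- apply: cont_on_itv_integrable; apply: cont_on_mul => //; exact: cont_on_cst.
- by apply: cont_on_itv_integrable; apply: cont_on_add; exact: cont_on_mul.
move=> t; rewrite /= in_itv /= => /andP[t0 tT].
exact: pw.
Qed.

Lemma boundary_integrable phi d t : orlicz_density phi d0 d1 -> C2_closure (cylinder Omega) d ->
  0 <= t -> sigma.-integrable (bdry Omega) (EFin \o (fun x => orlicz_primitive phi `|d (x, t)|)).
Proof.
move=> hphi hd t0; apply: (cont_integrable_bdry hO hs) => //.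
apply: (@cont_on_comp _ _ _ _ setT (fun x => d (x, t)) (fun r => orlicz_primitive phi `|r|)) => //.
  by apply: continuous_cont_onT; exact: (primitive_abs_continuous hphi).
apply: (cont_onW Bcl); apply: (cont_on_slice (I := [set t : R | 0 <= t])) => //.
exact: C2_closure_cont_on.
Qed.

Lemma domain_integrable phi (u : V -> R) : orlicz_density phi d0 d1 -> cont_on (closure Omega) u ->
  leb.-integrable Omega (EFin \o (fun x => orlicz_primitive phi `|u x|)).
Proof.
move=> hphi cu; apply: cont_integrable_domain => //.
apply: (@cont_on_comp _ _ _ _ setT u (fun r => orlicz_primitive phi `|r|)) => //.
by apply: continuous_cont_onT; exact: (primitive_abs_continuous hphi).
Qed.

Let slice_cont f t : 0 <= t -> C2_closure (cylinder Omega) f ->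
  cont_on (closure Omega) (fun x => f (x, t)).
Proof.
move=> t0 hf; apply: (cont_on_slice (I := [set t : R | 0 <= t])) => //=.
exact: C2_closure_cont_on.
Qed.

Lemma boundary_modular phi d t : orlicz_density phi d0 d1 -> C2_closure (cylinder Omega) d ->
  0 <= t -> modular sigma (orlicz_primitive phi) (bdry Omega) (fun x => d (x, t)) =
            (modular_time phi sigma (bdry Omega) d t)%:E.
Proof.
by move=> hphi hd t0; apply: modular_Rintegral => //; exact: boundary_integrable.
Qed.

Lemma domain_modular phi (u : V -> R) : orlicz_density phi d0 d1 -> cont_on (closure Omega) u ->
  modular leb (orlicz_primitive phi) Omega u = (\int[leb]_(x in Omega) orlicz_primitive phi `|u
      x|)%:E.
Proof.
by move=> hphi cu; apply: modular_Rintegral => //; exact: domain_integrable.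
Qed.

Lemma boundary_Lq_modular phi d q T : orlicz_density phi d0 d1 -> C2_closure (cylinder Omega) d ->
  Lq_modular sigma (orlicz_primitive phi) (bdry Omega) q d T =
  ('N[lebesgue_measure]_q[(fun t => (modular_time phi sigma (bdry Omega) d t)%:E) \_ `]0%R, T[])%E.
Proof.
move=> hphi hd; rewrite /Lq_modular; congr Lnorm; apply/funext => t.
rewrite !patchE; case: ifPn => // /set_mem /=; rewrite in_itv /= => /andP[t0 _].
by rewrite boundary_modular// ltW.
Qed.

Lemma domain_Lq_modular phi f q T : orlicz_density phi d0 d1 -> C2_closure (cylinder Omega) f ->
  Lq_modular leb (orlicz_primitive phi) Omega q f T =
  ('N[lebesgue_measure]_q[(fun t => (modular_time phi leb Omega f t)%:E) \_ `]0%R, T[])%E.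
Proof.
move=> hphi hf; rewrite /Lq_modular; congr Lnorm; apply/funext => t.
rewrite !patchE; case: ifPn => // /set_mem /=; rewrite in_itv /= => /andP[t0 _].
by rewrite domain_modular//; apply: slice_cont => //; exact: ltW.
Qed.

Lemma data_Lq phi w0 d f lam q T : orlicz_density phi d0 d1 -> admissible_data Omega S w0 d f ->
  0 < lam -> 0 < T -> (1 <= q)%E ->
  ((\int[lebesgue_measure]_(t in `[0, T]) (decay lam T t * modular_time phi sigma (bdry Omega) d
      t))%:E
    <= (conjugate_factor lam q)%:E * Lq_modular sigma (orlicz_primitive phi) (bdry Omega) q d
        T)%E /\
  ((\int[lebesgue_measure]_(t in `[0, T]) (decay lam T t * modular_time phi leb Omega f t))%:E
    <= (conjugate_factor lam q)%:E * Lq_modular leb (orlicz_primitive phi) Omega q f T)%E.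
Proof.
move=> hphi [_ hd hf _] l0 T0 q1; rewrite boundary_Lq_modular// domain_Lq_modular//; split.
- apply: decay_Lq => // [|t]; first exact: (md_cont hO hs hphi hd (lexx 0) (ltW T0)).
  exact: (modular_time_ge0 hphi).
- apply: decay_Lq => // [|t]; first exact: (mf_cont hO hphi hf (lexx 0) (ltW T0)).
  exact: (modular_time_ge0 hphi).
Qed.

Lemma decay_estimate_Lq : exists C0, 0 < C0 /\ forall phi, orlicz_density phi d0 d1 ->
  forall w0 d f w, admissible_data Omega S w0 d f -> classical_solution Omega S w0 d f w ->
  forall lam q T, 0 < lam <= clo * (1 + d0) -> (1 <= q)%E -> 0 < T ->
  (modular leb (orlicz_primitive phi) Omega (fun x => w (x, T)) <=
   (expR (- lam * T))%:E * modular leb (orlicz_primitive phi) Omega w0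
   + (C0 * conjugate_factor lam q)%:E * Lq_modular sigma (orlicz_primitive phi) (bdry Omega) q d T
   + (C0 * conjugate_factor lam q)%:E * Lq_modular leb (orlicz_primitive phi) Omega q f T)%E.
Proof.
have [C0 [C00 hE]] := decay_estimate.
exists C0; split => // phi hphi w0 d f w adm sol lam q T /andP[l0 lle] q1 T0.
have [hd hf] := data_Lq hphi adm l0 T0 q1.
have [[/within_continuousP cw0 _ _ _ _] _ _ _] := adm.
have cwT : cont_on (closure Omega) (fun x => w (x, T)).
  apply: (cont_on_slice (I := [set t : R | 0 <= t])) => //=; first exact: ltW.
  exact: (solution_cont_on sol).
rewrite !domain_modular//.
have h := hE phi hphi w0 d f w adm sol lam T lle T0.
apply: (@le_trans _ _ (_ : R)%:E); first by rewrite lee_fin; exact: h.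
rewrite EFinD EFinM -addeA; apply: leeD => //.
rewrite mulrDr EFinD !(EFinM C0) -!muleA.
by apply: leeD; apply: lee_wpmul2l => //; rewrite lee_fin ltW.
Qed.

End iss_estimates.

(** The unit value of the modular is budgeted as one half for the initial datum and one quarter for
    each disturbance. *)
Lemma half_quarters {R : realFieldType} (x y z a : R) :
  x <= 2^-1 -> a * y <= 4^-1 -> a * z <= 4^-1 -> x + a * (y + z) <= 1.
Proof. by rewrite mulrDr; lra. Qed.

Section iss_bounds.
Context {R : realType} {m : nat}.
Local Notation V := ('rV[R]_m.+1).
Implicit Types (s t T k : R) (q : \bar R) (d f : V * R -> R).
Variables (Omega : set V) (sigma : {measure set V -> \bar R}) (S : system R m)
  (d0 d1 alo ahi clo psilo : R) (mu : V * R -> R).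
Hypotheses (hO : smooth_bounded_domain Omega) (hs : is_surface_measure Omega sigma)
  (hS : system_C2 Omega S) (h11 : condA11 Omega S alo ahi)
  (h21 : condA21 Omega S mu) (h23 : condA23 Omega S mu d0 d1 clo)
  (h32 : condA32 Omega S d0 d1 psilo).
Variable phi : R -> R.
Hypothesis hphi : orlicz_density phi d0 d1.
Local Notation leb := (lebesgue_row R m.+1).
Local Notation Phi := (orlicz_primitive phi).

Let d00 : 0 < d0. Proof. exact: (density_d0 hphi). Qed.
Let d10 : 0 < d1. Proof. exact: (density_d1 hphi). Qed.
Let clo0 : 0 < clo. Proof. by case: h23. Qed.
Let p0 : 0 < 1 + d0. Proof. by rewrite addr_gt0. Qed.
Let p1 : 0 < 1 + d1. Proof. by rewrite addr_gt0. Qed.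
Let lam0 : 0 < clo * (1 + d0). Proof. by rewrite mulr_gt0. Qed.
Let oOmega : open Omega. Proof. by case: hO. Qed.
Let bOmega : bounded_set Omega. Proof. by case: hO. Qed.
Let mO : measurable Omega. Proof. exact: open_measurable_row. Qed.
Let mbd : measurable (bdry Omega).
Proof. by apply: closed_measurable_row; exact: closed_bdry. Qed.
Let fO : (leb Omega < +oo)%E. Proof. exact: domain_finite. Qed.
Let cO : compact (closure Omega). Proof. exact: compact_closure_domain. Qed.
Let Ocl : Omega `<=` closure Omega. Proof. exact: subset_closure. Qed.

Let Lq_fine (nu : {measure set V -> \bar R}) D q v T : 0 < T -> Lq_loc_class nu Phi D q v ->
  Lq_modular nu Phi D q v T = (fine (Lq_modular nu Phi D q v T))%:E.
Proof. by move=> T0 h; rewrite fineK// ge0_fin_numE ?h// Lnorm_ge0. Qed.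

Let Lq_fine_ge0 (nu : {measure set V -> \bar R}) D q v T : 0 <= fine (Lq_modular nu Phi D q v T).
Proof. by apply: fine_ge0; exact: Lnorm_ge0. Qed.

(** The full rate [clo * (1 + d0)] is available here, with [M0 = 1] and linear gains: a fixed
    constant suffices, so no [eps] is given up. *)
Lemma ISS_class q : (1 <= q)%E -> exp_ISS_class Omega sigma S Phi q.
Proof.
move=> q1.
have [C0 [C00 hE]] := decay_estimate_Lq hO hs hS d00 d10 h11 h21 h23 h32.
have cf0 := conjugate_factor_gt0 lam0 q1.
have G0 := mulr_gt0 C00 cf0.
exists 1, (clo * (1 + d0)), ( *%R (C0 * conjugate_factor (clo * (1 + d0)) q)),
  ( *%R (C0 * conjugate_factor (clo * (1 + d0)) q)); split => //; try exact: class_K_linear.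
move=> w0 d f w [adm sol hd hf] T T0.
have ll : 0 < clo * (1 + d0) <= clo * (1 + d0) by rewrite lam0 lexx.
have := hE phi hphi w0 d f w adm sol _ q T ll q1 T0.
by rewrite (Lq_fine T0 hd) (Lq_fine T0 hf) mul1r /ISS_gain -!EFinM -addeA -EFinD.
Qed.

(** An infimum over an empty set would carry no information about [w0]. The level
    [l = 1 + Phi B * v] works, because [Phi (B / l) <= Phi B / l] for [l >= 1]. *)
Lemma luxemburg_nonempty (u : V -> R) : cont_on (closure Omega) u ->
  exists2 k, 0 < k & (modular leb Phi Omega (fun x => u x / k)%R <= 1)%E.
Proof.
move=> cu; have [B B0 hB] := cont_on_bounded cO cu.
pose v := fine (leb Omega); pose l := 1 + Phi B * v.
have v0 : 0 <= v by apply: fine_ge0; exact: measure_ge0.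
have PB := primitive_ge0 hphi B.
have l1 : 1 <= l by rewrite lerDl mulr_ge0.
have l0 : 0 < l := lt_le_trans ltr01 l1.
have hl : Phi (B / l) <= Phi B / l.
  rewrite ler_pdivlMr// mulrC.
  have -> : Phi B = Phi (l * (B / l)) by rewrite mulrC divfK// gt_eqF.
  apply: le_trans (primitive_scale_ge hphi l1 _); last by rewrite divr_ge0// ltW.
  rewrite ler_wpM2r ?(primitive_ge0 hphi)//.
  by apply: le1r_powR => //; rewrite lerDl ltW.
have cul : cont_on (closure Omega) (fun x => u x / l).
  by apply: cont_on_mul => //; exact: cont_on_cst.
exists l => //; rewrite (domain_modular hO hphi cul) lee_fin.
have ifn : (leb Omega) \is a fin_num by rewrite ge0_fin_numE.
apply: (@le_trans _ _ (\int[leb]_(x in Omega) (Phi B / l))).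
  apply: le_Rintegral => //; first exact: (domain_integrable hO hphi cul).
    by apply: cont_integrable_domain => //; exact: cont_on_cst.
  move=> x Ox; apply: le_trans hl; apply: (primitive_homo hphi).
  by rewrite normrM (ger0_norm (_ : 0 <= l^-1)) ?invr_ge0 ?(ltW l0)// ler_wpM2r ?invr_ge0 ?(ltW
      l0)// hB//; exact: Ocl.
rewrite Rintegral_cst// -/v mulrAC ler_pdivrMr// mul1r.
by rewrite /l lerDr.
Qed.

(* The energy estimate is applied to the density [rescale phi k], whose
   primitive is [Phi (s / k)]: the constant does not depend on the density. *)
Lemma luxemburg_decay q : (1 <= q)%E -> exists2 G, 0 < G &
  forall w0 d f w, disturbed_solution Omega sigma S Phi q w0 d f w -> forall T, 0 < T ->
  forall k l, 0 < k -> 0 < l ->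
  (modular leb Phi Omega (fun x => w0 x / k)%R <= 1)%E ->
  2 * k <= expR (clo * (1 + d0) / (1 + d1) * T) * l ->
  4 * (G * fine (Lq_modular sigma Phi (bdry Omega) q d T)) <= Num.min (l `^ (1 + d0)) (l `^ (1 +
      d1)) ->
  4 * (G * fine (Lq_modular leb Phi Omega q f T)) <= Num.min (l `^ (1 + d0)) (l `^ (1 + d1)) ->
  (modular leb Phi Omega (fun x => w (x, T) / l)%R <= 1)%E.
Proof.
move=> q1.
have [C0 [C00 hE]] := decay_estimate hO hs hS d00 d10 h11 h21 h23 h32.
set lam := clo * (1 + d0).
have cf0 := conjugate_factor_gt0 lam0 q1.
exists (C0 * conjugate_factor lam q); first exact: mulr_gt0.
move=> w0 d f w [adm sol hd hf] T T0 k l k0 l0 hk kl.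
set a := Num.min _ _; set Jd := fine (Lq_modular sigma _ _ _ _ _); set Jf := fine _ => had haf.
have a0 : 0 < a by rewrite lt_min !powR_gt0.
have [dC fC] : C2_closure (cylinder Omega) d /\ C2_closure (cylinder Omega) f by case: adm.
have hr := orlicz_density_rescale hphi l0.
have RE v : orlicz_primitive (rescale phi l) `|v| = Phi (`|v| / l) by exact: (primitive_rescale
    hphi l0).
have absl v : `|v / l| = `|v| / l by rewrite normrM (ger0_norm (_ : 0 <= l^-1)) ?invr_ge0 ?(ltW l0).
have cw0 : cont_on (closure Omega) w0 by case: adm => -[/within_continuousP].
have cwT : cont_on (closure Omega) (fun x => w (x, T)).
  apply: (cont_on_slice (I := [set t : R | 0 <= t])) => //=; first exact: ltW.
  exact: (solution_cont_on sol).
have cwl : cont_on (closure Omega) (fun x => w (x, T) / l).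
  by apply: cont_on_mul => //; exact: cont_on_cst.
have cw0k : cont_on (closure Omega) (fun x => w0 x / k).
  by apply: cont_on_mul => //; exact: cont_on_cst.
rewrite (domain_modular hO hphi cwl) lee_fin.
have -> : \int[leb]_(x in Omega) Phi `|w (x, T) / l| =
    \int[leb]_(x in Omega) orlicz_primitive (rescale phi l) `|w (x, T)|.
  by apply: eq_Rintegral => x _; rewrite RE absl.
apply: (le_trans (hE _ hr w0 d f w adm sol lam T (lexx _) T0)).
(* Passing to the rescaled density divides the modular of a disturbance at least by [a], the smaller
   of the two powers of [l]. *)
have dle t : 0 <= t <= T -> a * modular_time (rescale phi l) sigma (bdry Omega) d t <=
    modular_time phi sigma (bdry Omega) d t.
  move=> /andP[t0 _]; rewrite /modular_time -RintegralZl//;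
      last exact: (boundary_integrable hO hs hr dC).
  apply: le_Rintegral => //.
  - by apply: integrable_scaleR => //; exact: (boundary_integrable hO hs hr dC).
  - exact: (boundary_integrable hO hs hphi dC).
  move=> x _; rewrite RE; apply: (primitive_div_le hphi) => //; first exact: ltW.
    by rewrite ge_min lexx.
  by rewrite ge_min lexx orbT.
have fle t : 0 <= t <= T -> a * modular_time (rescale phi l) leb Omega f t <=
    modular_time phi leb Omega f t.
  move=> /andP[t0 _].
  have cft : cont_on (closure Omega) (fun x => f (x, t)).
    apply: (cont_on_slice (I := [set t : R | 0 <= t])) => //=.
    exact: C2_closure_cont_on.
  rewrite /modular_time -RintegralZl//; last exact: (domain_integrable hO hr cft).
  apply: le_Rintegral => //.
  - by apply: integrable_scaleR => //; exact: (domain_integrable hO hr cft).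
  - exact: (domain_integrable hO hphi cft).
  move=> x _; rewrite RE; apply: (primitive_div_le hphi) => //; first exact: ltW.
    by rewrite ge_min lexx.
  by rewrite ge_min lexx orbT.
have [hLd hLf] := data_Lq hO hs hphi adm lam0 T0 q1.
rewrite (Lq_fine T0 hd) -EFinM lee_fin -/Jd in hLd.
rewrite (Lq_fine T0 hf) -EFinM lee_fin -/Jf in hLf.
have Id := le_decay_Rintegral lam (md_cont hO hs hr dC (lexx 0) (ltW T0))
  (md_cont hO hs hphi dC (lexx 0) (ltW T0)) dle.
have If := le_decay_Rintegral lam (mf_cont hO hr fC (lexx 0) (ltW T0))
  (mf_cont hO hphi fC (lexx 0) (ltW T0)) fle.
have quarter (c I I' J : R) : a * I <= I' -> I' <= c * J -> 4 * (C0 * c * J) <= a -> C0 * I <= 4^-1.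
  move=> h1 h2 h3; rewrite -(ler_pM2l a0).
  apply: (@le_trans _ _ (C0 * (c * J))); last first.
    by rewrite mulrA -[leLHS](mulKf (_ : 4 != 0 :> R))// mulrC ler_wpM2r.
  by rewrite mulrCA ler_wpM2l ?(ltW C00)// (le_trans h1).
have Qd := quarter _ _ _ _ Id hLd had.
have Qf := quarter _ _ _ _ If hLf haf.
have half : expR (- lam * T) * \int[leb]_(x in Omega) orlicz_primitive (rescale phi l) `|w0 x| <=
    2^-1.
  move: hk; rewrite (domain_modular hO hphi cw0k) lee_fin => hk.
  rewrite -RintegralZl//; last exact: (domain_integrable hO hr cw0).
  apply: (@le_trans _ _ (\int[leb]_(x in Omega) (2^-1 * Phi `|w0 x / k|))).
    apply: le_Rintegral => //.
    - by apply: integrable_scaleR => //; exact: (domain_integrable hO hr cw0).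
    - by apply: integrable_scaleR => //; exact: (domain_integrable hO hphi cw0k).
    move=> x _; rewrite RE normrM (ger0_norm (_ : 0 <= k^-1)) ?invr_ge0 ?(ltW k0)//.
    have E1 : 1 <= expR (lam / (1 + d1) * T).
      by rewrite -[leLHS]expR0 ler_expR mulr_ge0 ?(ltW T0) ?divr_ge0 ?(ltW lam0) ?(ltW p1).
    have := primitive_scale_half hphi E1 k0 l0 (normr_ge0 (w0 x)) kl.
    rewrite -expRM.
    have -> : lam / (1 + d1) * T * (1 + d1) = lam * T by field; rewrite gt_eqF.
    by rewrite mulNr expRN ler_pdivrMl ?expR_gt0// (mulrC 2^-1).
  rewrite RintegralZl//; last exact: (domain_integrable hO hphi cw0k).
  by rewrite -[leRHS]mulr1 ler_wpM2l.
exact: half_quarters half Qd Qf.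
Qed.

(** The rate is divided by [1 + d1], the price of passing from the modular to the norm, and the
    overshoot 2 leaves half of the unit modular to the disturbances. *)
Lemma ISS_norm q : (1 <= q)%E -> exp_ISS_norm Omega sigma S Phi q.
Proof.
move=> q1; have [G G0 hG] := luxemburg_decay q1.
(* One root for each power of [l] in the condition of [luxemburg_decay]: a level above their sum
   satisfies both, whether it is smaller or larger than 1. *)
pose g (s : R) := (4 * G * s) `^ (1 + d0)^-1 + (4 * G * s) `^ (1 + d1)^-1.
have G40 : 0 < 4 * G by rewrite mulr_gt0.
have Kg : class_K g by apply: class_K_add; exact: class_K_root.
pose lam := clo * (1 + d0) / (1 + d1).
exists 2, lam, g, g; split => //; first by rewrite divr_gt0.
move=> w0 d f w sol T T0; rewrite /ISS_gain.
have := hG w0 d f w sol T T0.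
set Jd := fine (Lq_modular sigma _ _ _ _ _); set Jf := fine _ => hT.
have Jd0 : 0 <= Jd by exact: Lq_fine_ge0.
have Jf0 : 0 <= Jf by exact: Lq_fine_ge0.
have g0 s : 0 <= s -> 0 <= g s by exact: class_K_ge0.
have gle s l : 0 <= s -> 0 < l -> g s <= l -> 4 * (G * s) <= Num.min (l `^ (1 + d0)) (l `^ (1 +
    d1)).
  move=> s0 l0 gl; rewrite mulrA; have x0 : 0 <= 4 * G * s by rewrite mulr_ge0// ltW.
  have root p : 0 < p -> (4 * G * s) `^ p^-1 <= l -> 4 * G * s <= l `^ p.
    move=> pp h; have := @ge0_ler_powR _ p (ltW pp) _ _ _ _ h.
    by rewrite -powRrM mulVf ?gt_eqF// powRr1//; apply; rewrite nnegrE ?powR_ge0// ltW.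
  rewrite le_min !root//; apply: le_trans gl; rewrite /g ?lerDl ?lerDr; exact: powR_ge0.
have key k : 0 < k -> (modular leb Phi Omega (fun x => w0 x / k)%R <= 1)%E ->
    luxemburg leb Phi Omega (fun x => w (x, T)) <= 2 * expR (- lam * T) * k + (g Jd + g Jf).
  move=> k0 hk; set l := _ + _.
  have e0 : 0 < 2 * expR (- lam * T) * k by rewrite !mulr_gt0// expR_gt0.
  have l0 : 0 < l by rewrite ltr_wpDr// addr_ge0// g0.
  apply: ge_inf.
    by exists 0 => x [/ltW].
  have h1 : 2 * k <= expR (lam * T) * l.
    apply: (@le_trans _ _ (expR (lam * T) * (2 * expR (- lam * T) * k))).
      have -> : expR (lam * T) * (2 * expR (- lam * T) * k) = expR (lam * T) * expR (- lam * T) *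
          (2 * k) by ring.
      by rewrite -expRD mulNr subrr expR0 mul1r.
    by rewrite ler_wpM2l ?expR_ge0// lerDl addr_ge0// g0.
  have h2 : g Jd <= l by rewrite /l addrCA lerDl addr_ge0 ?(ltW e0)// g0.
  have h3 : g Jf <= l by rewrite /l addrA lerDr addr_ge0 ?(ltW e0)// g0.
  have h4 := gle Jd l Jd0 l0 h2; have h5 := gle Jf l Jf0 l0 h3.
  by split; [exact: l0|exact: (hT k l k0 l0 hk h1 h4 h5)].
(* Every admissible level [k] of [w0] bounds the norm at time [T]; the infimum over [k] is taken
   last, after the gains have been moved to the left. *)
rewrite -lerBlDr.
have e0 : 0 < 2 * expR (- lam * T) by rewrite mulr_gt0// expR_gt0.
rewrite -ler_pdivrMl//; apply: lb_le_inf.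
  have [[/within_continuousP cw0 _ _ _ _] _ _ _] : admissible_data Omega S w0 d f by case: sol.
  by have [k k0 hk] := luxemburg_nonempty cw0; exists k.
by move=> k [k0 hk]; rewrite ler_pdivrMl// lerBlDr; exact: key.
Qed.

End iss_bounds.

Theorem theorem4p3 (R : realType) (m : nat) (Omega : set 'rV[R]_m.+1)
  (sigma : {measure set 'rV[R]_m.+1 -> \bar R}) (S : system R m)
  (phi : R -> R) (delta0 delta1 alo ahi clo psilo : R) (mu1 : R -> R)
  (mu3 mu : 'rV[R]_m.+1 * R -> R) :
  smooth_bounded_domain Omega ->
  is_surface_measure Omega sigma ->
  system_C2 Omega S ->
  orlicz_density phi delta0 delta1 ->
  condA11 Omega S alo ahi ->
  condA12 Omega S mu1 ->
  condA14 Omega S mu3 ->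
  condA21 Omega S mu ->
  condA23 Omega S mu delta0 delta1 clo ->
  condA32 Omega S delta0 delta1 psilo ->
  let Phi := orlicz_primitive phi in
  let leb := lebesgue_row R m.+1 in
  let C eps := delta1 * (1 + delta0) / (delta0 * (1 + delta1)) *
    ((1 + delta0) / (1 + delta1) * eps)
      `^ (- ((1 + delta0) / (delta0 * (1 + delta1)))) in
  (exists2 eps0, 0 < eps0 & forall eps, 0 < eps < eps0 ->
    let lam := clo * (1 + delta0) - eps in
    0 < lam /\
    forall (q : \bar R), (1 <= q)%E ->
    forall w0 d f w, disturbed_solution Omega sigma S Phi q w0 d f w ->
    forall T, 0 < T ->
    (modular leb Phi Omega (fun x => w (x, T))
     <= (expR (- lam * T))%:E * modular leb Phi Omega w0
        + (C eps * conjugate_factor lam q)%:E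
          * Lq_modular sigma Phi (bdry Omega) q d T
        + (C eps * conjugate_factor lam q)%:E
          * Lq_modular leb Phi Omega q f T)%E) /\
  forall (q : \bar R), (1 <= q)%E ->
    exp_ISS_class Omega sigma S Phi q /\ exp_ISS_norm Omega sigma S Phi q.
Proof.
move=> hO hs hS hphi h11 _ _ h21 h23 h32 Phi leb C.
split; last first.
  move=> q q1; split; first exact: (ISS_class hO hs hS h11 h21 h23 h32 hphi q1).
  exact: (ISS_norm hO hs hS h11 h21 h23 h32 hphi q1).
have d00 := density_d0 hphi; have d10 := density_d1 hphi.
have p0 : 0 < 1 + delta0 by rewrite addr_gt0.
have p1 : 0 < 1 + delta1 by rewrite addr_gt0.
have [clo0 _] := h23.
have [C0 [C00 hE]] := decay_estimate_Lq hO hs hS d00 d10 h11 h21 h23 h32.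
set A := delta1 * (1 + delta0) / (delta0 * (1 + delta1)) in C *.
set B := (1 + delta0) / (1 + delta1) in C *.
set x := (1 + delta0) / (delta0 * (1 + delta1)) in C *.
have A0 : 0 < A by rewrite divr_gt0// mulr_gt0.
have B0 : 0 < B by rewrite divr_gt0.
have x0 : 0 < x by rewrite divr_gt0// mulr_gt0.
(* The value of [B * eps] at which [C eps] equals [C0]. As [C] decreases in [eps], the prescribed
   constant dominates [C0] below [b / B]. *)
pose b := (A / C0) `^ x^-1.
have b0 : 0 < b by rewrite powR_gt0// divr_gt0.
exists (Num.min (clo * (1 + delta0)) (b / B)).
  by rewrite lt_min mulr_gt0//= divr_gt0.
move=> eps /andP[e0]; rewrite lt_min => /andP[e1 e2] lam.
have lam0 : 0 < lam by rewrite subr_gt0.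
split => // q q1 w0 d f w [adm sol hd hf] T T0.
have lle : 0 < lam <= clo * (1 + delta0) by rewrite lam0 gerBl ltW.
have CC : C0 <= C eps.
  have Be0 : 0 < B * eps by rewrite mulr_gt0.
  have Beb : (B * eps) `^ x <= A / C0.
    have -> : A / C0 = b `^ x.
      by rewrite -powRrM mulVf ?gt_eqF// powRr1// divr_ge0 ?(ltW A0) ?(ltW C00).
    apply: ge0_ler_powR; rewrite ?nnegrE ?(ltW x0) ?(ltW Be0) ?(ltW b0)//.
    by rewrite mulrC -ler_pdivlMr// ltW.
  rewrite /C powRN ler_pdivlMr ?powR_gt0// mulrC -ler_pdivlMr//.
apply: (le_trans (hE phi hphi w0 d f w adm sol lam q T lle q1 T0)).
have cf0 := conjugate_factor_gt0 lam0 q1.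
have CCf : ((C0 * conjugate_factor lam q)%:E <= (C eps * conjugate_factor lam q)%:E)%E.
  by rewrite lee_fin ler_wpM2r// ltW.
apply: leeD; last by apply: lee_wpmul2r => //; exact: Lnorm_ge0.
by apply: leeD => //; apply: lee_wpmul2r => //; exact: Lnorm_ge0.
Qed.
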